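(* Let $(M^n,g_0)$ and $(N^n,h)$ be two compact smooth Riemannian manifolds of dimension $n$ and let $f:M\to N$ be a smooth map such that $f^*h\leq\Lambda^2 g_0$ on $M$ for some $\Lambda>0$. Suppose $g(t)$, $t\in[0,T]$, is a smooth family of Riemannian metrics on $M$ with $g(0)=g_0$ satisfying $$\partial_t g_{ij}=2k_{ij}$$ on $M\times[0,T]$, such that $k+\mathrm{Ric}(g)\ge0$ (for $g=g(t)$, $k=k(t)$ at each time). Let $F(t):(M,g(t))\to(N,h)$, $t\in[0,T]$, be a smooth family of maps satisfying the harmonic map heat flow $$\partial_t F=\tau(F),\qquad F(0)=f,$$ where $\tau(F)$ at time $t$ is the tension field of $F(t)$ with respect to $g(t)$ and $h$. Let $\kappa\ge0$ and suppose that either one of the following holds: (i) the sectional curvature of $h$ satisfies $K(h)\le\kappa$; or (ii) the sectional curvature of $h$ is non-negative and $\mathrm{Ric}(h)\le(n-1)\kappa\, h$. Then $$\bigl(\Lambda^{-2}-2(n-1)\kappa t\bigr)\,F(t)^*h\leq g(t)$$ on $M\times[0,T]$.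
   Context: Manifolds are without boundary. Inequalities between symmetric $2$-tensors are in the sense of bilinear forms. For a smooth map $F:(M,g)\to(N,h)$, $dF$ is a section of $T^*M\otimes F^{-1}(TN)$; with $D$ the covariant derivative induced by the Levi-Civita connections of $g$ and $h$, the tension field is $\tau(F)=\mathrm{tr}_g(D\,dF)$, a vector field along $F$. *)

(* Defs.v *)
From HB Require Import structures.
From mathcomp Require Import all_boot all_order all_algebra.
From mathcomp Require Import all_classical all_reals all_analysis.

Set Implicit Arguments.
Unset Strict Implicit.
Unset Printing Implicit Defensive.

Import Order.TTheory GRing.Theory Num.Theory.
Import numFieldNormedType.Exports.

Local Open Scope classical_set_scope.
Local Open Scope ring_scope.

Section Smooth.
Context {R : realType} {V W : normedModType R}.

Definition iter_derive (vs : seq V) (f : V -> W) : V -> W :=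
  foldr (fun v (g : V -> W) x => 'D_v g x) f vs.

(* C^oo on an open set; used only for finite-dimensional V, where existence and
   continuity of all iterated directional derivatives is equivalent to
   smoothness. *)
Definition smooth_open (U : set V) (f : V -> W) : Prop :=
  forall vs x, U x ->
    {for x, continuous (iter_derive vs f)} /\
    forall v, derivable (iter_derive vs f) x v.

(* Smoothness on an arbitrary subset means local extendability to a smooth
   function; this gives smoothness up to the end points of a closed time
   interval. *)
Definition smooth_on (A : set V) (f : V -> W) : Prop :=
  forall a, A a -> exists U (fe : V -> W),
    [/\ open_nbhs a U, smooth_open U fe & forall x, A x -> U x -> fe x = f x].

End Smooth.

(* Derivative of a curve relative to a set A of times (one-sided at an end
   point of an interval). *)
Definition has_derive_within (R : realType) (W : normedModType R)
    (A : set R) (f : R -> W) (t : R) (l : W) : Prop :=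
  (fun s => (s - t)^-1 *: (f s - f t)) @ within A (t^') --> l.

Record chart (R : realType) (n : nat) (M : topologicalType) := Chart {
  chart_dom : set M;
  chart_img : set 'rV[R]_n;
  chart_map : M -> 'rV[R]_n;
  chart_inv : 'rV[R]_n -> M;
  chart_dom_open : open chart_dom;
  chart_img_open : open chart_img;
  chart_mapP : forall p, chart_dom p ->
    chart_img (chart_map p) /\ chart_inv (chart_map p) = p;
  chart_invP : forall x, chart_img x ->
    chart_dom (chart_inv x) /\ chart_map (chart_inv x) = x;
  chart_map_continuous : {within chart_dom, continuous chart_map};
  chart_inv_continuous : {within chart_img, continuous chart_inv} }.

Section LocalRep.
Context {R : realType} {n : nat} {M N : topologicalType}.
Variables (F : M -> N) (c : chart R n M) (d : chart R n N).

Definition local_rep : 'rV[R]_n -> 'rV[R]_n :=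
  fun x => chart_map d (F (chart_inv c x)).

Definition local_dom : set 'rV[R]_n :=
  [set x | chart_img c x /\ chart_dom d (F (chart_inv c x))].

End LocalRep.

(* The atlas need not be maximal: tensor fields and smooth maps are determined
   by, and can be prescribed on, any atlas of the smooth structure. *)
Record smoothManifold (R : realType) (n : nat) := SmoothManifold {
  carrier :> topologicalType;
  manifold_hausdorff : hausdorff_space carrier;
  manifold_second_countable : @second_countable carrier;
  chart_index : Type;
  chart_at : chart_index -> chart R n carrier;
  chart_cover : forall p : carrier, exists i, chart_dom (chart_at i) p;
  chart_compat : forall i j,
    smooth_on (local_dom id (chart_at i) (chart_at j))
              (local_rep id (chart_at i) (chart_at j)) }.

Arguments chart_index {R n} _.
Arguments chart_at {R n} _ _.

Section Maps.
Context {R : realType} {n : nat} {M N : smoothManifold R n}.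

Definition smooth_map (f : M -> N) : Prop :=
  continuous f /\
  forall i j, smooth_on (local_dom f (chart_at M i) (chart_at N j))
                        (local_rep f (chart_at M i) (chart_at N j)).

Definition smooth_map_family (A : set R) (F : R -> M -> N) : Prop :=
  {within A `*` setT, continuous (fun z : R * M => F z.1 z.2)} /\
  forall i j,
    smooth_on
      [set z : R * 'rV[R]_n |
        A z.1 /\ local_dom (F z.1) (chart_at M i) (chart_at N j) z.2]
      (fun z => local_rep (F z.1) (chart_at M i) (chart_at N j) z.2).

End Maps.

(* The value of the form with Gram matrix A on the pair (u, v). *)
Definition bform (R : realType) (n : nat) (A : 'M[R]_n) (u v : 'rV[R]_n) : R :=
  (u *m A *m v^T) 0 0.

Definition form_le (R : realType) (n : nat) (A B : 'M[R]_n) : Prop :=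
  forall v, bform A v v <= bform B v v.

(* A symmetric 2-tensor field, given by its component matrices in every chart
   together with the tensorial transformation law.  Library Jacobians act on
   row vectors from the right: 'd f x v = v *m jacobian f x. *)
Record symTensor (R : realType) (n : nat) (M : smoothManifold R n) := SymTensor {
  tensor_comp :> chart_index M -> 'rV[R]_n -> 'M[R]_n;
  tensor_sym : forall i x, chart_img (chart_at M i) x ->
    (tensor_comp i x)^T = tensor_comp i x;
  tensor_transform : forall i j x,
    local_dom id (chart_at M i) (chart_at M j) x ->
    let phi := local_rep id (chart_at M i) (chart_at M j) in
    tensor_comp i x =
      jacobian phi x *m tensor_comp j (phi x) *m (jacobian phi x)^T }.

Record riemMetric (R : realType) (n : nat) (M : smoothManifold R n) := RiemMetric {
  metric_tensor :> symTensor M;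
  metric_smooth : forall i,
    smooth_on (chart_img (chart_at M i)) (metric_tensor i);
  metric_pos : forall i x, chart_img (chart_at M i) x ->
    forall v, v != 0 -> 0 < bform (metric_tensor i x) v v }.

Definition smooth_metric_family (R : realType) (n : nat)
    (M : smoothManifold R n) (A : set R) (g : R -> riemMetric M) : Prop :=
  forall i, smooth_on
    [set z : R * 'rV[R]_n | A z.1 /\ chart_img (chart_at M i) z.2]
    (fun z => g z.1 i z.2).

Section Coordinates.
Context {R : realType} {n : nat}.
Implicit Types (G H : 'rV[R]_n -> 'M[R]_n) (F : 'rV[R]_n -> 'rV[R]_n).
Implicit Types (x u v w z : 'rV[R]_n) (i j k l m : 'I_n).

Definition partial i (f : 'rV[R]_n -> R) x : R := 'D_(delta_mx 0 i) f x.

(* christoffel G x k i j is Gamma^k_{ij}, for the Levi-Civita connection of the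
   metric with components G. *)
Definition christoffel G x k i j : R :=
  2^-1 * \sum_(l < n) invmx (G x) k l *
    (partial i (fun y => G y j l) x + partial j (fun y => G y i l) x
     - partial l (fun y => G y i j) x).

(* riemann G x l i j k is the l-th component of R(d_i, d_j) d_k, where
   R(X,Y)Z = D_X D_Y Z - D_Y D_X Z - D_[X,Y] Z. *)
Definition riemann G x l i j k : R :=
  partial i (fun y => christoffel G y l j k) x
  - partial j (fun y => christoffel G y l i k) x
  + \sum_(m < n) (christoffel G x l i m * christoffel G x m j k
                  - christoffel G x l j m * christoffel G x m i k).

(* <R(u,v)w, z> *)
Definition riemann_form G x u v w z : R :=
  \sum_(i < n) \sum_(j < n) \sum_(k < n) \sum_(l < n) \sum_(m < n)
    riemann G x l i j k * G x l m * u 0 i * v 0 j * w 0 k * z 0 m.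

Definition sectional G x u v : R :=
  riemann_form G x u v v u /
  (bform (G x) u u * bform (G x) v v - bform (G x) u v ^+ 2).

(* Ric(Y,Z) is the trace of X |-> R(X,Y)Z. *)
Definition ricci G x : 'M[R]_n :=
  \matrix_(j < n, k < n) \sum_(i < n) riemann G x i i j k.

(* (D xi)_{ij}^a for a section xi = xi_j^a of T^*M (x) F^{-1}(TN), where D comes
   from the Levi-Civita connections of G on M and H on N. *)
Definition cov_deriv G H F (xi : 'I_n -> 'I_n -> 'rV[R]_n -> R) x
    (i j a : 'I_n) : R :=
  partial i (xi j a) x
  - \sum_(k < n) christoffel G x k i j * xi k a x
  + \sum_(b < n) \sum_(c < n)
      christoffel H (F x) a b c * partial i (fun y => F y 0 b) x * xi j c x.

Definition map_diff F (j a : 'I_n) : 'rV[R]_n -> R :=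
  partial j (fun y => F y 0 a).

Definition tension G H F x : 'rV[R]_n :=
  \row_(a < n) \sum_(i < n) \sum_(j < n)
    invmx (G x) i j * cov_deriv G H F (map_diff F) x i j a.

Definition pullback_form H F x : 'M[R]_n :=
  jacobian F x *m H (F x) *m (jacobian F x)^T.

End Coordinates.

Section Geometry.
Context {R : realType} {n : nat} {M N : smoothManifold R n}.

Definition sectional_le (h : riemMetric N) (kappa : R) : Prop :=
  forall j y, chart_img (chart_at N j) y ->
  forall u v : 'rV[R]_n, row_free (col_mx u v) ->
    sectional (h j) y u v <= kappa.

Definition sectional_ge0 (h : riemMetric N) : Prop :=
  forall j y, chart_img (chart_at N j) y ->
  forall u v : 'rV[R]_n, row_free (col_mx u v) ->
    0 <= sectional (h j) y u v.

Definition ricci_le (h : riemMetric N) (c : R) : Prop :=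
  forall j y, chart_img (chart_at N j) y ->
    form_le (ricci (h j) y) (c *: h j y).

(* a F^*h <= b g on M *)
Definition pullback_le (a : R) (F : M -> N) (h : riemMetric N)
    (b : R) (g : riemMetric M) : Prop :=
  forall i j x, local_dom F (chart_at M i) (chart_at N j) x ->
    form_le
      (a *: pullback_form (h j) (local_rep F (chart_at M i) (chart_at N j)) x)
      (b *: g i x).

Definition eq_metric (g g' : riemMetric M) : Prop :=
  forall i x, chart_img (chart_at M i) x -> g i x = g' i x.

(* d_t g = 2 k *)
Definition metric_evolution (A : set R) (g : R -> riemMetric M)
    (k : R -> symTensor M) : Prop :=
  forall t, A t -> forall i x, chart_img (chart_at M i) x ->
    has_derive_within A (fun s => g s i x) t (2 *: k t i x).

(* k + Ric(g) >= 0 *)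
Definition plus_ricci_ge0 (k : symTensor M) (g : riemMetric M) : Prop :=
  forall i x, chart_img (chart_at M i) x ->
    form_le 0 (k i x + ricci (g i) x).

(* d_t F = tau(F).  For s in A near t the point F s p stays in the domain of
   the chart of N, so the difference quotient in that chart is meaningful. *)
Definition harmonic_map_heat_flow (A : set R) (g : R -> riemMetric M)
    (h : riemMetric N) (F : R -> M -> N) : Prop :=
  forall t, A t -> forall i j x,
    local_dom (F t) (chart_at M i) (chart_at N j) x ->
    has_derive_within A
      (fun s => local_rep (F s) (chart_at M i) (chart_at N j) x) t
      (tension (g t i) (h j)
         (local_rep (F t) (chart_at M i) (chart_at N j)) x).

End Geometry.

(* Main.v *)
From HB Require Import structures.
Require Import Defs.
From mathcomp Require Import all_boot all_order all_algebra.
From mathcomp Require Import all_classical all_reals all_analysis.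
From mathcomp Require Import perm ring lra.
Import Order.TTheory GRing.Theory Num.Theory.
Import numFieldNormedType.Exports.
Local Open Scope classical_set_scope.
Local Open Scope ring_scope.

(** Maximum principle for the defect tensor
    [Z = g(t) - phi(t) F(t)^*h], where
    [phi(t) = Lambda^-2 - e - (2 (n-1) kappa + e) t] and [e > 0]; letting [e]
    tend to 0 gives the theorem.  [Z] is positive definite at time 0.  If it
    first degenerates at time [t > 0], at a point [x] and along [v], then [Z >= 0]
    at time [t] and [v] is in the kernel of [Z] at [x].  Extend [v] to a field [V]
    with [nabla V = 0] at [x].  The function [Z(V, V)] has a minimum at [x], and
    the trace of its Hessian over a [g]-orthonormal frame [(e)] gives, with the
    Codazzi equation for the Hessian of [F],
      [phi <nabla_v tau, dF v> <= phi sum_e Rm_h(dF v, dF e, dF e, dF v) - Ric(v, v)].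
    As [phi F^*h <= g], with equality along [v], each curvature hypothesis bounds
    the sum by [(n-1) kappa F^*h(v, v) / phi].  On the other hand the left
    derivative of [Z(v, v)] in time is nonpositive, and it equals
      [2 k(v, v) - phi' F^*h(v, v) - 2 phi <nabla_v tau, dF v>
         >= e F^*h(v, v) > 0]. *)

Set Implicit Arguments.
Unset Strict Implicit.
Unset Printing Implicit Defensive.
(** * Directional derivatives and smooth functions *)

(** The factor phi may reach zero or become negative before time T. This is harmless: at a contact
    phi F^*h(v, v) = g(v, v) > 0, so phi and F^*h(v, v) are both positive there, and the curvature
    bounds are only invoked at contacts. The number e has two tasks: subtracted from Lambda^-2 it
    makes Z definite at time 0, and added to the slope of phi it makes the last inequality strict.

    Since Z >= 0, the equation Z(v, v) = 0 improves to Z(v, -) = 0. This trades phi F^*h(v, -) for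
    g(v, -), which is how the curvature of M, produced by the Codazzi equation inside h, becomes
    Ric(v, v). Under (i) the direction v itself accounts for the n - 1 in place of n; under (ii) the
    inequality phi F^*h <= g has to be dualized, because Ric(h) is a trace over a frame of N while
    the sum runs over images of a frame of M.

    Compactness of M serves to keep Z definite for a short time on all of M at once. Time
    derivatives are taken from the left, so that a contact at time T is treated like any other. *)

Lemma norm_close_half (R : realFieldType) (e x y z : R) :
  `|x - z| <= e / 2 -> `|y - z| <= e / 2 -> `|x - y| <= e.
Proof.
by move=> xz yz; rewrite (splitr e) -(subrKA z) (le_trans (ler_normD _ _))// lerD// distrC.
Qed.

Section DirectionalDerivatives.
Variables (R : realType) (E : normedModType R).
Implicit Types (f : E -> R) (x u v : E).

Lemma is_derive_line f x v (s : R) : derivable f (x + s *: v) v ->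
  is_derive s 1 (fun r : R => f (x + r *: v)) ('D_v f (x + s *: v)).
Proof.
have E1 : (fun h : R => h^-1 *: (((fun r : R => f (x + r *: v)) \o shift s) (h *: 1)
             - f (x + s *: v))) =
          (fun h => h^-1 *: ((f \o shift (x + s *: v)) (h *: v) - f (x + s *: v))).
  apply/funext => h /=; congr (_ *: (f _ - _)).
  by rewrite [h *: 1]mulr1 scalerDl addrCA addrA.
move=> d; split; first by rewrite /derivable E1.
by rewrite /derive E1.
Qed.

(** The step h may be negative, as the coordinates of an increment may be; hence only [|c| <= |h|]
    is recorded of the intermediate point. *)
Lemma derive_mvt f x v (h : R) :
  (forall s : R, `|s| <= `|h| -> derivable f (x + s *: v) v) ->
  exists2 c, `|c| <= `|h| & f (x + h *: v) - f x = 'D_v f (x + c *: v) * h.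
Proof.
move=> d.
have dl (s : R) : `|s| <= `|h| ->
    is_derive s 1 (fun r : R => f (x + r *: v)) ('D_v f (x + s *: v)).
  by move=> /d; exact: is_derive_line.
have cl (a b : R) : (forall s : R, s \in `[a, b] -> `|s| <= `|h|) ->
    {within `[a, b], continuous (fun r : R => f (x + r *: v))}.
  move=> ab; apply: derivable_within_continuous => s /ab /dl [+ _]; exact.
have [h0|h0|h0] := ltgtP 0 h.
- have ab (s : R) : s \in `[0, h] -> `|s| <= `|h|.
    by rewrite in_itv/= => /andP[s0 sh]; rewrite (ger0_norm s0) (gtr0_norm h0).
  have [|c ch e] := @MVT R _ (fun s => 'D_v f (x + s *: v)) 0 h h0 _ (cl _ _ ab).
    by move=> s sh; apply: dl; apply: ab; exact: subset_itv_oo_cc.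
  exists c; first by apply: ab; exact: subset_itv_oo_cc.
  by move: e; rewrite scale0r addr0 subr0.
- have ab (s : R) : s \in `[h, 0] -> `|s| <= `|h|.
    by rewrite in_itv/= => /andP[sh s0]; rewrite (ler0_norm s0) (ltr0_norm h0) lerN2.
  have [|c ch e] := @MVT R _ (fun s => 'D_v f (x + s *: v)) h 0 h0 _ (cl _ _ ab).
    by move=> s sh; apply: dl; apply: ab; exact: subset_itv_oo_cc.
  exists c; first by apply: ab; exact: subset_itv_oo_cc.
  by move: e; rewrite scale0r addr0 sub0r mulrN => /eqP; rewrite -eqr_oppLR opprB => /eqP.
- by exists 0; rewrite -?h0 ?lexx// scale0r addr0 subrr mulr0.
Qed.

Lemma near_plane x u v (P : set E) : nbhs x P ->
  \forall d \near (0 : R)^'+, forall a b : R, `|a| <= d -> `|b| <= d ->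
    P (x + a *: u + b *: v).
Proof.
move=> nP.
have c : (fun z : R * R => x + z.1 *: u + z.2 *: v) @ (0, 0) --> x + 0 *: u + 0 *: v.
  by apply: cvgD; [apply: cvgD; [exact: cvg_cst|apply: cvgZr_tmp; exact: cvg_fst]
                  |apply: cvgZr_tmp; exact: cvg_snd].
move: c; rewrite !scale0r !addr0 => /(_ _ nP) [[A B] [/= nA nB] AB].
move: nA nB => /nbhs_ballP[e1 /= e10 h1] /nbhs_ballP[e2 /= e20 h2].
near=> d => a b ad bd; apply: (AB (a, b)); split => /=.
  by apply: h1; rewrite /ball/= sub0r normrN; apply: le_lt_trans ad _; near: d; exact: nbhs_right_lt.
by apply: h2; rewrite /ball/= sub0r normrN; apply: le_lt_trans bd _; near: d; exact: nbhs_right_lt.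
Unshelve. all: by end_near. Qed.

(* The double difference quotient of f over a parallelogram of side d is a value of
   D_v D_u f as well as a value of D_u D_v f. *)
Lemma derive_swap f x u v :
  (\forall y \near x, [/\ derivable f y u, derivable f y v,
      derivable ('D_u f) y v & derivable ('D_v f) y u]) ->
  {for x, continuous ('D_v ('D_u f))} -> {for x, continuous ('D_u ('D_v f))} ->
  'D_v ('D_u f) x = 'D_u ('D_v f) x.
Proof.
move=> dn c1 c2.
have main (w z : E) (d : R) : 0 < d ->
    (forall a b : R, `|a| <= d -> `|b| <= d -> derivable f (x + a *: w + b *: z) w
       /\ derivable ('D_w f) (x + a *: w + b *: z) z) ->
    exists a b : R, [/\ `|a| <= d, `|b| <= d &
      f (x + d *: w + d *: z) - f (x + d *: w) - f (x + d *: z) + f x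
      = 'D_z ('D_w f) (x + a *: w + b *: z) * d * d].
  move=> d0 H; pose g y := f (y + d *: z) - f y.
  have nd : `|d| = d by rewrite gtr0_norm.
  have Ez y : (fun h : R => h^-1 *: (((fun y => f (y + d *: z)) \o shift y) (h *: w) - f (y + d *: z)))
      = (fun h => h^-1 *: ((f \o shift (y + d *: z)) (h *: w) - f (y + d *: z))).
    by apply/funext => h /=; rewrite addrA.
  have dz y : derivable f (y + d *: z) w -> derivable (fun y => f (y + d *: z)) y w.
    by rewrite /derivable Ez.
  have Dz y : 'D_w (fun y => f (y + d *: z)) y = 'D_w f (y + d *: z).
    by rewrite /derive Ez.
  have dg (s : R) : `|s| <= `|d| -> derivable g (x + s *: w) w.
    rewrite nd => sd; apply: derivableB.
      by apply: dz; apply: (H _ _ sd _).1; rewrite nd.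
    by have := (H s 0 sd _).1; rewrite scale0r addr0; apply; rewrite normr0 ltW.
  have ld : `|d| <= d by rewrite nd.
  have l0 : `|0 : R| <= d by rewrite normr0 ltW.
  have [a + ea] := derive_mvt dg; rewrite nd => ad.
  have [|b + eb] := @derive_mvt ('D_w f) (x + a *: w) z d.
    by rewrite nd => s sd; exact: (H a s ad sd).2.
  rewrite nd => bd; exists a, b; split=> //.
  rewrite -eb -[X in X * d](_ : 'D_w g (x + a *: w) = _); last first.
    have -> : g = (fun y => f (y + d *: z)) - f by [].
    rewrite deriveB; first by rewrite Dz.
      by apply: dz; exact: (H a d ad ld).1.
    by have := (H a 0 ad l0).1; rewrite scale0r addr0.
  by rewrite -ea /g; ring.
apply/eqP; rewrite -subr_eq0 -normr_le0; apply/ler_addgt0Pl => e e0; rewrite addr0.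
have e20 : 0 < e / 2 by rewrite divr_gt0.
have /cvgrPdist_le/(_ _ e20)/(near_plane u v) n1 := c1.
have /cvgrPdist_le/(_ _ e20)/(near_plane v u) n2 := c2.
have n3 := near_plane u v dn.
have n4 := near_plane v u dn.
have n0 : \forall d \near (0 : R)^'+, 0 < d by exact: nbhs_right_gt.
have [d [d0 [h1 [h2 [h3 h4]]]]] := filter_ex (filterI n0 (filterI n1 (filterI n2 (filterI n3 n4)))).
have [|a [b [ad bd e1]]] := main u v d d0.
  by move=> a b ad bd; have [] := h3 a b ad bd.
have [|a' [b' [ad' bd' e2]]] := main v u d d0.
  by move=> a' b' ad' bd'; have [] := h4 a' b' ad' bd'.
have E1 : 'D_v ('D_u f) (x + a *: u + b *: v) = 'D_u ('D_v f) (x + a' *: v + b' *: u).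
  have cancel (X Y L L' : R) : L = X * d * d -> L' = Y * d * d -> L = L' -> X = Y.
    by move=> -> ->; do 2!move/(mulIf (lt0r_neq0 d0)).
  by apply: (cancel _ _ _ _ e1 e2); rewrite (addrAC x (d *: v)); ring.
have := h2 a' b' ad' bd'; rewrite -E1; have := h1 a b ad bd.
move: ('D_v ('D_u f) x) ('D_u ('D_v f) x) ('D_v ('D_u f) (x + a *: u + b *: v)) => X Y Z.
exact: norm_close_half.
Qed.

End DirectionalDerivatives.

(** * Differentiability from continuous partial derivatives *)

Lemma differentiable_littleo (R : numFieldType) (V W : normedModType R)
    (f : V -> W) (df : {linear V -> W}) x : continuous df ->
  (forall e, 0 < e -> \forall h \near 0, `|f (h + x) - (f x + df h)| <= e * `|h|) ->
  differentiable f x.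
Proof.
move=> dfc h; have main : f \o shift x = cst (f x) + df +o_ 0 id.
  by apply/eqaddoP => e e0; apply: filterS (h e e0).
by apply/diff_locallyP; rewrite (diff_unique dfc main).
Qed.

(** One step of the telescoping sum in [differentiable_partial]: a and b are the values of f before
    and after one more coordinate is changed, c is the value at the centre, s the linear part so
    far, and d1, d2 are the partial derivatives at the centre and at the mean value point. *)
Lemma telescope_step (R : realFieldType) (k : nat) (d1 d2 s a b c e h z : R) :
  `|a - c - s| <= k%:R * (e * h) -> b - a = d2 * z -> `|d1 - d2| <= e -> `|z| <= h ->
  `|b - c - (z * d1 + s)| <= k.+1%:R * (e * h).
Proof.
move=> ih ba dd zh.
have -> : b - c - (z * d1 + s) = (a - c - s) - (d1 - d2) * z.
  by rewrite -(subrK a b) ba; ring.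
rewrite (le_trans (ler_normB _ _))// -natr1 [leRHS]mulrDl mul1r lerD// normrM.
by rewrite ler_pM.
Qed.

Section PartialDerivatives.
Variables (R : realType) (n : nat).
Implicit Types (f : 'rV[R]_n -> R) (x v : 'rV[R]_n).

Lemma coord_le_norm m p (A : 'M[R]_(m, p)) i j : `|A i j| <= `|A|.
Proof.
rewrite -[leRHS]/(mx_norm A) mx_normrE; apply: (le_bigmax _ (fun k : 'I_m * 'I_p => `|A k.1 k.2|) (i, j)).
Qed.

Lemma norm_le_coord m p (A : 'M[R]_(m, p)) (c : R) : 0 <= c ->
  (forall i j, `|A i j| <= c) -> `|A| <= c.
Proof. by move=> c0 h; rewrite -[leLHS]/(mx_norm A) mx_normrE; apply: bigmax_le => // -[i j] _; exact: h. Qed.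

Lemma near_norm x (P : set 'rV[R]_n) : nbhs x P ->
  exists2 d : R, 0 < d & forall y, `|y| < d -> P (x + y).
Proof.
move=> /nbhs_ballP[d /= d0 h]; exists d => // y yd; apply: h.
by rewrite -ball_normE/= opprD addrA subrr sub0r normrN.
Qed.

(** Pass from x to x + h through the points [x + tr k h], one coordinate at a time. By the mean
    value theorem each of the n increments is within e |h| / (n + 1) of its linear part; n + 1
    instead of n covers n = 0. *)
Lemma differentiable_partial f x :
  (forall i, \forall y \near x, derivable f y (delta_mx 0 i)) ->
  (forall i, {for x, continuous ('D_(delta_mx 0 i) f)}) ->
  differentiable f x.
Proof.
move=> dn cn; pose L (v : 'rV[R]_n) : R := \sum_i v 0 i * 'D_(delta_mx 0 i) f x.
have Llin : linear L.
  move=> a u v; rewrite /L scaler_sumr -big_split/=; apply: eq_bigr => i _.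
  by rewrite !mxE mulrDl -mulrA.
pose Lm := GRing.isLinear.Build R _ _ _ L Llin.
pose Ll : {linear 'rV[R]_n -> R} := HB.pack L Lm.
have Lc : continuous Ll.
  move=> v; have -> : (Ll : _ -> _) = \sum_i (fun v : 'rV[R]_n => v 0 i * 'D_(delta_mx 0 i) f x).
    by apply/funext => u; rewrite fct_sumE.
  apply: differentiable_continuous; apply: differentiable_sum => i.
  exact/differentiableZl/differentiable_coord.
apply: (@differentiable_littleo R 'rV[R]_n R f Ll x Lc) => e e0.
  pose Q (i : 'I_n) y := derivable f y (delta_mx 0 i) /\
      `|'D_(delta_mx 0 i) f x - 'D_(delta_mx 0 i) f y| <= e / n.+1%:R.
  have nn : \forall y \near x, forall i, Q i y.
    apply: (@filter_forall _ _ Q (nbhs x) (nbhs_filter x)) => i; apply: filterI; first exact: dn.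
    by move/cvgrPdist_le: (cn i); apply; rewrite divr_gt0.
  have [d d0 hd] := near_norm nn.
  pose tr k (h : 'rV[R]_n) := \row_(i < n) (if (i < k)%N then h 0 i else 0).
  have step (h : 'rV[R]_n) : `|h| < d -> forall k, (k <= n)%N ->
     `|f (x + tr k h) - f x - \sum_(i < n | (i < k)%N) h 0 i * 'D_(delta_mx 0 i) f x|
       <= k%:R * (e / n.+1%:R * `|h|).
    move=> hd'; elim=> [|k IH] kn.
      have -> : tr 0%N h = 0 by apply/rowP => i; rewrite !mxE.
      by rewrite addr0 subrr big_pred0// subr0 normr0 mul0r.
    pose i0 := Ordinal kn.
    have trS : tr k.+1 h = tr k h + h 0 i0 *: delta_mx 0 i0.
      apply/rowP => i; rewrite !mxE eqxx/=.
      have [->|ne] := eqVneq i i0; first by rewrite /= ltnSn ltnn add0r mulr1.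
      rewrite mulr0 addr0 ltnS leq_eqVlt; suff -> : (i == k :> nat) = false by [].
      by apply: contraNF ne => /eqP ik; apply/eqP/val_inj.
    have [|c ch ec] := @derive_mvt _ _ f (x + tr k h) (delta_mx 0 i0) (h 0 i0).
      move=> s sh; rewrite -addrA; apply: (hd _ _ i0).1; apply: le_lt_trans hd'.
      apply: norm_le_coord => // a j; rewrite !mxE (ord1 a) eqxx/=.
      case: ifP => jk; last first.
        rewrite add0r; case: eqP => [_|_]; last by rewrite mulr0 normr0.
        by rewrite mulr1 (le_trans sh)// coord_le_norm.
      rewrite (_ : (j == i0) = false) ?mulr0 ?addr0 ?coord_le_norm//.
      by apply/eqP => ji; rewrite ji ltnn in jk.
    have ch' : `|tr k h + c *: delta_mx 0 i0| < d.
      apply: le_lt_trans hd'.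
      apply: norm_le_coord => // a j; rewrite !mxE (ord1 a) eqxx/=.
      case: ifP => jk; last first.
        rewrite add0r; case: eqP => [_|_]; last by rewrite mulr0 normr0.
        by rewrite mulr1 (le_trans ch)// coord_le_norm.
      rewrite (_ : (j == i0) = false) ?mulr0 ?addr0 ?coord_le_norm//.
      by apply/eqP => ji; rewrite ji ltnn in jk.
    have [_] := hd _ ch' i0.
    have bigE : \sum_(i < n | (i < k.+1)%N) h 0 i * 'D_(delta_mx 0 i) f x =
      h 0 i0 * 'D_(delta_mx 0 i0) f x + \sum_(i < n | (i < k)%N) h 0 i * 'D_(delta_mx 0 i) f x.
      rewrite (bigD1 i0)//=; congr (_ + _); apply: eq_bigl => i.
      rewrite ltnS (leq_eqVlt i); have [->|ne] := eqVneq i i0; first by rewrite eqxx/= ltnn.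
      have -> : (i == k :> nat) = false by apply: contraNF ne => /eqP ik; apply/eqP/val_inj.
      by rewrite andbT.
    move: (IH (ltnW kn)) ec; rewrite bigE trS !addrA.
    move: (\sum_(i < n | _) _) (f (x + tr k h)) (f (x + tr k h + _)) (f x).
    move: ('D_(delta_mx 0 i0) f x) ('D_(delta_mx 0 i0) f _) => D1 D2 S a b c0 I E H.
    have h0 := coord_le_norm h 0 i0.
    exact: telescope_step I E H h0.
  near=> h.
  have hd' : `|h| < d.
    by near: h; apply/nbhs_ballP; exists d => // h; rewrite -ball_normE/= sub0r normrN.
  have := step h hd' n (leqnn n).
  have -> : tr n h = h by apply/rowP => i; rewrite mxE ltn_ord.
  rewrite (eq_bigl xpredT) => [H|i]; last by rewrite ltn_ord.
  rewrite opprD addrA (addrC h); apply: le_trans H _.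
  rewrite mulrA ler_wpM2r//.
  have -> : n%:R * (e / n.+1%:R) = e * (n%:R / n.+1%:R) by rewrite mulrCA.
  by apply: ler_piMr; [exact: ltW|rewrite ler_pdivrMr// mul1r ler_nat].
Unshelve. all: by end_near. Qed.

End PartialDerivatives.

(** * Smooth functions on open sets: locality, entries, time slices *)

Section SmoothOpen.
Variables (R : realType).
Implicit Types (V W : normedModType R).

Lemma near_open (X : topologicalType) (U : set X) x (P : X -> Prop) :
  open U -> U x -> (forall y, U y -> P y) -> \forall y \near x, P y.
Proof.
by move=> oU Ux h; apply: filterS h _; apply: open_nbhs_nbhs.
Qed.

Lemma iter_derive_eq V W (U : set V) (f g : V -> W) vs : open U ->
  (forall x, U x -> f x = g x) -> forall x, U x -> iter_derive vs f x = iter_derive vs g x.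
Proof.
move=> oU fg; elim: vs => [//|v vs IH] x Ux /=.
by apply: near_eq_derive; exact: (near_open oU Ux IH).
Qed.

Lemma smooth_open_eq V W (U : set V) (f g : V -> W) : open U ->
  (forall x, U x -> f x = g x) -> smooth_open U f -> smooth_open U g.
Proof.
move=> oU fg sf vs x Ux; have e := iter_derive_eq vs oU fg.
have [c d] := sf vs x Ux.
have n : {near x, iter_derive vs f =1 iter_derive vs g} by exact: (near_open oU Ux e).
split; last by move=> v; apply: near_eq_derivable (d v).
move: c; rewrite /prop_for /continuous_at (e _ Ux) => c.
by apply: cvg_trans c; apply: near_eq_cvg; apply: filterS n => y ->.
Qed.

Lemma smooth_open_sub V W (U U' : set V) (f : V -> W) :
  U' `<=` U -> smooth_open U f -> smooth_open U' f.
Proof. by move=> s sf vs x /s; exact: sf. Qed.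

Lemma iter_derive_rcons V W (f : V -> W) v vs :
  iter_derive (rcons vs v) f = iter_derive vs ('D_v f).
Proof. by rewrite /iter_derive foldr_rcons. Qed.

Lemma smooth_open_derive V W (U : set V) (f : V -> W) v :
  smooth_open U f -> smooth_open U ('D_v f).
Proof. by move=> sf vs x Ux; rewrite -iter_derive_rcons; exact: sf. Qed.

Lemma smooth_open_continuous V W (U : set V) (f : V -> W) x :
  smooth_open U f -> U x -> {for x, continuous f}.
Proof. by move=> sf /(sf [::] x)[]. Qed.

Lemma smooth_open_derivable V W (U : set V) (f : V -> W) x v :
  smooth_open U f -> U x -> derivable f x v.
Proof. by move=> sf /(sf [::] x)[]. Qed.

Lemma iter_derive_coord V m p (U : set V) (A : V -> 'M[R]_(m, p)) i j vs : open U ->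
  smooth_open U A -> forall x, U x ->
  iter_derive vs (fun y => A y i j) x = iter_derive vs A x i j.
Proof.
move=> oU sA; elim: vs => [//|v vs IH] x Ux /=.
rewrite (derive_mx ((sA vs x Ux).2 v)) mxE.
by apply: near_eq_derive; exact: (near_open oU Ux IH).
Qed.

Lemma smooth_open_coord V m p (U : set V) (A : V -> 'M[R]_(m, p)) i j : open U ->
  smooth_open U A -> smooth_open U (fun y => A y i j).
Proof.
move=> oU sA vs x Ux; have e := iter_derive_coord i j vs oU sA.
have [c d] := sA vs x Ux.
have n : {near x, (fun y => iter_derive vs A y i j) =1 iter_derive vs (fun y => A y i j)}.
  by apply: (near_open oU Ux) => y /e.
split; last first.
  by move=> v; apply: (near_eq_derivable n); have /derivable_mxP := d v.
rewrite /prop_for /continuous_at (e _ Ux).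
have c' : (fun y => iter_derive vs A y i j) @ x --> iter_derive vs A x i j.
  exact: (continuous_comp c (@coord_continuous R m p i j (iter_derive vs A x))).
by apply: cvg_trans c'; apply: near_eq_cvg; apply: filterS n => y ->.
Qed.

Lemma growth_slice V W (f : R * V -> W) t x v :
  (fun h : R => h^-1 *: (((fun y => f (t, y)) \o shift x) (h *: v) - f (t, x))) =
  (fun h : R => h^-1 *: ((f \o shift (t, x)) (h *: ((0, v) : R * V)) - f (t, x))).
Proof.
apply/funext => h /=; congr (_ *: (f _ - _)).
by apply/pair_eqP; rewrite /= scaler0 add0r !eqxx.
Qed.

Lemma derive_slice V W (f : R * V -> W) t x v :
  'D_v (fun y => f (t, y)) x = 'D_((0, v) : R * V) f (t, x).
Proof. by rewrite /derive growth_slice. Qed.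

Lemma derivable_slice V W (f : R * V -> W) t x v :
  derivable f (t, x) ((0, v) : R * V) -> derivable (fun y => f (t, y)) x v.
Proof. by rewrite /derivable growth_slice. Qed.

Lemma iter_derive_slice V W (f : R * V -> W) t vs :
  iter_derive vs (fun y => f (t, y)) =
  fun x => iter_derive (map (fun v => (0, v) : R * V) vs) f (t, x).
Proof.
elim: vs => [//|v vs IH]; apply/funext => x.
by rewrite -[LHS]/('D_v (iter_derive vs (fun y => f (t, y))) x) IH derive_slice.
Qed.

Lemma smooth_open_slice V W (U : set (R * V)) (f : R * V -> W) t :
  smooth_open U f -> smooth_open [set x | U (t, x)] (fun y => f (t, y)).
Proof.
move=> sf vs x /= Ux; rewrite iter_derive_slice; have [c d] := sf (map (fun v => (0, v) : R * V) vs) _ Ux.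
split; last by move=> v; apply: derivable_slice; exact: d.
have c0 : (fun y : V => (t, y)) @ x --> (t, x).
  by apply: (@cvg_pair _ _ _ _ (nbhs t) (nbhs x)); [exact: cvg_cst|exact: cvg_id].
exact: (cvg_comp _ _ c0 c).
Qed.

End SmoothOpen.

Section SmoothRows.
Variables (R : realType).

Lemma smooth_open_swap (V : normedModType R) (U : set V) (f : V -> R) x u v :
  open U -> smooth_open U f -> U x -> 'D_v ('D_u f) x = 'D_u ('D_v f) x.
Proof.
move=> oU sf Ux; apply: derive_swap.
- apply: (near_open oU Ux) => y Uy.
  by split; apply: smooth_open_derivable Uy; do ?exact: smooth_open_derive.
- by apply: smooth_open_continuous Ux; do 2!apply: smooth_open_derive.
- by apply: smooth_open_continuous Ux; do 2!apply: smooth_open_derive.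
Qed.

Lemma smooth_open_differentiable n (U : set 'rV[R]_n) (f : 'rV[R]_n -> R) x :
  open U -> smooth_open U f -> U x -> differentiable f x.
Proof.
move=> oU sf Ux; apply: differentiable_partial => i.
  by apply: (near_open oU Ux) => y Uy; exact: smooth_open_derivable Uy.
by apply: smooth_open_continuous Ux; exact: smooth_open_derive.
Qed.

End SmoothRows.
(** * Calculus of matrix-valued functions *)

Lemma differentiable_near (R : realType) (V W : normedModType R) (f g : V -> W) x :
  {near x, f =1 g} -> differentiable f x -> differentiable g x.
Proof.
move=> fg df; have fx := nbhs_singleton fg.
apply: (@differentiable_littleo _ _ _ g ('d f x)); first exact: diff_continuous.
move=> e e0; have /eqaddoP/(_ e e0) := diff_locally df.
have fg0 : \forall h \near 0, f (h + x) = g (h + x).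
  by move: fg; rewrite (near_shift 0) subr0.
apply: filterS2 fg0 => h; rewrite /= !fctE/= => <- h1.
by rewrite -fx.
Qed.

Section MatrixDerivative.
Variables (R : realType) (E : normedModType R).
Implicit Types (x u v : E).

Definition dmx m p (A : E -> 'M[R]_(m, p)) x :=
  forall i j, differentiable (fun y => A y i j : R) x.

(* Locked, since unification would otherwise unfold the limits behind 'D_v. *)
Definition dd_def m p v (A : E -> 'M[R]_(m, p)) x : 'M[R]_(m, p) :=
  \matrix_(i, j) 'D_v (fun y => A y i j : R) x.
Fact dd_key : unit. Proof. by []. Qed.
Definition dd := locked_with dd_key dd_def.
Arguments dd {m p} v A x.

Lemma ddE m p v (A : E -> 'M[R]_(m, p)) x i j : dd v A x i j = 'D_v (fun y => A y i j : R) x.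
Proof. by rewrite /dd unlock mxE. Qed.

(** A relation rather than a value: the rules below propagate differentiability together with the
    derivative, so that derivatives of matrix expressions are obtained by composing them. Full
    differentiability, not only along v, feeds the chain rule [isd_comp]. *)
Definition isd m p (A : E -> 'M[R]_(m, p)) x v (A' : 'M[R]_(m, p)) :=
  dmx A x /\ dd v A x = A'.

Lemma isdP m p (A : E -> 'M[R]_(m, p)) x v : dmx A x -> isd A x v (dd v A x).
Proof. by []. Qed.

Lemma isd_entries m p (A : E -> 'M[R]_(m, p)) x v (A' : 'M[R]_(m, p)) :
  (forall i j, differentiable (fun y => A y i j : R) x /\ 'D_v (fun y => A y i j : R) x = A' i j) ->
  isd A x v A'.
Proof.
move=> h; split; first by move=> i j; exact: (h i j).1.
by apply/matrixP => i j; rewrite ddE (h i j).2.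
Qed.

Lemma isd_entryP m p (A : E -> 'M[R]_(m, p)) x v (A' : 'M[R]_(m, p)) i j : isd A x v A' ->
  is_derive x v (fun y => A y i j : R) (A' i j).
Proof.
move=> [d <-]; rewrite ddE; apply: derivableP; exact: diff_derivable.
Qed.

Lemma isd_eq m p (A : E -> 'M[R]_(m, p)) x v A' A'' : isd A x v A' -> A' = A'' -> isd A x v A''.
Proof. by move=> ? <-. Qed.

Lemma isd_near m p (A B : E -> 'M[R]_(m, p)) x v A' :
  (\forall y \near x, A y = B y) -> isd A x v A' -> isd B x v A'.
Proof.
move=> AB [d e].
have nAB i j : {near x, (fun y => A y i j : R) =1 (fun y => B y i j)}.
  by apply: filterS AB => y ->.
apply: isd_entries => i j; split.
  apply: differentiable_near (nAB i j) (d i j).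
by rewrite -e ddE; apply: near_eq_derive; apply: filterS (nAB i j) => y ->.
Qed.

Lemma isd_cst m p (A : 'M[R]_(m, p)) x v : isd (fun=> A) x v 0.
Proof.
apply: isd_entries => i j; split; first exact: differentiable_cst.
by rewrite mxE; exact: derive_cst.
Qed.

Lemma isdD m p (A B : E -> 'M[R]_(m, p)) x v A' B' :
  isd A x v A' -> isd B x v B' -> isd (fun y => A y + B y) x v (A' + B').
Proof.
move=> hA hB; apply: isd_entries => i j.
have -> : (fun y => (A y + B y) i j) = (fun y => A y i j) + (fun y => B y i j).
  by apply/funext => y; rewrite mxE.
split; first by apply: differentiableD; [exact: hA.1|exact: hB.1].
rewrite mxE; have := is_deriveD (isd_entryP i j hA) (isd_entryP i j hB).
by case.
Qed.

Lemma isdN m p (A : E -> 'M[R]_(m, p)) x v A' :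
  isd A x v A' -> isd (fun y => - A y) x v (- A').
Proof.
move=> hA; apply: isd_entries => i j.
have -> : (fun y => (- A y) i j) = - (fun y => A y i j).
  by apply/funext => y; rewrite mxE.
split; first by apply: differentiableN; exact: hA.1.
by rewrite mxE; have := is_deriveN (isd_entryP i j hA); case.
Qed.

Lemma isdB m p (A B : E -> 'M[R]_(m, p)) x v A' B' :
  isd A x v A' -> isd B x v B' -> isd (fun y => A y - B y) x v (A' - B').
Proof. by move=> hA /isdN; exact: isdD. Qed.

Lemma isd_tr m p (A : E -> 'M[R]_(m, p)) x v A' :
  isd A x v A' -> isd (fun y => (A y)^T) x v A'^T.
Proof.
move=> hA; apply: isd_entries => i j.
have -> : (fun y => (A y)^T i j) = (fun y => A y j i) by apply/funext => y; rewrite mxE.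
by split; [exact: hA.1|rewrite mxE; case: (isd_entryP j i hA)].
Qed.

Lemma isd_sum m p (I : Type) (r : seq I) (A : I -> E -> 'M[R]_(m, p)) x v A' :
  (forall i, isd (A i) x v (A' i)) ->
  isd (fun y => \sum_(i <- r) A i y) x v (\sum_(i <- r) A' i).
Proof.
move=> h; elim: r => [|i r IH].
  rewrite big_nil (_ : (fun y => _) = fun=> 0); first exact: isd_cst.
  by apply/funext => y; rewrite big_nil.
rewrite big_cons (_ : (fun y => _) = fun y => A i y + \sum_(j <- r) A j y).
  exact: isdD.
by apply/funext => y; rewrite big_cons.
Qed.

Lemma isd_mulentry m p q (A : E -> 'M[R]_(m, p)) (B : E -> 'M[R]_(p, q)) x v A' B' i j k :
  isd A x v A' -> isd B x v B' ->
  differentiable (fun y => A y i k * B y k j) x /\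
  is_derive x v (fun y => A y i k * B y k j) (A' i k * B x k j + A x i k * B' k j).
Proof.
move=> hA hB; split.
  by apply: (@differentiableM _ _ (fun y => A y i k) (fun y => B y k j)); [exact: hA.1|exact: hB.1].
have := is_deriveM (isd_entryP i k hA) (isd_entryP k j hB).
by rewrite addrC [X in X + _]mulrC.
Qed.

Lemma isdM m p q (A : E -> 'M[R]_(m, p)) (B : E -> 'M[R]_(p, q)) x v A' B' :
  isd A x v A' -> isd B x v B' -> isd (fun y => A y *m B y) x v (A' *m B x + A x *m B').
Proof.
move=> hA hB; apply: isd_entries => i j.
have -> : (fun y => (A y *m B y) i j) = \sum_(k < p) (fun y => A y i k * B y k j).
  by apply/funext => y; rewrite fct_sumE mxE.
split; first by apply: differentiable_sum => k; exact: (isd_mulentry _ _ _ hA hB).1.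
rewrite !mxE -big_split/=.
have := is_derive_sum (fun k => (isd_mulentry i j k hA hB).2).
by case.
Qed.

Lemma isd_scale m p q r (A : E -> 'M[R]_(m, p)) (B : E -> 'M[R]_(q, r)) x v A' B' i j :
  isd A x v A' -> isd B x v B' ->
  isd (fun y => A y i j *: B y) x v (A' i j *: B x + A x i j *: B').
Proof.
move=> hA hB; apply: isd_entries => k l.
have -> : (fun y => (A y i j *: B y) k l) = (fun y => A y i j * B y k l).
  by apply/funext => y; rewrite mxE.
split.
  by apply: (@differentiableM _ _ (fun y => A y i j) (fun y => B y k l)); [exact: hA.1|exact: hB.1].
have [_] := is_deriveM (isd_entryP i j hA) (isd_entryP k l hB).
by rewrite addrC [X in X + _]mulrC => ->; rewrite !mxE.
Qed.

Lemma isdMc m p q (A : E -> 'M[R]_(m, p)) (B : 'M[R]_(p, q)) x v A' :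
  isd A x v A' -> isd (fun y => A y *m B) x v (A' *m B).
Proof.
by move=> hA; apply: isd_eq (isdM hA (isd_cst B x v)) _; rewrite mulmx0 addr0.
Qed.

Lemma isdcM m p q (A : 'M[R]_(m, p)) (B : E -> 'M[R]_(p, q)) x v B' :
  isd B x v B' -> isd (fun y => A *m B y) x v (A *m B').
Proof.
by move=> hB; apply: isd_eq (isdM (isd_cst A x v) hB) _; rewrite mul0mx add0r.
Qed.

Lemma isdZ m p (A : E -> 'M[R]_(m, p)) (c : R) x v A' :
  isd A x v A' -> isd (fun y => c *: A y) x v (c *: A').
Proof.
rewrite -mul_scalar_mx (_ : (fun y => c *: A y) = fun y => c%:M *m A y).
  exact: isdcM.
by apply/funext => y; rewrite mul_scalar_mx.
Qed.

Lemma dmx_row_differentiable m (f : E -> 'rV[R]_m) x : dmx f x -> differentiable f x.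
Proof.
move=> d; have -> : f = \sum_(j < m) (fun y => f y 0 j *: delta_mx 0 j).
  by apply/funext => y; rewrite fct_sumE {1}[f y]row_sum_delta.
by apply: differentiable_sum => j; apply: differentiableZl; exact: d.
Qed.

Lemma diff_dd m p (A : E -> 'M[R]_(m, p)) x v i j : dmx A x ->
  'd (fun y => A y i j : R) x v = dd v A x i j.
Proof. by move=> d; rewrite ddE (deriveE v (d i j)). Qed.

Lemma dd_lin m p (A : E -> 'M[R]_(m, p)) x (a : R) u v : dmx A x ->
  dd (a *: u + v) A x = a *: dd u A x + dd v A x.
Proof.
by move=> d; apply/matrixP => i j; rewrite !mxE -!diff_dd// linearP.
Qed.

Lemma dd_row m (f : E -> 'rV[R]_m) x v : dmx f x -> 'd f x v = dd v f x.
Proof.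
move=> d; have df := dmx_row_differentiable d.
rewrite -deriveE// (derive_mx (@diff_derivable _ _ _ _ _ v df)).
by apply/matrixP => i j; rewrite ddE mxE.
Qed.

End MatrixDerivative.
Arguments dd {R E m p} v A x.

Section RowDerivative.
Variables (R : realType) (n : nat).
Local Notation E := 'rV[R]_n.
Implicit Types (x u v : E).

Lemma isd_id x v : isd id x v v.
Proof.
apply: isd_entries => i j; split; first exact: differentiable_coord.
rewrite (ord1 i); have /= := derive_mx (@derivable_id _ _ x v); rewrite derive_id => /matrixP/(_ 0 j).
by rewrite mxE => <-.
Qed.

Lemma dd_vec m p (A : E -> 'M[R]_(m, p)) x v : dmx A x ->
  dd v A x = \sum_k v 0 k *: dd (delta_mx 0 k) A x.
Proof.
move=> d; apply/matrixP => i j; rewrite -diff_dd// {1}(row_sum_delta v) linear_sum summxE.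
by apply: eq_bigr => k _; rewrite linearZ/= mxE diff_dd.
Qed.

Lemma jacobian_dd m (f : E -> 'rV[R]_m) x v : dmx f x -> v *m jacobian f x = dd v f x.
Proof. by move=> d; rewrite /jacobian mul_rV_lin1; exact: dd_row. Qed.

End RowDerivative.

Lemma isd_comp (R : realType) (E : normedModType R) k m p (B : 'rV[R]_k -> 'M[R]_(m, p))
    (f : E -> 'rV[R]_k) x v :
  dmx f x -> dmx B (f x) -> isd (fun y => B (f y)) x v (dd (dd v f x) B (f x)).
Proof.
move=> df dB; have df' := dmx_row_differentiable df.
apply: isd_entries => i j; split.
  exact: (differentiable_comp df' (dB i j)).
have dc := differentiable_comp df' (dB i j).
rewrite -diff_dd// -(dd_row v df).
rewrite (deriveE v dc).
by rewrite (diff_comp df' (dB i j)).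
Qed.

(** * Second derivative test *)

Lemma cvg_line (R : realType) (V : normedModType R) (x u : V) :
  (fun s : R => x + s *: u) @ (0 : R) --> x.
Proof.
rewrite -[X in _ --> X]addr0 -[X in _ --> _ + X](scale0r u).
by apply: cvgD; [exact: cvg_cst|apply: cvgZr_tmp; exact: cvg_id].
Qed.

(** The point 0 is a minimum of g, so the first derivative vanishes there. If l were negative, g1
    would be negative just to the right of 0, and the mean value theorem would make g negative. *)
Lemma second_derivative_test (R : realType) (g g1 : R -> R) (l : R) :
  (\forall s \near (0 : R), is_derive (s : R) (1 : R) g (g1 s)) -> is_derive (0 : R) 1 g1 l ->
  (\forall s \near (0 : R), 0 <= g s) -> g 0 = 0 -> g1 0 = 0 /\ 0 <= l.
Proof.
move=> /nbhs_ballP[a /= a0 ha] [dg1 lE] /nbhs_ballP[b /= b0 hb] g0.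
have [d d0 hd] : exists2 d : R, 0 < d & forall s : R, `|s| < d -> is_derive (s : R) (1 : R) g (g1 s) /\ 0 <= g s.
  exists (Num.min a b); first by rewrite lt_min a0 b0.
  move=> s; rewrite lt_min => /andP[sa sb].
  by split; [apply: ha|apply: hb]; rewrite /ball/= sub0r normrN.
have g10 : g1 0 = 0.
  have ab : - d < d by rewrite gtrN.
  have d00 : `|0 : R| < d by rewrite normr0.
  have i0 : (0 : R) \in `]- d, d[ by rewrite in_itv/= oppr_lt0 d0.
  have dd (s : R) : s \in `]- d, d[ -> derivable g s 1.
    by rewrite in_itv/= -ltr_norml => /hd[[]].
  have mn (s : R) : s \in `]- d, d[ -> g 0 <= g s.
    by rewrite in_itv/= -ltr_norml g0 => /hd[].
  have [_ <-] := (hd 0 d00).1.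
  by have [_ ->] := derive1_at_min (ltW ab) dd i0 mn.
split=> //; rewrite leNgt; apply/negP => l0.
have cv : (fun h : R => h^-1 *: g1 h) @ 0^' --> l.
  have := dg1; rewrite /derivable => /cvg_ex[k kP].
  have lk : l = k.
    by rewrite -lE /derive; apply/cvg_lim.
  rewrite lk; apply: cvg_trans kP; apply: near_eq_cvg; near=> h => /=.
  by rewrite g10 subr0 addr0 [h *: 1]mulr1.
have nl0 : 0 < - l by rewrite oppr_gt0.
have /cvgrPdist_lt/(_ _ nl0) := cv.
move=> /nbhs_ballP[r /= r0 hr].
pose m := Num.min d r / 2.
have m0 : 0 < m by rewrite divr_gt0// lt_min d0 r0.
have mlt : m < Num.min d r by rewrite ltr_pdivrMr// ltr_pMr ?ltr1n// lt_min d0 r0.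
have md : m < d by move: mlt; rewrite lt_min => /andP[].
have mr : m < r by move: mlt; rewrite lt_min => /andP[].
have ab (s : R) : s \in `[0, m] -> `|s| < d.
  by rewrite in_itv/= => /andP[s0 sm]; rewrite ger0_norm// (le_lt_trans sm).
have [| |c cm] := @MVT R g g1 0 m m0 _ _.
- by move=> s sm; apply: (hd s _).1; apply: ab; exact: subset_itv_oo_cc.
- apply: derivable_within_continuous => s /ab /hd[[+ _] _]; exact.
rewrite g0 !subr0 => e.
move: cm; rewrite in_itv/= => /andP[c0 cm].
have : 0 <= g m by apply: (hd m _).2; rewrite gtr0_norm.
rewrite e pmulr_lge0// leNgt => /negP; apply.
have rc : `|0 - c| < r by rewrite sub0r normrN gtr0_norm// (lt_trans cm mr).
have /= := hr c rc (lt0r_neq0 c0).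
rewrite ltr_norml => /andP[+ _]; rewrite opprK ltrBrDr -ltrBrDl subrr.
by rewrite [_ *: _]mulrC ltr_pdivrMr// mul0r.
Unshelve. all: by end_near. Qed.

Section SmoothMatrix.
Variables (R : realType) (n : nat).
Implicit Types (U : set 'rV[R]_n) (x u v : 'rV[R]_n).

Lemma isd_second_test (W W1 : 'rV[R]_n -> 'M[R]_1) W2 x u :
  (\forall y \near x, isd W y u (W1 y)) -> isd W1 x u W2 ->
  (\forall y \near x, 0 <= W y 0 0) -> W x = 0 -> W1 x = 0 /\ 0 <= W2 0 0.
Proof.
move=> h1 h2 hW W0.
have cl := @cvg_line R _ x u.
have line (f : 'rV[R]_n -> R) s l : is_derive (x + s *: u) u f l ->
    is_derive s 1 (fun r : R => f (x + r *: u)) l.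
  by move=> [d <-]; exact: (is_derive_line d).
have [|||/=|e l] := @second_derivative_test R (fun s => W (x + s *: u) 0 0)
    (fun s => W1 (x + s *: u) 0 0) (W2 0 0).
- near=> s; have hs : isd W (x + s *: u) u (W1 (x + s *: u)) by near: s; exact: (cl _ h1).
  exact: (line (fun y => W y 0 0) s _ (isd_entryP 0 0 hs)).
- apply: (line (fun y => W1 y 0 0) 0 _); rewrite scale0r addr0; exact: isd_entryP.
- by have := cl _ hW.
- by rewrite scale0r addr0 W0 mxE.
split=> //; move: e; rewrite scale0r addr0 => e.
by apply/matrixP => i j; rewrite !ord1 e mxE.
Unshelve. all: by end_near. Qed.

Definition smx m p U (A : 'rV[R]_n -> 'M[R]_(m, p)) :=
  open U /\ forall i j, smooth_open U (fun y => A y i j : R).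

Lemma smooth_smx m p U (A : 'rV[R]_n -> 'M[R]_(m, p)) : open U -> smooth_open U A -> smx U A.
Proof. by move=> oU sA; split=> // i j; exact: smooth_open_coord. Qed.

Lemma smx_dmx m p U (A : 'rV[R]_n -> 'M[R]_(m, p)) x : smx U A -> U x -> dmx A x.
Proof. by move=> [oU s] Ux i j; exact: smooth_open_differentiable (s i j) Ux. Qed.

Lemma smx_dd m p U (A : 'rV[R]_n -> 'M[R]_(m, p)) v : smx U A -> smx U (dd v A).
Proof.
move=> [oU s]; split; first exact: oU.
move=> i j; have -> : (fun y => dd v A y i j) = 'D_v (fun y => A y i j).
  by apply/funext => y; exact: ddE.
exact: smooth_open_derive.
Qed.

Lemma smx_isd m p U (A : 'rV[R]_n -> 'M[R]_(m, p)) x v : smx U A -> U x -> isd A x v (dd v A x).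
Proof. by move=> s Ux; split=> //; exact: smx_dmx s Ux. Qed.

Lemma smx_isd2 m p U (A : 'rV[R]_n -> 'M[R]_(m, p)) x u v : smx U A -> U x ->
  isd (dd u A) x v (dd v (dd u A) x).
Proof. by move=> s Ux; apply: smx_isd Ux; exact: smx_dd. Qed.

Lemma dd_swap m p U (A : 'rV[R]_n -> 'M[R]_(m, p)) x u v : smx U A -> U x ->
  dd v (dd u A) x = dd u (dd v A) x.
Proof.
move=> [oU s] Ux; apply/matrixP => i j.
have e w : (fun y => dd w A y i j) = 'D_w (fun y => A y i j).
  by apply/funext => y; rewrite ddE.
by rewrite 2!ddE !e; exact: smooth_open_swap (s i j) Ux.
Qed.

Lemma smx_near m p U (A : 'rV[R]_n -> 'M[R]_(m, p)) x : smx U A -> U x -> \forall y \near x, U y.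
Proof. by move=> [oU _] Ux; exact: near_open Ux _. Qed.

End SmoothMatrix.
(** * Symmetric bilinear forms *)

Section Forms.
Variables (R : realType).

Lemma bformDl n (A : 'M[R]_n) u u' v : bform A (u + u') v = bform A u v + bform A u' v.
Proof. by rewrite /bform !mulmxDl mxE. Qed.

Lemma bformDr n (A : 'M[R]_n) u v v' : bform A u (v + v') = bform A u v + bform A u v'.
Proof. by rewrite /bform linearD mulmxDr mxE. Qed.

Lemma bformZl n (A : 'M[R]_n) a u v : bform A (a *: u) v = a * bform A u v.
Proof. by rewrite /bform -!scalemxAl mxE. Qed.

Lemma bformZr n (A : 'M[R]_n) a u v : bform A u (a *: v) = a * bform A u v.
Proof. by rewrite /bform linearZ -scalemxAr mxE. Qed.

Lemma bformD n (A B : 'M[R]_n) u v : bform (A + B) u v = bform A u v + bform B u v.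
Proof. by rewrite /bform mulmxDr mulmxDl mxE. Qed.

Lemma bformN n (A : 'M[R]_n) u v : bform (- A) u v = - bform A u v.
Proof. by rewrite /bform mulmxN mulNmx mxE. Qed.

Lemma bformB n (A B : 'M[R]_n) u v : bform (A - B) u v = bform A u v - bform B u v.
Proof. by rewrite bformD bformN. Qed.

Lemma bformZ n a (A : 'M[R]_n) u v : bform (a *: A) u v = a * bform A u v.
Proof. by rewrite /bform -scalemxAr -scalemxAl mxE. Qed.

Lemma bform_tr n (A : 'M[R]_n) u v : bform A^T u v = bform A v u.
Proof.
by rewrite /bform -[in RHS](trmxK (v *m A *m u^T)) [in RHS]mxE !trmx_mul trmxK mulmxA.
Qed.

Lemma bform_mul m n (A : 'M[R]_n) (J : 'M[R]_(m, n)) u v :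
  bform (J *m A *m J^T) u v = bform A (u *m J) (v *m J).
Proof. by rewrite /bform trmx_mul !mulmxA. Qed.

Definition posdef n (A : 'M[R]_n) := forall v, v != 0 -> 0 < bform A v v.
Definition possemidef n (A : 'M[R]_n) := forall v, 0 <= bform A v v.

Lemma posdef_semidef n (A : 'M[R]_n) : posdef A -> possemidef A.
Proof.
move=> p v; have [->|/p/ltW//] := eqVneq v 0.
by rewrite /bform !mul0mx mxE.
Qed.

Lemma posdef_unit n (A : 'M[R]_n) : posdef A -> A \in unitmx.
Proof.
move=> p; rewrite -row_free_unit -kermx_eq0; apply/eqP/row_matrixP => i.
apply/eqP; rewrite row0; apply/negPn/negP => /p.
rewrite /bform (_ : row i _ *m A = 0) ?mul0mx ?mxE ?ltxx//.
by rewrite -row_mul mulmx_ker row0.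
Qed.

(** The polynomial A(v + t w, v + t w) = 2 t A(v, w) + t^2 A(w, w) is nonnegative for every t only
    if its linear coefficient vanishes. *)
Lemma possemidef_null n (A : 'M[R]_n) v : A^T = A -> possemidef A -> bform A v v = 0 -> v *m A = 0.
Proof.
move=> sA pA v0.
suff h w : bform A v w = 0.
  apply/rowP => j; rewrite [RHS]mxE; have := h (delta_mx 0 j).
  by rewrite /bform trmx_delta -colE [in LHS]mxE.
have sym u1 u2 : bform A u1 u2 = bform A u2 u1 by rewrite -bform_tr sA.
have q t : 0 <= t * (2 * bform A v w) + t ^+ 2 * bform A w w.
  have := pA (v + t *: w).
  rewrite !(bformDl, bformDr, bformZl, bformZr) v0 (sym w v).
  by congr (0 <= _); ring.
have := pA w; set c := bform A w w in q *; set b := bform A v w in q * => c0.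
apply/eqP/negPn/negP => b0.
have c1 : 0 < c + 1 by rewrite ltr_wpDl.
(* A value of t at which the polynomial is negative when b is nonzero; c + 1 replaces c because c
   may be 0. *)
have := q (- b / (c + 1)).
have -> : - b / (c + 1) * (2 * b) + (- b / (c + 1)) ^+ 2 * c =
   - (b ^+ 2 / (c + 1) * (1 + (1 + c)^-1)).
  by field; rewrite (addrC 1) (lt0r_neq0 c1).
rewrite oppr_ge0 leNgt => /negP; apply; apply: mulr_gt0.
  by rewrite divr_gt0// exprn_even_gt0.
by rewrite addrC in c1; rewrite addr_gt0// invr_gt0.
Qed.

(** Cholesky factorization by induction on the size. If the corner a is 0, the first row vanishes by
    [possemidef_null]; otherwise the induction runs on the Schur complement C - a^-1 b^T b. *)
Lemma possemidef_factor n (A : 'M[R]_n) : A^T = A -> possemidef A ->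
  exists B : 'M[R]_n, A = B^T *m B.
Proof.
elim: n A => [|n IH] A sA pA; first by exists 0; apply/matrixP => -[].
change 'M[R]_(1 + n) in A.
pose a := A 0 0; pose b := ursubmx A; pose C := drsubmx A.
have ul : ulsubmx A = a%:M.
  apply/matrixP => i j; rewrite !ord1 !mxE eqxx mulr1n /a.
  by congr (A _ _); apply/val_inj.
have dl : dlsubmx A = b^T by rewrite /b trmx_ursub sA.
have sC : C^T = C by rewrite /C trmx_drsub sA.
have AE : A = block_mx a%:M b b^T C by rewrite -{1}(submxK A) ul dl.
have bf (s : R) (w : 'rV[R]_n) :
    bform A (row_mx s%:M w) (row_mx s%:M w) = s ^+ 2 * a + 2 * s * (b *m w^T) 0 0 + bform C w w.
  have tr : w *m b^T = (b *m w^T)^T by rewrite trmx_mul trmxK.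
  rewrite AE /bform mul_row_block tr_row_mx mul_row_col !mulmxDl tr tr_scalar_mx.
  rewrite -(mulmxA _ b) (mx11_scalar (b *m w^T)) tr_scalar_mx -!scalar_mxM.
  move: ((b *m w^T) 0 0) (w *m C *m w^T) => t c.
  by rewrite !mxE eqxx !mulr1n; ring.
have pC : possemidef C.
  by move=> w; have := bf 0 w; rewrite expr0n/= mul0r mulr0 mul0r !add0r => <-; exact: pA.
have a0 : 0 <= a.
  have := bf 1 0; rewrite trmx0 mulmx0 mxE mulr0 addr0 expr1n mul1r.
  by rewrite [bform C 0 0]/bform !mul0mx mxE addr0 => <-; exact: pA.
have [az|an0] := eqVneq a 0.
  have b0 : b = 0.
    have := @possemidef_null _ A (row_mx 1%:M 0) sA pA.
    rewrite bf az mulr0 trmx0 mulmx0 mxE mulr0 [bform C 0 0]/bform !mul0mx mxE !addr0.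
    move=> /(_ erefl); rewrite AE mul_row_block !mul0mx !mul1mx !addr0.
    by rewrite -row_mx0 => /eq_row_mx[].
  have [B CB] := IH C sC pC.
  pose X : 'M[R]_(1 + n) := block_mx 0 0 0 B.
  suff XE : A = X^T *m X by exists X.
  rewrite tr_block_mx mulmx_block !trmx0 !mul0mx !mulmx0 !add0r -CB.
  by rewrite AE b0 az trmx0 raddf0.
have ap : 0 < a by rewrite lt_neqAle eq_sym an0.
pose C' := C - a^-1 *: (b^T *m b).
have [||B CB] := IH C'.
- by rewrite /C' linearB/= sC linearZ/= trmx_mul trmxK.
(* The first coordinate that minimizes the form for given w; the minimum is the Schur complement at
   w. *)
- move=> w; have := pA (row_mx (- a^-1 * (b *m w^T) 0 0)%:M w).
  rewrite bf bformB bformZ.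
  have -> : bform (b^T *m b) w w = (b *m w^T) 0 0 ^+ 2.
    rewrite /bform mulmxA -mulmxA mxE big_ord1 expr2; congr (_ * _).
    by rewrite -(trmxK (w *m b^T)) trmx_mul trmxK mxE.
  by congr (0 <= _); field.
pose X : 'M[R]_(1 + n) := block_mx (Num.sqrt a)%:M ((Num.sqrt a)^-1 *: b) 0 B.
suff XE : A = X^T *m X by exists X.
have sa : Num.sqrt a * Num.sqrt a = a by rewrite -expr2 sqr_sqrtr.
have sa0 : Num.sqrt a != 0 by rewrite sqrtr_eq0 -ltNge.
have e12 : (Num.sqrt a)%:M *m ((Num.sqrt a)^-1 *: b) = b.
  by rewrite mul_scalar_mx scalerA mulfV// scale1r.
have e21 : ((Num.sqrt a)^-1 *: b)^T *m (Num.sqrt a)%:M = b^T.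
  by rewrite linearZ/= mul_mx_scalar scalerA mulfV// scale1r.
have e22 : ((Num.sqrt a)^-1 *: b)^T *m ((Num.sqrt a)^-1 *: b) = a^-1 *: (b^T *m b).
  have -> : ((Num.sqrt a)^-1 *: b)^T = (Num.sqrt a)^-1 *: b^T.
    by apply/matrixP => i j; rewrite !mxE.
  by rewrite -scalemxAr -scalemxAl scalerA -invfM sa.
rewrite tr_block_mx mulmx_block !trmx0 !mul0mx !mulmx0 !addr0 tr_scalar_mx e12 e21 e22.
by rewrite -CB -scalar_mxM sa /C' addrCA subrr addr0.
Qed.

End Forms.

(** * Orthonormal frames and trace inequalities *)

Section Frames.
Variables (R : realType).

Lemma possemidef_inv n (A : 'M[R]_n) : A^T = A -> posdef A -> possemidef (invmx A).
Proof.
move=> sA pA v; have uA := posdef_unit pA.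
have := posdef_semidef pA (v *m invmx A).
by rewrite /bform trmx_mul trmx_inv sA !mulmxA (mulmxKV uA).
Qed.

(** The rows of E form an A-orthonormal basis. Factoring the inverse of A gives E^T (E A) = 1, and
    one-sided inverses of square matrices are two-sided. *)
Lemma posdef_frame n (A : 'M[R]_n) : A^T = A -> posdef A ->
  exists2 E : 'M[R]_n, E^T *m E = invmx A & E *m A *m E^T = 1%:M.
Proof.
move=> sA pA; have uA := posdef_unit pA.
have [|E EE] := possemidef_factor _ (possemidef_inv sA pA); first by rewrite trmx_inv sA.
exists E => //; have : E^T *m (E *m A) = 1%:M by rewrite mulmxA -EE mulVmx.
by move/mulmx1C.
Qed.

Lemma bform_rows n (E A : 'M[R]_n) a b : bform A (row a E) (row b E) = (E *m A *m E^T) a b.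
Proof.
rewrite /bform tr_row -row_mul [LHS]mxE [RHS]mxE; apply: eq_bigr => k _.
by rewrite !mxE.
Qed.

Lemma sum_bform_rows n m (E : 'M[R]_(m, n)) (v w : 'rV[R]_n) :
  \sum_a (v *m (row a E)^T) 0 0 * (row a E *m w^T) 0 0 = bform (E^T *m E) v w.
Proof.
rewrite /bform mulmxA -(mulmxA _ E) [RHS]mxE; apply: eq_bigr => a _.
by rewrite tr_row -row_mul [X in _ * X]mxE; congr (_ * _); rewrite !mxE; apply: eq_bigr => i _; rewrite !mxE.
Qed.

(** Used with the inverse metric E^T E, and with its derivative, to turn contractions into sums over
    frame vectors. *)
Lemma sum_factor n (p q : nat) (C D : 'M[R]_n) (K : 'I_n -> 'I_n -> 'M[R]_(p, q)) :
  \sum_i \sum_j (C^T *m D) i j *: K i j =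
  \sum_a \sum_i \sum_j (row a C 0 i * row a D 0 j) *: K i j.
Proof.
rewrite exchange_big; rewrite [RHS]exchange_big/= exchange_big/=; apply: eq_bigr => i _.
rewrite exchange_big/=; apply: eq_bigr => j _.
by rewrite mxE scaler_suml; apply: eq_bigr => a _; rewrite !mxE.
Qed.

(** The trace of c P over the frame is at most n because c P <= G. From v P = c^-1 v G and Parseval,
    c times the sum of P(v, e_a)^2 is exactly P(v, v); this lowers n to n - 1. *)
Lemma sum_sectional_le n (G P E : 'M[R]_n) (c : R) v :
  G^T = G -> P^T = P -> posdef G -> E^T *m E = invmx G -> E *m G *m E^T = 1%:M ->
  0 < c -> possemidef (G - c *: P) -> v *m (G - c *: P) = 0 ->
  c * \sum_a (bform P v v * bform P (row a E) (row a E) - bform P v (row a E) ^+ 2)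
    <= (n%:R - 1) * bform P v v.
Proof.
move=> sG sP pG EE EGE c0 pZ vZ; have uG := posdef_unit pG.
have vGP : v *m P = c^-1 *: (v *m G).
  move/eqP: vZ; rewrite mulmxBr subr_eq0 -scalemxAr => /eqP ->.
  by rewrite scalerA mulVf ?lt0r_neq0// scale1r.
have Pvv : 0 <= bform P v v.
  by rewrite /bform vGP -scalemxAl mxE mulr_ge0 ?invr_ge0 ?(ltW c0)//; exact: (posdef_semidef pG v).
have trP : c * \sum_a bform P (row a E) (row a E) <= n%:R.
  rewrite -subr_ge0 mulr_sumr.
  have -> : n%:R = \sum_(a < n) bform G (row a E) (row a E).
    under eq_bigr => a _ do rewrite bform_rows EGE mxE eqxx.
    by rewrite sumr_const card_ord.
  rewrite -sumrB; apply: sumr_ge0 => a _.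
  by have := pZ (row a E); rewrite bformB bformZ.
have sq : c * \sum_a bform P v (row a E) ^+ 2 = bform P v v.
  transitivity (c * bform (E^T *m E) (v *m P) (v *m P)).
    rewrite -sum_bform_rows; congr (_ * _); apply: eq_bigr => a _.
    rewrite expr2 /bform; congr (_ * _).
    have -> : row a E *m (v *m P)^T = (v *m P *m (row a E)^T)^T by rewrite [RHS]trmx_mul trmxK.
    by rewrite [RHS]mxE.
  have h1 : v *m P *m invmx G = c^-1 *: v by rewrite vGP -scalemxAl (mulmxK uG).
  by rewrite EE /bform h1 -scalemxAl mxE trmx_mul sP mulrA mulfV ?lt0r_neq0// mul1r mulmxA.
rewrite sumrB mulrBr sq -mulr_sumr mulrCA mulrBl mul1r lerB// [leRHS]mulrC.
by rewrite ler_wpM2l.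
Qed.

Lemma mxtrace_frame n (E S : 'M[R]_n) :
  \tr (E^T *m E *m S) = \sum_a bform S (row a E) (row a E).
Proof.
rewrite -mulmxA mxtrace_mulC; apply: eq_bigr => a _.
by rewrite bform_rows.
Qed.

(** The hypothesis c J H J^T <= G bounds the norm of a linear map, hence that of its adjoint.
    Concretely, with u = b J^T G^-1, nonnegativity of H^-1 at c u J H - b gives d >= 2 c q - c^2 r,
    and the hypothesis at u gives c r <= q. *)
Lemma dual_form_le n (G H J : 'M[R]_n) c : G^T = G -> H^T = H -> posdef G -> posdef H ->
  0 < c -> possemidef (G - c *: (J *m H *m J^T)) ->
  forall b, c * bform (J^T *m invmx G *m J) b b <= bform (invmx H) b b.
Proof.
move=> sG sH pG pH c0 pZ b; have uG := posdef_unit pG; have uH := posdef_unit pH.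
have sGi : (invmx G)^T = invmx G by rewrite trmx_inv sG.
have sHi : (invmx H)^T = invmx H by rewrite trmx_inv sH.
pose u := b *m J^T *m invmx G.
set q := bform (J^T *m _ *m _) b b; set d := bform (invmx H) b b.
have q1 : bform G u u = q.
  by rewrite /q /bform /u !trmx_mul trmxK sGi !mulmxA (mulmxKV uG).
have q2 : bform (invmx H) (u *m J *m H) b = q.
  by rewrite /q /bform (mulmxK uH) /u !mulmxA.
have q3 : bform (invmx H) b (u *m J *m H) = q by rewrite -q2 -bform_tr sHi.
have q4 : bform (invmx H) (u *m J *m H) (u *m J *m H) = bform (J *m H *m J^T) u u.
  by rewrite /bform (mulmxK uH) !trmx_mul sH !mulmxA.
have q5 := pZ u; rewrite bformB bformZ -q4 q1 in q5.
have := possemidef_inv sH pH (c *: (u *m J *m H) - b).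
rewrite -scaleN1r !(bformDl, bformDr, bformZl, bformZr) q2 q3 -/d => q6.
move: q5 q6; move: (bform (invmx H) _ _) => r q5 q6.
have : 0 <= c * (q - c * r) by rewrite mulr_ge0// ltW.
by nra.
Qed.

(** With S = B^T B the left sum becomes the sum of J^T G^-1 J over the rows of B, and [dual_form_le]
    compares it with H^-1 row by row. *)
Lemma sum_pullback_le n (G H J E S : 'M[R]_n) c :
  G^T = G -> H^T = H -> posdef G -> posdef H -> E^T *m E = invmx G ->
  0 < c -> possemidef (G - c *: (J *m H *m J^T)) -> possemidef S ->
  c * \sum_a bform S (row a E *m J) (row a E *m J) <= \tr (invmx H *m S).
Proof.
move=> sG sH pG pH EE c0 pZ.
(* Both sides depend only on the symmetric part of S, and it is this part that gets factored. *)
wlog sS : S / S^T = S => [hw pS|pS].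
  pose S' := 2^-1 *: (S + S^T).
  have S'E w : bform S' w w = bform S w w.
    by rewrite bformZ bformD bform_tr; field.
  have := hw S'; rewrite -mulrC.
  have -> : \tr (invmx H *m S') = \tr (invmx H *m S).
    rewrite -scalemxAr mulmxDr linearZ/= mxtraceD -[X in _ + X]mxtrace_tr trmx_mul trmxK.
    by rewrite trmx_inv sH [X in _ + X]mxtrace_mulC; field.
  under eq_bigr => a _ do rewrite S'E.
  rewrite mulrC; apply; last by move=> w; rewrite S'E.
  by rewrite /S' linearZ/= linearD/= trmxK addrC.
have [B SB] := possemidef_factor sS pS.
have rhs : \tr (invmx H *m S) = \sum_k bform (invmx H) (row k B) (row k B).
  by rewrite SB mulmxA mxtrace_mulC mulmxA; apply: eq_bigr => k _; rewrite bform_rows.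
have lhs : \sum_a bform S (row a E *m J) (row a E *m J) =
    \sum_k bform (J^T *m invmx G *m J) (row k B) (row k B).
  under eq_bigr => a _ do rewrite -bform_mul.
  rewrite -[LHS]mxtrace_frame EE SB.
  transitivity (\tr (B *m (J^T *m invmx G *m J) *m B^T)).
    have -> : invmx G *m (J *m (B^T *m B) *m J^T) = (invmx G *m J *m (B^T *m B)) *m J^T.
      by rewrite !mulmxA.
    rewrite mxtrace_mulC.
    have -> : J^T *m (invmx G *m J *m (B^T *m B)) = (J^T *m invmx G *m J *m B^T) *m B.
      by rewrite !mulmxA.
    by rewrite mxtrace_mulC !mulmxA.
  by apply: eq_bigr => k _; rewrite bform_rows.
rewrite rhs lhs mulr_sumr; apply: ler_sum => k _.
exact: dual_form_le sG sH pG pH c0 pZ _.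
Qed.

(** In an orthonormal frame A becomes the identity, and E (A - B) E^T has entries of size at most d
    K. By 2 |w_i w_j| <= w_i^2 + w_j^2 its quadratic form is at most d K n |w|^2 < |w|^2. *)
Lemma posdef_near n (A : 'M[R]_n) : A^T = A -> posdef A ->
  exists2 d : R, 0 < d & forall B : 'M[R]_n, (forall i j, `|A i j - B i j| < d) -> posdef B.
Proof.
move=> sA pA; have [E _ EAE] := posdef_frame sA pA.
have uE : E \in unitmx.
  have : E *m (A *m E^T) = 1%:M by rewrite mulmxA.
  by case/mulmx1_unit.
pose K := \sum_a \sum_b \sum_i \sum_j `|E a i| * `|E b j|.
have K0 : 0 <= K by do 4!(apply: sumr_ge0 => ? _); exact: mulr_ge0.
(* Makes d K n < 1; the added units keep d meaningful when K or n is 0. *)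
pose d := ((K + 1) * (n%:R + 1))^-1.
have d0 : 0 < d by rewrite invr_gt0 mulr_gt0// ltr_wpDl.
exists d => // B AB.
have close a b : `|(1%:M - E *m B *m E^T) a b| <= d * K.
  rewrite -EAE -mulmxBl -mulmxBr !mxE.
  apply: (le_trans (ler_norm_sum _ _ _)).
  pose T a b := \sum_j \sum_i d * `|E a i| * `|E b j|.
  have T0 a' b' : 0 <= T a' b'.
    by do 2!(apply: sumr_ge0 => ? _); rewrite !mulr_ge0// ltW.
  have -> : d * K = \sum_a \sum_b T a b.
    rewrite /K mulr_sumr; apply: eq_bigr => a' _; rewrite mulr_sumr; apply: eq_bigr => b' _.
    rewrite exchange_big mulr_sumr; apply: eq_bigr => j _.
    by rewrite mulr_sumr; apply: eq_bigr => i _; rewrite mulrA.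
  apply: (@le_trans _ _ (T a b)); last first.
    apply: (@le_trans _ _ (\sum_b T a b)).
      by rewrite [leRHS](bigD1 b)//= lerDl; apply: sumr_ge0.
    by rewrite [leRHS](bigD1 a)//= lerDl; do 2!(apply: sumr_ge0 => ? _).
  apply: ler_sum => j _; rewrite normrM !mxE -mulr_suml ler_wpM2r//.
  apply: (le_trans (ler_norm_sum _ _ _)); apply: ler_sum => i _.
  by rewrite normrM mulrC ler_wpM2r// !mxE ltW.
move=> v v0.
have [w wE] : exists w, v = w *m E by exists (v *m invmx E); rewrite mulmxKV.
have w0 : w != 0 by apply: contraNneq v0 => w0; rewrite wE w0 mul0mx.
have -> : bform B v v = bform 1%:M w w - bform (1%:M - E *m B *m E^T) w w.
  by rewrite bformB opprB addrC subrK bform_mul -wE.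
have n1 : bform 1%:M w w = \sum_i w 0 i ^+ 2.
  rewrite /bform mulmx1 [LHS]mxE; apply: eq_bigr => i _.
  by rewrite [X in _ * X]mxE expr2.
have npos : 0 < \sum_i w 0 i ^+ 2.
  rewrite lt_neqAle sumr_ge0 ?andbT; last by move=> i _; exact: sqr_ge0.
  apply: contra w0; rewrite eq_sym psumr_eq0; last by move=> i _; exact: sqr_ge0.
  move=> /allP h; apply/eqP/rowP => i; rewrite mxE; apply/eqP.
  by have := h i (mem_index_enum _); rewrite /= sqrf_eq0.
rewrite n1 subr_gt0.
have : bform (1%:M - E *m B *m E^T) w w <= d * K * n%:R * \sum_i w 0 i ^+ 2.
  rewrite /bform mxE.
  apply: (@le_trans _ _ (\sum_j \sum_i d * K * ((w 0 i ^+ 2 + w 0 j ^+ 2) / 2))).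
    apply: ler_sum => j _; rewrite mxE mulr_suml; apply: ler_sum => i _.
    apply: le_trans (ler_norm _) _; rewrite [w^T _ _]mxE !normrM -mulrA mulrCA.
    apply: (@le_trans _ _ (d * K * (`|w 0 i| * `|w 0 j|))).
      by rewrite ler_wpM2r// mulr_ge0.
    apply: ler_wpM2l; first by rewrite mulr_ge0// ltW.
    rewrite -[X in _ <= (X + _) / _]real_normK ?num_real// -[X in _ <= (_ + X) / _]real_normK ?num_real//.
    move: `|_| `|_| => s t; rewrite ler_pdivlMr//.
    by have := sqr_ge0 (s - t); lra.
  under eq_bigr => j _ do rewrite -mulr_sumr -mulr_suml big_split/= sumr_const card_ord.
  rewrite -mulr_sumr -mulr_suml big_split/= sumr_const card_ord -sumrMnl.
  have half (z : R) : (z + z) / 2 = z by field.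
  by rewrite half -[leRHS]mulrA mulr_natl sumrMnl.
move/le_lt_trans; apply; rewrite gtr_pMl//.
rewrite /d -mulrA mulrC ltr_pdivrMr ?mul1r ?mulr_gt0 ?ltr_wpDl//.
have n0 : (0 : R) <= n%:R by [].
clear -K0 n0; move: K n%:R K0 n0 => a b a0 b0; nra.
Qed.

End Frames.
(** * Levi-Civita connection and curvature *)

Section InverseDerivative.
Variables (R : realType) (n : nat).
Local Notation E := 'rV[R]_n.

Lemma differentiable_prod (I : Type) (r : seq I) (f : I -> E -> R) x :
  (forall i, differentiable (f i) x) -> differentiable (fun y => \prod_(i <- r) f i y) x.
Proof.
move=> df; elim: r => [|i r IH].
  rewrite (_ : (fun y => _) = cst 1); first exact: differentiable_cst.
  by apply/funext => y; rewrite big_nil.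
rewrite (_ : (fun y => _) = f i * (fun y => \prod_(j <- r) f j y)).
  exact: differentiableM.
by apply/funext => y; rewrite big_cons.
Qed.

Lemma differentiable_det m (A : E -> 'M[R]_m) x : dmx A x ->
  differentiable (fun y => \det (A y)) x.
Proof.
move=> dA; pose r := index_enum 'S_m.
suff h (s : seq 'S_m) : differentiable
    (fun y => \sum_(t <- s) (-1) ^+ t * \prod_i A y i (t i)) x by exact: (h r).
elim: s => [|t s IH].
  rewrite (_ : (fun y => _) = cst 0); first exact: differentiable_cst.
  by apply/funext => y; rewrite big_nil.
rewrite (_ : (fun y => _) = (fun y => (-1) ^+ t *: \prod_i A y i (t i)) +
    (fun y => \sum_(t <- s) (-1) ^+ t * \prod_i A y i (t i))).
  apply: differentiableD => //.
  apply: (@differentiableZ _ _ _ (fun y => \prod_i A y i (t i))).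
  by apply: (@differentiable_prod _ _ (fun i y => A y i (t i))) => i; exact: dA.
by apply/funext => y; rewrite big_cons.
Qed.

(** Cramer's rule: near x the determinant stays nonzero and the entries of the inverse are quotients
    of polynomials in those of A. *)
Lemma dmx_inv m (A : E -> 'M[R]_m) x : dmx A x -> A x \in unitmx ->
  dmx (fun y => invmx (A y)) x /\ \forall y \near x, A y \in unitmx.
Proof.
move=> dA uA; have dd := differentiable_det dA.
have d0 : \det (A x) != 0 by rewrite -unitfE -unitmxE.
have nu : \forall y \near x, A y \in unitmx.
  have := differentiable_continuous dd => /cvgr_neq0 /(_ d0).
  by apply: filterS => y; rewrite unitmxE unitfE.
split=> // i j.
apply: (@differentiable_near _ _ _ ((fun y => (\det (A y))^-1) *
    (fun y => (-1) ^+ (j + i) *: \det (row' j (col' i (A y)))))).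
  by apply: filterS nu => y uy; rewrite /invmx uy mxE [\adj _ _ _]mxE.
apply: differentiableM; first exact: differentiableV.
apply: (@differentiableZ _ _ _ (fun y => \det (row' j (col' i (A y))))).
apply: differentiable_det => k l.
rewrite (_ : (fun y => _) = (fun y => A y (lift j k) (lift i l))); first exact: dA.
by apply/funext => y; rewrite !mxE.
Qed.

(** Differentiate the identity A^-1 A = 1. *)
Lemma isd_inv m (A : E -> 'M[R]_m) x v A' : isd A x v A' -> A x \in unitmx ->
  isd (fun y => invmx (A y)) x v (- (invmx (A x) *m A' *m invmx (A x))).
Proof.
move=> hA uA; have [di nu] := dmx_inv hA.1 uA.
split=> //; set B := dd v _ x.
have hp := isdM (isdP v di) hA.
have h1 : isd (fun y => invmx (A y) *m A y) x v 0.
  by apply: isd_near (isd_cst 1%:M x v); apply: filterS nu => y /mulVmx ->.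
have /(congr1 (mulmx^~ (invmx (A x)))) : B *m A x + invmx (A x) *m A' = 0.
  by rewrite -hp.2 h1.2.
by rewrite mulmxDl (mulmxK uA) mul0mx => /eqP; rewrite addr_eq0 => /eqP.
Qed.

End InverseDerivative.

(** * The Levi-Civita connection in matrix form *)

Section Connection.
Variables (R : realType) (n : nat).
Implicit Types (G : 'rV[R]_n -> 'M[R]_n) (x u v w : 'rV[R]_n).

(** The matrix of w |-> (D_w G)(u, -). With D_u G it gives the positive terms of the Koszul formula,
    and its transpose gives the negative one. *)
Definition gterm G x u : 'M[R]_n := \matrix_(j, l) (u *m dd (delta_mx 0 j) G x) 0 l.

(* w *m conn G x u is the Christoffel bilinear map applied to u and w. *)
Definition conn G x u : 'M[R]_n :=
  2^-1 *: ((dd u G x + gterm G x u - (gterm G x u)^T) *m invmx (G x)).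

Lemma gterm_mul G x u w : dmx G x -> w *m gterm G x u = u *m dd w G x.
Proof.
move=> dG; rewrite (dd_vec w dG) mulmx_sumr; apply/rowP => l.
rewrite mxE summxE; apply: eq_bigr => j _.
by rewrite -scalemxAr [RHS]mxE [gterm _ _ _ _ _]mxE.
Qed.

Lemma dd_tr_sym G x u : dmx G x -> (\forall y \near x, (G y)^T = G y) ->
  (dd u G x)^T = dd u G x.
Proof.
move=> dG sG; have h := isd_tr (isdP u dG).
by have [_ <-] := isd_near sG h.
Qed.

(** The Levi-Civita connection is torsion-free: exchanging u and w exchanges the two positive Koszul
    terms and fixes the third. *)
Lemma conn_sym G x u w : dmx G x -> (\forall y \near x, (G y)^T = G y) ->
  w *m conn G x u = u *m conn G x w.
Proof.
move=> dG sG; rewrite /conn -!scalemxAr !mulmxA; congr (_ *: (_ *m _)).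
rewrite !(mulmxBr, mulmxDr) !gterm_mul//; congr (_ - _); first by rewrite addrC.
have gt a b l : (a *m (gterm G x b)^T) 0 l = bform (dd (delta_mx 0 l) G x) b a.
  rewrite /bform !mxE; apply: eq_bigr => j _.
  by rewrite [_^T _ _]mxE [gterm _ _ _ _ _]mxE mulrC [a^T _ _]mxE.
by apply/rowP => l; rewrite !gt -bform_tr dd_tr_sym.
Qed.

(** Metric compatibility: in the sum with the transpose the two [gterm] contributions cancel and D_u
    G remains. *)
Lemma conn_compat G x u : dmx G x -> (\forall y \near x, (G y)^T = G y) -> G x \in unitmx ->
  conn G x u *m G x + G x *m (conn G x u)^T = dd u G x.
Proof.
move=> dG sG uG; have sx := nbhs_singleton sG.
rewrite /conn linearZ/= trmx_mul trmx_inv sx -scalemxAl -scalemxAr -scalerDr.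
rewrite (mulmxKV uG) mulmxA (mulmxV uG) mul1mx linearB !linearD/= trmxK dd_tr_sym//.
move: (dd u G x) (gterm G x u) => D L.
by apply/matrixP => i j; rewrite !mxE; field.
Qed.

Lemma gterm_lin G x a u v : gterm G x (a *: u + v) = a *: gterm G x u + gterm G x v.
Proof. by apply/matrixP => i j; rewrite mxE mulmxDl -scalemxAl !mxE. Qed.

Lemma conn_christoffel G x i j k : dmx G x -> (\forall y \near x, (G y)^T = G y) ->
  conn G x (delta_mx 0 i) j k = christoffel G x k i j.
Proof.
move=> dG sG; have sx := nbhs_singleton sG.
rewrite /conn mxE [X in _ * X]mxE; congr (_ * _); apply: eq_bigr => l _.
rewrite mulrC; congr (_ * _); first by rewrite -[in LHS]sx -trmx_inv mxE.
have g a b : gterm G x (delta_mx 0 i) a b = dd (delta_mx 0 a) G x i b.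
  by rewrite mxE -rowE mxE.
have e (A B C : 'M[R]_n) : (A + B - C^T) j l = A j l + B j l - C l j by rewrite !mxE.
by rewrite e !g !ddE.
Qed.

End Connection.

(** * The curvature operator and its symmetries *)

Section Curvature.
Variables (R : realType) (n : nat).
Implicit Types (G : 'rV[R]_n -> 'M[R]_n) (x u v w z : 'rV[R]_n) (U : set 'rV[R]_n).

Lemma addmxE m p (A B : 'M[R]_(m, p)) i j : (A + B) i j = A i j + B i j.
Proof. exact: mxE. Qed.

Lemma oppmxE m p (A : 'M[R]_(m, p)) i j : (- A) i j = - A i j.
Proof. exact: mxE. Qed.

Lemma scalemxE m p a (A : 'M[R]_(m, p)) i j : (a *: A) i j = a * A i j.
Proof. exact: mxE. Qed.

Lemma trmxD m p (A B : 'M[R]_(m, p)) : (A + B)^T = A^T + B^T.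
Proof. exact: linearD. Qed.

Lemma trmxN m p (A : 'M[R]_(m, p)) : (- A)^T = - A^T.
Proof. exact: linearN. Qed.

Definition trmxE := (trmxD, trmxN).

Definition mxlinE := (addmxE, oppmxE, scalemxE).

Definition mxdistrE := (@mulmxDl R, @mulmxDr R, @mulmxBl R, @mulmxBr R, @mulNmx R, @mulmxN R).

Record metric_on U G : Prop := MetricOn {
  metric_on_smx : smx U G;
  metric_on_sym : forall x, U x -> (G x)^T = G x;
  metric_on_pos : forall x, U x -> posdef (G x) }.

Variables (U : set 'rV[R]_n) (G : 'rV[R]_n -> 'M[R]_n).
Hypothesis mG : metric_on U G.

Lemma metric_on_near x (P : 'rV[R]_n -> Prop) : U x -> (forall y, U y -> P y) ->
  \forall y \near x, P y.
Proof. by move=> Ux h; exact: (filterS h (smx_near (metric_on_smx mG) Ux)). Qed.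

Lemma metric_on_nsym x : U x -> \forall y \near x, (G y)^T = G y.
Proof. by move=> Ux; apply: metric_on_near Ux _ => y Uy; exact: (metric_on_sym mG Uy). Qed.

Lemma metric_on_dmx x : U x -> dmx G x.
Proof. exact: smx_dmx (metric_on_smx mG). Qed.

Lemma metric_on_unit x : U x -> G x \in unitmx.
Proof. by move=> Ux; apply: posdef_unit; exact: (metric_on_pos mG Ux). Qed.

Lemma metric_on_conn_sym x u w : U x -> w *m conn G x u = u *m conn G x w.
Proof. by move=> Ux; apply: conn_sym; [exact: metric_on_dmx|exact: metric_on_nsym]. Qed.

Lemma metric_on_conn_compat x u : U x ->
  conn G x u *m G x + G x *m (conn G x u)^T = dd u G x.
Proof.
move=> Ux; apply: conn_compat.
- exact: metric_on_dmx.
- exact: metric_on_nsym.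
- exact: metric_on_unit.
Qed.

Lemma gterm_dmx x u : U x -> dmx (fun y => gterm G y u) x.
Proof.
move=> Ux j l.
rewrite (_ : (fun y => _) = (fun y => (u *m dd (delta_mx 0 j) G y) 0 l)).
  exact: (isdcM u (smx_isd2 (delta_mx 0 j) 0 (metric_on_smx mG) Ux)).1.
by apply/funext => y; rewrite mxE.
Qed.

Lemma conn_dmx x u : U x -> dmx (fun y => conn G y u) x.
Proof.
move=> Ux; have h1 := smx_isd2 u 0 (metric_on_smx mG) Ux.
have h2 := isdP 0 (gterm_dmx u Ux).
have h3 := isd_inv (isdP 0 (metric_on_dmx Ux)) (metric_on_unit Ux).
exact: (isdZ 2^-1 (isdM (isdB (isdD h1 h2) (isd_tr h2)) h3)).1.
Qed.

Lemma conn_lin x a u v : U x -> conn G x (a *: u + v) = a *: conn G x u + conn G x v.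
Proof.
move=> Ux; rewrite /conn gterm_lin dd_lin; last exact: metric_on_dmx.
rewrite linearD linearZ/= !scalerA (mulrC a) -!scalerA -scalerDr scalemxAl -mulmxDl.
congr (_ *: (_ *m _)).
move: (dd u G x) (dd v G x) (gterm G x u) (gterm G x v) => A B C D.
by apply/matrixP => i j; rewrite !mxE; ring.
Qed.

Lemma conn_vec x u : U x -> conn G x u = \sum_k u 0 k *: conn G x (delta_mx 0 k).
Proof.
move=> Ux.
have conn0 : conn G x 0 = 0.
  have := conn_lin (-1) 0 0 Ux; rewrite scaler0 addr0 scaleN1r => ->.
  exact: addNr.
rewrite {1}(row_sum_delta u); elim: (index_enum _) => [|k s IH].
  by rewrite !big_nil conn0.
by rewrite !big_cons conn_lin// IH.
Qed.

(* z *m Rmx G x u w is R(u, w) z. *)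
Definition Rmx G x u w : 'M[R]_n :=
  dd u (fun y => conn G y w) x - dd w (fun y => conn G y u) x
  + conn G x w *m conn G x u - conn G x u *m conn G x w.

Lemma Rmx_anti x u w : Rmx G x w u = - Rmx G x u w.
Proof.
rewrite /Rmx; move: (dd u _ x) (dd w _ x) (_ *m _) (_ *m _) => A B C D.
by apply/matrixP => i j; rewrite !mxlinE; ring.
Qed.

(** Differentiate metric compatibility once more: the symmetry of the second derivatives of G leaves
    R G + G R^T = 0. *)
Lemma Rmx_skew x u w : U x -> Rmx G x u w *m G x = - (G x *m (Rmx G x u w)^T).
Proof.
move=> Ux.
have main a b : dd a (dd b G) x =
   dd a (fun y => conn G y b) x *m G x + conn G x b *m dd a G x +
   (dd a G x *m (conn G x b)^T + G x *m (dd a (fun y => conn G y b) x)^T).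
  have hc := isdP a (conn_dmx b Ux).
  have hG := isdP a (metric_on_dmx Ux).
  have h := isdD (isdM hc hG) (isdM hG (isd_tr hc)).
  suff : isd (dd b G) x a (dd a (fun y => conn G y b) x *m G x + conn G x b *m dd a G x +
   (dd a G x *m (conn G x b)^T + G x *m (dd a (fun y => conn G y b) x)^T)) by case.
  apply: isd_near h; apply: metric_on_near Ux _ => y Uy; exact: metric_on_conn_compat.
have := dd_swap u w (metric_on_smx mG) Ux; rewrite !main -!metric_on_conn_compat//.
rewrite /Rmx; move: (dd u (fun y => conn G y w) x) (dd w (fun y => conn G y u) x).
move: (conn G x u) (conn G x w) (G x) => A B g C D.
rewrite !trmxE !trmx_mul !mxdistrE !mulmxA => e.
apply/matrixP => i j; have := congr1 (fun X : 'M[R]_n => X i j) e.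
by rewrite !mxlinE => {}e; lra.
Qed.

Lemma Rmx_skew_form x u w z y : U x ->
  bform (Rmx G x u w *m G x) z y = - bform (Rmx G x u w *m G x) y z.
Proof.
move=> Ux; rewrite {1}Rmx_skew// bformN; congr (- _).
by rewrite -bform_tr trmx_mul trmxK (metric_on_sym mG Ux).
Qed.

Lemma riemann_mx x i j k l : U x ->
  riemann G x l i j k = Rmx G x (delta_mx 0 i) (delta_mx 0 j) k l.
Proof.
move=> Ux.
have cc y : U y -> forall i j k, christoffel G y k i j = conn G y (delta_mx 0 i) j k.
  by move=> Uy *; rewrite conn_christoffel//; [exact: metric_on_dmx|exact: metric_on_nsym].
have pc a b c d : partial a (fun y => christoffel G y b c d) x =
    dd (delta_mx 0 a) (fun y => conn G y (delta_mx 0 c)) x d b.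
  rewrite ddE /partial; apply: near_eq_derive.
  by apply: metric_on_near Ux _ => y /cc.
rewrite /riemann !pc /Rmx -[in RHS](addrA (_ - _)) addmxE; congr (_ + _); first by rewrite addmxE oppmxE.
rewrite addmxE oppmxE sumrB; congr (_ - _); rewrite mxE; apply: eq_bigr => m _;
  by rewrite !cc// mulrC.
Qed.

Lemma Rmx_vec x u w : U x -> Rmx G x u w =
  \sum_i \sum_j (u 0 i * w 0 j) *: Rmx G x (delta_mx 0 i) (delta_mx 0 j).
Proof.
move=> Ux.
have dc a b : dd a (fun y => conn G y b) x =
    \sum_i \sum_j (a 0 i * b 0 j) *: dd (delta_mx 0 i) (fun y => conn G y (delta_mx 0 j)) x.
  rewrite (dd_vec a (conn_dmx b Ux)); apply: eq_bigr => i _.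
  transitivity (a 0 i *: \sum_j b 0 j *: dd (delta_mx 0 i) (fun y => conn G y (delta_mx 0 j)) x).
    congr (_ *: _).
    have h := isd_sum (index_enum 'I_n)
      (fun j => isdZ (b 0 j) (isdP (delta_mx 0 i) (conn_dmx (delta_mx 0 j) Ux))).
    suff : isd (fun y => conn G y b) x (delta_mx 0 i)
        (\sum_j b 0 j *: dd (delta_mx 0 i) (fun y => conn G y (delta_mx 0 j)) x) by case.
    apply: isd_near h; apply: metric_on_near Ux _ => y Uy; by rewrite (conn_vec b Uy).
  by rewrite scaler_sumr; apply: eq_bigr => j _; rewrite scalerA.
have cm a b : conn G x a *m conn G x b =
    \sum_i \sum_j (a 0 i * b 0 j) *: (conn G x (delta_mx 0 i) *m conn G x (delta_mx 0 j)).
  rewrite (conn_vec a Ux) mulmx_suml; apply: eq_bigr => i _.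
  rewrite {1}(conn_vec b Ux) mulmx_sumr; apply: eq_bigr => j _.
  by rewrite -scalemxAl -scalemxAr scalerA.
have dcx a b : dd a (fun y => conn G y b) x =
    \sum_i \sum_j (a 0 j * b 0 i) *: dd (delta_mx 0 j) (fun y => conn G y (delta_mx 0 i)) x.
  by rewrite dc exchange_big.
have cmx a b : conn G x a *m conn G x b =
    \sum_i \sum_j (a 0 j * b 0 i) *: (conn G x (delta_mx 0 j) *m conn G x (delta_mx 0 i)).
  by rewrite cm exchange_big.
rewrite /Rmx (dc u w) (dcx w u) (cmx w u) (cm u w).
rewrite -sumrB -big_split -sumrB/=; apply: eq_bigr => i _.
rewrite -sumrB -big_split -sumrB/=; apply: eq_bigr => j _.
by rewrite (mulrC (w 0 j)) scalerBr scalerDr scalerBr.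
Qed.

Lemma Rmx_vecl x u w : U x -> Rmx G x u w = \sum_i u 0 i *: Rmx G x (delta_mx 0 i) w.
Proof.
move=> Ux; rewrite (Rmx_vec u w Ux); apply: eq_bigr => i _.
rewrite (Rmx_vec (delta_mx 0 i) w Ux) [in RHS](bigD1 i)//= [X in _ = _ *: (_ + X)]big1 ?addr0; last first.
  by move=> k /negbTE ki; rewrite big1// => j _; rewrite mxE ki mul0r scale0r.
by rewrite scaler_sumr; apply: eq_bigr => j _; rewrite mxE !eqxx/= mul1r scalerA.
Qed.

Lemma Rmx_vecr x u w : U x -> Rmx G x u w = \sum_j w 0 j *: Rmx G x u (delta_mx 0 j).
Proof.
move=> Ux; rewrite Rmx_anti (Rmx_vecl w u Ux) -sumrN; apply: eq_bigr => j _.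
by rewrite -scalerN -Rmx_anti.
Qed.

Lemma riemann_form_mx x u v w z : U x ->
  riemann_form G x u v w z = bform (Rmx G x u v *m G x) w z.
Proof.
move=> Ux; rewrite /riemann_form /bform mulmxA.
rewrite (Rmx_vec u v Ux) mulmx_sumr !mulmx_suml summxE; apply: eq_bigr => i _.
rewrite mulmx_sumr !mulmx_suml summxE; apply: eq_bigr => j _.
rewrite -scalemxAr -!scalemxAl mxE.
under eq_bigr => k _ do under eq_bigr => l _ do under eq_bigr => m _ do rewrite riemann_mx//.
move: (Rmx G x _ _) => B.
rewrite -!mulmxA [in RHS]mxE mulr_sumr; apply: eq_bigr => k _.
rewrite [X in _ = _ * (_ * X)]mxE 2!mulr_sumr; apply: eq_bigr => l _.
rewrite [X in _ = _ * (_ * (_ * X))]mxE 3!mulr_sumr; apply: eq_bigr => m _.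
by rewrite [z^T _ _]mxE; ring.
Qed.


(** The matrix [N] represents e |-> R(e, v) w, whose trace is Ric(v, w). Since E has inverse G E^T,
    conjugation by E writes this trace as a sum over the frame. *)
Lemma ricci_mx x v w (E : 'M[R]_n) : U x -> E *m G x *m E^T = 1%:M ->
  bform (ricci G x) v w = \sum_a riemann_form G x (row a E) v w (row a E).
Proof.
move=> Ux EGE.
pose N := \matrix_(i < n) (w *m Rmx G x (delta_mx 0 i) v).
have NE e : e *m N = w *m Rmx G x e v.
  rewrite (Rmx_vecl e v Ux) mulmx_sum_row mulmx_sumr; apply: eq_bigr => i _.
  by rewrite rowK -scalemxAr.
transitivity (\tr N).
  rewrite /bform mxE /mxtrace.
  have Nii i : N i i = \sum_j v 0 j * \sum_k w 0 k * Rmx G x (delta_mx 0 i) (delta_mx 0 j) k i.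
    rewrite mxE (Rmx_vecr (delta_mx 0 i) v Ux) mulmx_sumr summxE; apply: eq_bigr => j _.
    by rewrite -scalemxAr mxE; congr (_ * _); rewrite mxE.
  under [RHS]eq_bigr => i _ do rewrite Nii.
  under [LHS]eq_bigr => k _ do rewrite [w^T _ _]mxE mxE mulr_suml.
  rewrite exchange_big/= [RHS]exchange_big/=; apply: eq_bigr => j _.
  rewrite -mulr_sumr exchange_big mulr_sumr/=; apply: eq_bigr => k _.
  rewrite -mulr_sumr mxE -mulrA; congr (_ * _); rewrite mulrC; congr (_ * _).
  by apply: eq_bigr => i _; rewrite riemann_mx.
transitivity (\tr (E *m N *m (G x *m E^T))).
  rewrite mxtrace_mulC !mulmxA.
  have : (G x *m E^T) *m E = 1%:M by apply: mulmx1C; rewrite mulmxA.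
  by move=> ->; rewrite mul1mx.
apply: eq_bigr => a _.
by rewrite riemann_form_mx// mulmxA -(mulmxA E N) -bform_rows /bform !mulmxA NE.
Qed.

End Curvature.

(** * Consequences of the curvature hypotheses on the target *)

Section FormSums.
Variables (R : realType) (n : nat).

Lemma bform_sum (I : Type) (r : seq I) (A : I -> 'M[R]_n) u v :
  bform (\sum_(i <- r) A i) u v = \sum_(i <- r) bform (A i) u v.
Proof. by rewrite /bform mulmx_sumr mulmx_suml summxE. Qed.

Lemma bform_vecl (A : 'M[R]_n) u v : bform A u v = \sum_i u 0 i * bform A (delta_mx 0 i) v.
Proof.
rewrite {1}/bform {1}(row_sum_delta u) !mulmx_suml summxE; apply: eq_bigr => i _.
by rewrite -!scalemxAl [LHS]mxE.
Qed.

End FormSums.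

Section CurvatureBounds.
Variables (R : realType) (n : nat).
Variables (U : set 'rV[R]_n) (G : 'rV[R]_n -> 'M[R]_n).
Hypothesis mG : metric_on U G.
Implicit Types (x u v w z : 'rV[R]_n).

Let gram x u v := bform (G x) u u * bform (G x) v v - bform (G x) u v ^+ 2.

Lemma riemann_form_swap x u v w z : U x ->
  riemann_form G x u v w z = riemann_form G x v u z w.
Proof.
move=> Ux; rewrite !(riemann_form_mx mG)// (Rmx_skew_form mG)//.
by rewrite (Rmx_anti G x v u) mulNmx bformN opprK.
Qed.

Lemma riemann_form_diag x u w z : U x -> riemann_form G x u u w z = 0.
Proof.
move=> Ux; rewrite (riemann_form_mx mG)//.
have -> : Rmx G x u u = 0.
  apply/matrixP => i j; have := congr1 (fun X : 'M[R]_n => X i j) (Rmx_anti G x u u).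
  by rewrite oppmxE => h; rewrite [RHS]mxE; move: (Rmx _ _ _ _ _ _) h => r h; lra.
by rewrite mul0mx /bform mulmx0 mul0mx mxE.
Qed.

Lemma riemann_form_Zr x u a v w z : U x ->
  riemann_form G x u (a *: v) w z = a * riemann_form G x u v w z.
Proof.
move=> Ux; rewrite !(riemann_form_mx mG)// -bformZ; congr bform; rewrite scalemxAl; congr (_ *m _).
rewrite !(Rmx_vecr mG _ _ Ux) scaler_sumr; apply: eq_bigr => i _.
by rewrite mxE scalerA.
Qed.

Lemma metric_bformC x u v : U x -> bform (G x) u v = bform (G x) v u.
Proof. by move=> Ux; rewrite -bform_tr (metric_on_sym mG Ux). Qed.

(** Bounds on sectional curvature speak of independent pairs only, whereas the images of a frame may
    be dependent. For a dependent pair both the curvature and the Gram determinant vanish, so the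
    bounds persist in product form. *)
Lemma gram_cases x u v : U x ->
  (forall w z, riemann_form G x u v w z = 0) /\ gram x u v = 0 \/
  row_free (col_mx u v) /\ 0 < gram x u v.
Proof.
move=> Ux; have pG := metric_on_pos mG Ux; have sG := metric_bformC u v Ux.
have [u0|un0] := eqVneq u 0.
  left; rewrite /gram u0; split=> [w z|].
    have h := riemann_form_Zr v 0 0 z w Ux; rewrite scale0r mul0r in h.
    by rewrite riemann_form_swap.
  by rewrite /bform !mul0mx mxE mul0r expr2 mul0r subr0.
(* The vector v - c u is the component of v orthogonal to u, of squared length gram / G(u, u). *)
have uu := pG u un0; pose c := bform (G x) u v / bform (G x) u u.
have q : bform (G x) (v - c *: u) (v - c *: u) = gram x u v / bform (G x) u u.
  rewrite -scaleNr !(bformDl, bformDr, bformZl, bformZr) -sG /c /gram.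
  by field; exact: lt0r_neq0.
have [vc|vnc] := eqVneq (v - c *: u) 0.
  left; split=> [w z|].
    by rewrite -(subrK (c *: u) v) vc add0r riemann_form_Zr// riemann_form_diag// mulr0.
  move: q; rewrite vc {1}/bform !mul0mx mxE => /esym/eqP.
  by rewrite mulf_eq0 invr_eq0 (gt_eqF uu) orbF => /eqP.
right; have gp : 0 < gram x u v.
  by have := pG _ vnc; rewrite q pmulr_lgt0// invr_gt0.
split=> //; rewrite -kermx_eq0; apply/eqP/row_matrixP => i; rewrite row0.
set r := row i _; have : r *m col_mx u v = 0 by rewrite -row_mul mulmx_ker row0.
rewrite -(hsubmxK r) mul_row_col (mx11_scalar (lsubmx r)) (mx11_scalar (rsubmx r)) !mul_scalar_mx.
move: (lsubmx r 0 0) (rsubmx r 0 0) => a b ab0.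
have e w : a * bform (G x) u w + b * bform (G x) v w = 0.
  by rewrite -!bformZl -bformDl ab0 /bform !mul0mx mxE.
have e1 := e u; have e2 := e v; rewrite -sG in e1.
move: gp e1 e2; rewrite /gram; move: (bform (G x) u u) (bform (G x) v v) (bform (G x) u v) => X Y Z gp e1 e2.
have a0 : a = 0.
  have : a * (X * Y - Z ^+ 2) = 0.
    have -> : a * (X * Y - Z ^+ 2) = (a * X + b * Z) * Y - (a * Z + b * Y) * Z by ring.
    by rewrite e1 e2 !mul0r subr0.
  by move/eqP; rewrite mulf_eq0 (gt_eqF gp) orbF => /eqP.
have b0 : b = 0.
  have : b * (X * Y - Z ^+ 2) = 0.
    have -> : b * (X * Y - Z ^+ 2) = (a * Z + b * Y) * X - (a * X + b * Z) * Z by ring.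
    by rewrite e1 e2 !mul0r subr0.
  by move/eqP; rewrite mulf_eq0 (gt_eqF gp) orbF => /eqP.
by rewrite a0 b0 !raddf0 row_mx0.
Qed.

Lemma sectional_le_riemann x u v kappa : U x ->
  (forall u v, row_free (col_mx u v) -> sectional G x u v <= kappa) ->
  riemann_form G x u v v u <= kappa * gram x u v.
Proof.
move=> Ux h; have [[-> ->]|[rf gp]] := gram_cases u v Ux; first by rewrite mulr0.
by have := h _ _ rf; rewrite /sectional ler_pdivrMr.
Qed.

Lemma sectional_ge_riemann x u v : U x ->
  (forall u v, row_free (col_mx u v) -> 0 <= sectional G x u v) ->
  0 <= riemann_form G x u v v u.
Proof.
move=> Ux h; have [[-> //]|[rf gp]] := gram_cases u v Ux.
by have := h _ _ rf; rewrite /sectional pmulr_lge0// invr_gt0.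
Qed.

(** If K <= kappa, each summand is at most kappa times a Gram determinant of P, and
    [sum_sectional_le] applies. In the other case S(a, b) = Rm(v J, a, b, v J) is a nonnegative
    form, so [sum_pullback_le] passes to an orthonormal frame of G x, over which S sums to Ric(v J,
    v J). *)
Lemma curvature_trace_le x (A E J : 'M[R]_n) v (c kappa : R) : U x ->
  let P := J *m G x *m J^T in
  A^T = A -> posdef A -> E^T *m E = invmx A -> E *m A *m E^T = 1%:M ->
  0 < c -> possemidef (A - c *: P) -> v *m (A - c *: P) = 0 -> 0 <= kappa ->
  (forall u w, row_free (col_mx u w) -> sectional G x u w <= kappa) \/
  (forall u w, row_free (col_mx u w) -> 0 <= sectional G x u w) /\
  form_le (ricci G x) (((n%:R - 1) * kappa) *: G x) ->
  c * \sum_a riemann_form G x (v *m J) (row a E *m J) (row a E *m J) (v *m J)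
    <= (n%:R - 1) * kappa * bform P v v.
Proof.
move=> Ux P sA pA EE EAE c0 pZ vZ k0 [hk|[hs hr]].
- have sP : P^T = P by rewrite /P !trmx_mul trmxK (metric_on_sym mG Ux) mulmxA.
  have h := ler_wpM2l k0 (sum_sectional_le sA sP pA EE EAE c0 pZ vZ).
  rewrite (mulrC (n%:R - 1) kappa) -mulrA; apply: le_trans h.
  rewrite mulrCA; apply: ler_wpM2l; first exact: ltW.
  rewrite mulr_sumr; apply: ler_sum => a _.
  by rewrite !bform_mul; exact: sectional_le_riemann.
- have pG := metric_on_pos mG Ux; have sG := metric_on_sym mG Ux.
  pose S := \matrix_(i < n, j < n) riemann_form G x (v *m J) (delta_mx 0 i) (delta_mx 0 j) (v *m J).
  have SE a b : bform S a b = riemann_form G x (v *m J) a b (v *m J).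
    rewrite (riemann_form_mx mG)// (Rmx_vecr mG _ _ Ux) mulmx_suml bform_sum.
    rewrite bform_vecl; apply: eq_bigr => i _; rewrite -scalemxAl bformZ; congr (_ * _).
    rewrite [RHS]bform_vecl /bform -rowE [LHS]mxE; apply: eq_bigr => j _.
    by rewrite [b^T _ _]mxE mulrC; congr (_ * _); rewrite mxE [LHS]mxE (riemann_form_mx mG).
  have pS : possemidef S by move=> w; rewrite SE; exact: sectional_ge_riemann.
  have [F FF FGF] := posdef_frame sG pG.
  have := sum_pullback_le sA sG pA pG EE c0 pZ pS.
  under eq_bigr => a _ do rewrite SE.
  move/le_trans; apply; rewrite -FF mxtrace_frame.
  under eq_bigr => a _ do rewrite SE riemann_form_swap//.
  rewrite -(ricci_mx mG _ _ Ux FGF).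
  by have := hr (v *m J); rewrite bformZ bform_mul.
Qed.

End CurvatureBounds.
(** * The Bochner inequality for the heat flow *)

Section SecondFundamentalForm.
Variables (R : realType) (n : nat).
Implicit Types (x y u v w e : 'rV[R]_n).
Variables (U W : set 'rV[R]_n) (G H : 'rV[R]_n -> 'M[R]_n) (f : 'rV[R]_n -> 'rV[R]_n).

(* A second copy of the Jacobian with entries visible to dd. *)
Definition jacmx x : 'M[R]_n := \matrix_(i, j) dd (delta_mx 0 i) f x 0 j.

(** The connection of the pulled-back bundle F^{-1}(TN) in direction u. *)
Definition pullconn u x : 'M[R]_n := conn H (f x) (u *m jacmx x).

(* w *m hessmx u x is the covariant Hessian of f evaluated at (u, w). *)
Definition hessmx u x : 'M[R]_n :=
  dd u jacmx x + jacmx x *m pullconn u x - conn G x u *m jacmx x.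

Definition tensionmx x : 'rV[R]_n :=
  \sum_i \sum_j invmx (G x) i j *: (delta_mx 0 j *m hessmx (delta_mx 0 i) x).

Hypothesis mG : metric_on U G.
Hypothesis mH : metric_on W H.
Hypothesis sf : smx U f.
Hypothesis fW : forall x, U x -> W (f x).

Lemma jacmx_mul x u : U x -> u *m jacmx x = dd u f x.
Proof.
move=> Ux; rewrite (dd_vec u (smx_dmx sf Ux)) mulmx_sum_row; apply: eq_bigr => i _.
by congr (_ *: _); apply/rowP => j; rewrite !mxE.
Qed.

Lemma jacmxE x : U x -> jacobian f x = jacmx x.
Proof.
move=> Ux; apply/row_matrixP => i.
by rewrite !rowE jacobian_dd ?jacmx_mul//; exact: smx_dmx sf Ux.
Qed.

Lemma jacmx_smx : smx U jacmx.
Proof.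
split; first exact: sf.1.
move=> i j; rewrite (_ : (fun y => _) = (fun y => dd (delta_mx 0 i) f y 0 j)).
  by have [_] := smx_dd (delta_mx 0 i) sf; exact.
by apply/funext => y; rewrite mxE.
Qed.

Lemma smooth_near x (P : 'rV[R]_n -> Prop) : U x -> (forall y, U y -> P y) -> \forall y \near x, P y.
Proof. by move=> Ux h; exact: (metric_on_near mG Ux h). Qed.

Lemma jac_isd x v : U x -> isd jacmx x v (dd v jacmx x).
Proof. by move=> Ux; exact: smx_isd jacmx_smx Ux. Qed.

Lemma dd_jacmx_mul x u w : U x -> w *m dd u jacmx x = dd u (dd w f) x.
Proof.
move=> Ux; have h := isdcM w (jac_isd u Ux).
suff : isd (dd w f) x u (w *m dd u jacmx x) by case.
by apply: isd_near h; apply: smooth_near Ux _ => y Uy; rewrite jacmx_mul.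
Qed.

Lemma dd_jacmx_sym x u w : U x -> w *m dd u jacmx x = u *m dd w jacmx x.
Proof. by move=> Ux; rewrite !dd_jacmx_mul//; exact: dd_swap sf Ux. Qed.

Lemma pullconn_sym x u w : U x ->
  w *m jacmx x *m pullconn u x = u *m jacmx x *m pullconn w x.
Proof. by move=> Ux; apply: (metric_on_conn_sym mH); exact: fW. Qed.

Lemma hessmx_sym x u w : U x -> w *m hessmx u x = u *m hessmx w x.
Proof.
move=> Ux; have e1 := dd_jacmx_sym u w Ux.
have e2 := pullconn_sym u w Ux; have e3 := metric_on_conn_sym mG u w Ux.
rewrite /hessmx; move: e1 e2 e3; move: (dd u jacmx x) (dd w jacmx x) (jacmx x) => Ju Jw J.
move: (pullconn u x) (pullconn w x) (conn G x u) (conn G x w) => Au Aw Cu Cw e1 e2 e3.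
by rewrite !mulmxBr !mulmxDr !mulmxA e1 e2 e3.
Qed.

Lemma pullconn_vec x u : U x ->
  pullconn u x = \sum_k (u *m jacmx x) 0 k *: conn H (f x) (delta_mx 0 k).
Proof. by move=> Ux; apply: (conn_vec mH); exact: fW. Qed.

(** Both the base point f y and the direction u J(y) vary. Expanding the direction in the standard
    basis separates the two: one term differentiates the coefficients, the other the connection of
    H. *)
Lemma pullconn_isd x u v : U x -> isd (pullconn u) x v
  (conn H (f x) (u *m dd v jacmx x) +
   dd (v *m jacmx x) (fun y => conn H y (u *m jacmx x)) (f x)).
Proof.
move=> Ux; have Wx := fW Ux; have df := smx_dmx sf Ux.
have hk k : isd (fun y => conn H (f y) (delta_mx 0 k)) x v
    (dd (v *m jacmx x) (fun y => conn H y (delta_mx 0 k)) (f x)).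
  rewrite jacmx_mul//.
  exact: isd_comp (fun y => conn H y (delta_mx 0 k)) f x v df (conn_dmx mH (delta_mx 0 k) Wx).
have h1 := isdcM u (jac_isd v Ux).
have h := isd_sum (index_enum 'I_n) (fun k => isd_scale 0 k h1 (hk k)).
apply: (isd_near (A := fun y => \sum_k (u *m jacmx y) 0 k *: conn H (f y) (delta_mx 0 k))).
  by apply: smooth_near Ux _ => y Uy; rewrite pullconn_vec.
apply: isd_eq h _; rewrite big_split/= -(conn_vec mH)//; congr (_ + _).
have hs := isd_sum (index_enum 'I_n) (fun k => isdZ ((u *m jacmx x) 0 k)
  (isdP (v *m jacmx x) (conn_dmx mH (delta_mx 0 k) Wx))).
suff : isd (fun y => conn H y (u *m jacmx x)) (f x) (v *m jacmx x)
  (\sum_k (u *m jacmx x) 0 k *: dd (v *m jacmx x) (fun y => conn H y (delta_mx 0 k)) (f x)).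
  by case.
by apply: isd_near hs; apply: (metric_on_near mH) Wx _ => y Wy; rewrite (conn_vec mH).
Qed.

Lemma pullmetric_isd x u : U x -> isd (fun y => H (f y)) x u
  (pullconn u x *m H (f x) + H (f x) *m (pullconn u x)^T).
Proof.
move=> Ux; have Wx := fW Ux.
have h := isd_comp u (smx_dmx sf Ux) (metric_on_dmx mH Wx).
by apply: isd_eq h _; rewrite -jacmx_mul// -(metric_on_conn_compat mH).
Qed.

Lemma conn_isd x u v : U x -> isd (fun y => conn G y u) x v (dd v (fun y => conn G y u) x).
Proof. by move=> Ux; apply: isdP; exact: (conn_dmx mG). Qed.

Lemma hessmx_isd x u v : U x -> isd (hessmx u) x v
  (dd v (dd u jacmx) x +
   (dd v jacmx x *m pullconn u x + jacmx x *m
     (conn H (f x) (u *m dd v jacmx x) +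
      dd (v *m jacmx x) (fun y => conn H y (u *m jacmx x)) (f x)))
   - (dd v (fun y => conn G y u) x *m jacmx x + conn G x u *m dd v jacmx x)).
Proof.
move=> Ux; apply: isdB.
  by apply: isdD; [exact: smx_isd2 jacmx_smx Ux|apply: isdM; [exact: jac_isd|exact: pullconn_isd]].
by apply: isdM; [exact: conn_isd|exact: jac_isd].
Qed.

(** By symmetry of the Hessian, u can be moved to the slot where linearity is matrix
    multiplication. *)
Lemma hessmx_vec x u : U x -> hessmx u x = \sum_i u 0 i *: hessmx (delta_mx 0 i) x.
Proof.
move=> Ux; apply/row_matrixP => k; rewrite !rowE hessmx_sym// {1}(row_sum_delta u).
rewrite mulmx_suml mulmx_sumr; apply: eq_bigr => i _.
by rewrite -scalemxAl -scalemxAr [RHS]/= hessmx_sym.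
Qed.

(** Commutation of covariant derivatives on dF: the third derivatives agree, and the curvatures of N
    along F and of M remain. The term in which the connection acts on the index w of the Hessian is
    symmetric in u and w, and is omitted from both sides. *)
Lemma hessmx_codazzi x u w : U x ->
  dd u (hessmx w) x + hessmx w x *m pullconn u x - conn G x u *m hessmx w x =
  dd w (hessmx u) x + hessmx u x *m pullconn w x - conn G x w *m hessmx u x
  + jacmx x *m Rmx H (f x) (u *m jacmx x) (w *m jacmx x) - Rmx G x u w *m jacmx x.
Proof.
move=> Ux; rewrite (hessmx_isd w u Ux).2 (hessmx_isd u w Ux).2.
rewrite (dd_swap u w jacmx_smx Ux) (dd_jacmx_sym u w Ux) /hessmx /Rmx.
rewrite -[conn H _ (u *m jacmx x)]/(pullconn u x) -[conn H _ (w *m jacmx x)]/(pullconn w x).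
move: (dd w (dd u jacmx) x) (dd u jacmx x) (dd w jacmx x) (jacmx x) => J2 Ju Jw J.
move: (pullconn u x) (pullconn w x) (conn H _ _) (dd _ _ (f x)) (dd _ _ (f x)) => Au Aw C D1 D2.
move: (dd u _ x) (dd w _ x) (conn G x u) (conn G x w) => Gu Gw Cu Cw.
rewrite !mxdistrE !mulmxA; apply/matrixP => i j; rewrite !mxlinE; ring.
Qed.

End SecondFundamentalForm.

(** * Derivatives of the defect tensor at a null vector *)

Section HessianInequality.
Variables (R : realType) (n : nat).
Implicit Types (x y u v w e : 'rV[R]_n).
Variables (U W : set 'rV[R]_n) (G H : 'rV[R]_n -> 'M[R]_n) (f : 'rV[R]_n -> 'rV[R]_n).
Hypothesis mG : metric_on U G.
Hypothesis mH : metric_on W H.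
Hypothesis sf : smx U f.
Hypothesis fW : forall x, U x -> W (f x).
Variable c : R.
Let J := jacmx f.
Let S := hessmx G H f.
Let A := pullconn H f.

Definition defect x := G x - c *: (jacmx f x *m H (f x) *m (jacmx f x)^T).

(** Both metrics are parallel, so the covariant derivative of Z is -c times the symmetrization of
    <Hess F(e, -), dF ->. The first two terms convert it into the ordinary derivative. *)
Lemma defect_isd x e : U x -> isd defect x e
  (conn G x e *m defect x + defect x *m (conn G x e)^T
   - c *: (S e x *m H (f x) *m (J x)^T + J x *m H (f x) *m (S e x)^T)).
Proof.
move=> Ux; have hJ := jac_isd sf e Ux.
have hH := pullmetric_isd mH sf fW e Ux.
have hG := isdP e (metric_on_dmx mG Ux).
apply: isd_eq (isdB hG (isdZ c (isdM (isdM hJ hH) (isd_tr hJ)))) _.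
rewrite -(metric_on_conn_compat mG e Ux) /defect /S /hessmx /J.
have sH := metric_on_sym mH (fW Ux).
move: (dd e _ x) (pullconn H f e x) (jacmx f x) (H (f x)) (G x) (conn G x e) sH => J' a j h g C sH.
rewrite !(trmxE, trmx_mul) !mxdistrE -?scalemxAl -?scalemxAr ?mxdistrE -?scalemxAl -?scalemxAr !mulmxA.
apply/matrixP => i k; rewrite !mxlinE; ring.
Qed.

Lemma mx11_tr (M : 'M[R]_1) : M^T = M.
Proof. by apply/matrixP => i j; rewrite mxE !ord1. Qed.

(* Second derivative at x of V Z V^T with V a vector field equal to v at x and with
   vanishing covariant derivative there. *)
Lemma hessian_algebra (Z C C' s s' j j' h a : 'M[R]_n) v :
  v *m Z = 0 -> Z^T = Z -> h^T = h -> j' = s + C *m j - j *m a ->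
  let Z1 := C *m Z + Z *m C^T - c *: (s *m h *m j^T + j *m h *m s^T) in
  let h1 := a *m h + h *m a^T in
  let Z2 := C' *m Z + C *m Z1 + (Z1 *m C^T + Z *m C'^T)
    - c *: ((s' *m h + s *m h1) *m j^T + s *m h *m j'^T
            + ((j' *m h + j *m h1) *m s^T + j *m h *m s'^T)) in
  let V' := - (v *m C) in
  (V' *m Z1 + (V' *m Z1 + v *m Z2)) *m v^T + (V' *m Z + v *m Z1) *m V'^T
   + ((V' *m Z + v *m Z1) *m V'^T) =
  - (2 * c) *: (v *m (s' + s *m a - C *m s) *m h *m (v *m j)^T
           + v *m s *m h *m (v *m s)^T).
Proof.
move=> vZ sZ sh ->; cbv zeta.
have Zv : Z *m v^T = 0 by rewrite -sZ -trmx_mul vZ trmx0.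
rewrite !(trmxE, trmx_mul) !mxdistrE -?scalemxAl -?scalemxAr ?mxdistrE -?scalemxAl -?scalemxAr.
do 2!rewrite -?scalemxAl -?scalemxAr ?mxdistrE.
rewrite !mulmxA.
have tr M : v *m M^T *m v^T = v *m M *m v^T.
  by rewrite -[LHS]mx11_tr !trmx_mul !trmxK mulmxA.
have t1 := tr (s' *m h *m j^T).
have t2 := tr (s *m a *m h *m j^T).
have t3 := tr (s *m h *m j^T *m C^T).
have t4 := tr (C *m s *m h *m j^T).
rewrite !trmx_mul !trmxK sh !mulmxA in t1 t2 t3 t4.
have z1 M : v *m M *m Z *m v^T = 0 by rewrite -mulmxA Zv mulmx0.
rewrite t1 t2 t3 t4 z1 -[v *m C *m C]mulmxA z1 vZ !mul0mx.
by apply/matrixP => i k; rewrite !mxlinE !mxE; ring.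
Qed.

(** The function V Z V^T is nonnegative and vanishes at x. Its first derivative gives the
    orthogonality of Hess F(v, e) and dF v; its second is -2 c times the third-order term plus |Hess
    F(v, e)|^2, and the square is discarded. *)
Lemma defect_hessian_le x v : U x -> 0 < c ->
  (forall y, U y -> possemidef (defect y)) -> v *m defect x = 0 ->
  let X := v *m J x in
  forall e, (v *m S e x *m H (f x) *m X^T) 0 0 = 0 /\
   (v *m (dd e (S e) x + S e x *m A e x - conn G x e *m S e x) *m H (f x) *m X^T) 0 0 <= 0.
Proof.
move=> Ux c0 pZ vZ X e; have Wx := fW Ux.
have sH := metric_on_sym mH Wx.
have sZ : (defect x)^T = defect x.
  rewrite /defect !(trmxE, trmx_mul) linearZ/= !trmx_mul trmxK sH mulmxA.
  by rewrite (metric_on_sym mG Ux).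
(* By symmetry of [conn] this affine field has derivative - v conn(e) along e, so its covariant
   derivative at x vanishes. *)
pose V y := v - (y - x) *m conn G x v.
have hV y : isd V y e (- (v *m conn G x e)).
  rewrite (metric_on_conn_sym mG e v Ux).
  have h := isdB (isd_cst v y e) (isdMc (conn G x v) (isdB (isd_id y e) (isd_cst x y e))).
  by apply: isd_eq h _; rewrite subr0 add0r.
pose Z1 y := conn G y e *m defect y + defect y *m (conn G y e)^T
   - c *: (S e y *m H (f y) *m (J y)^T + J y *m H (f y) *m (S e y)^T).
have hZ y : U y -> isd defect y e (Z1 y) by move=> Uy; exact: defect_isd.
have hW y Uy := isdM (isdM (hV y) (hZ y Uy)) (isd_tr (hV y)).
pose V' := - (v *m conn G x e).
pose W1 y := (V' *m defect y + V y *m Z1 y) *m (V y)^T + V y *m defect y *m V'^T.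
have hC := conn_isd mG e e Ux.
have hS : isd (S e) x e (dd e (S e) x) := isdP e (hessmx_isd mG mH sf fW e e Ux).1.
have hJ := jac_isd sf e Ux.
have hH := pullmetric_isd mH sf fW e Ux.
have hZ1 := isdB (isdD (isdM hC (hZ x Ux)) (isdM (hZ x Ux) (isd_tr hC)))
  (isdZ c (isdD (isdM (isdM hS hH) (isd_tr hJ)) (isdM (isdM hJ hH) (isd_tr hS)))).
have hW1 := isdD (isdM (isdD (isdcM V' (hZ x Ux)) (isdM (hV x) hZ1)) (isd_tr (hV x)))
   (isdMc V'^T (isdM (hV x) (hZ x Ux))).
have Vx : V x = v by rewrite /V subrr mul0mx subr0.
have [|||w1] := isd_second_test (x := x) (u := e)
  (W := fun y => V y *m defect y *m (V y)^T) (W1 := W1) _ hW1.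
- by apply: (smooth_near mG Ux) => y Uy; exact: hW.
- by apply: (smooth_near mG Ux) => y Uy; exact: pZ.
- by rewrite Vx vZ mul0mx.
have jE : dd e J x = S e x + conn G x e *m J x - J x *m A e x.
  by rewrite /S /hessmx /A /J subrK addrK.
have alg := @hessian_algebra (defect x) (conn G x e) (dd e (fun y => conn G y e) x) (S e x)
  (dd e (S e) x) (J x) (dd e J x) (H (f x)) (A e x) v vZ sZ sH jE.
cbv zeta in alg; rewrite Vx {}alg scalemxE addmxE => w2.
split; last first.
  have ss : 0 <= (v *m S e x *m H (f x) *m (v *m S e x)^T) 0 0.
    exact: (posdef_semidef (metric_on_pos mH Wx)).
  move: w2 ss; rewrite -/X; move: ((v *m S e x *m H (f x) *m (v *m S e x)^T) 0 0) => q.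
  move: ((_ *m X^T) 0 0) => p.
  rewrite mulNr oppr_ge0 pmulr_rle0 ?mulr_gt0// => pq q0.
  by apply: le_trans pq; rewrite lerDl.
have Zv : defect x *m v^T = 0 by rewrite -sZ -trmx_mul vZ trmx0.
move: w1; rewrite /W1 Vx vZ mul0mx addr0 mulmxDl -mulmxA Zv mulmx0 add0r /Z1.
move=> /(congr1 (fun M : 'M[R]_1 => M 0 0)).
have t : v *m (J x *m H (f x) *m (S e x)^T) *m v^T = v *m S e x *m H (f x) *m X^T.
  by rewrite -[LHS]mx11_tr /X !trmx_mul !trmxK sH !mulmxA.
have -> : v *m (conn G x e *m defect x + defect x *m (conn G x e)^T -
    c *: (S e x *m H (f x) *m (J x)^T + J x *m H (f x) *m (S e x)^T)) *m v^T =
    - (2 * c) *: (v *m S e x *m H (f x) *m X^T).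
  rewrite mulmxBr mulmxDr mulmxA (mulmxA v) vZ mul0mx addr0 mulmxBl -(mulmxA _ _ v^T) Zv mulmx0.
  rewrite sub0r -scalemxAr -scalemxAl mulmxDr mulmxDl t.
  have -> : v *m (S e x *m H (f x) *m (J x)^T) *m v^T = v *m S e x *m H (f x) *m X^T.
    by rewrite /X trmx_mul !mulmxA.
  by move: (_ *m X^T) => M; apply/matrixP => i k; rewrite !mxlinE; ring.
rewrite scalemxE [X in _ = X]mxE => /eqP; rewrite mulf_eq0 oppr_eq0 mulf_eq0 pnatr_eq0/= (gt_eqF c0)/=.
by move/eqP.
Qed.

End HessianInequality.

(** * Covariant derivative of the tension field *)

Section Bochner.
Variables (R : realType) (n : nat).
Implicit Types (x y u v w e : 'rV[R]_n).
Variables (U W : set 'rV[R]_n) (G H : 'rV[R]_n -> 'M[R]_n) (f : 'rV[R]_n -> 'rV[R]_n).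
Hypothesis mG : metric_on U G.
Hypothesis mH : metric_on W H.
Hypothesis sf : smx U f.
Hypothesis fW : forall x, U x -> W (f x).
Let J := jacmx f.
Let S := hessmx G H f.
Let A := pullconn H f.

Lemma hessmx_dmx x u : U x -> dmx (S u) x.
Proof. by move=> Ux; exact: (hessmx_isd mG mH sf fW u u Ux).1. Qed.

Lemma dd_hessmx_vec x u v : U x ->
  dd v (S u) x = \sum_i u 0 i *: dd v (S (delta_mx 0 i)) x.
Proof.
move=> Ux.
have h := isd_sum (index_enum 'I_n) (fun i => isdZ (u 0 i) (isdP v (hessmx_dmx (delta_mx 0 i) Ux))).
suff : isd (S u) x v (\sum_i u 0 i *: dd v (S (delta_mx 0 i)) x) by case.
apply: isd_near h; apply: (smooth_near mG Ux) => y Uy.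
by rewrite /S (hessmx_vec mG mH sf fW u Uy).
Qed.

Lemma dd_hessmx_sym x u w v : U x -> w *m dd v (S u) x = u *m dd v (S w) x.
Proof.
move=> Ux; have h (a b : 'rV[R]_n) := isdcM a (isdP v (hessmx_dmx b Ux)).
suff : isd (fun y => u *m S w y) x v (w *m dd v (S u) x) by case: (h u w) => _ <- [].
apply: isd_near (h w u); apply: (smooth_near mG Ux) => y Uy.
exact: (hessmx_sym mG mH sf fW).
Qed.

Lemma sum_bilinear (K : 'rV[R]_n -> 'rV[R]_n -> 'rV[R]_n) u w :
  (forall u w, K u w = \sum_i u 0 i *: K (delta_mx 0 i) w) ->
  (forall u w, K u w = \sum_j w 0 j *: K u (delta_mx 0 j)) ->
  \sum_i \sum_j (u 0 i * w 0 j) *: K (delta_mx 0 i) (delta_mx 0 j) = K u w.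
Proof.
move=> hl hr; rewrite hl; apply: eq_bigr => i _.
by rewrite (hr (delta_mx 0 i) w) scaler_sumr; apply: eq_bigr => j _; rewrite scalerA.
Qed.

Lemma sum_bilinear_factor (K : 'rV[R]_n -> 'rV[R]_n -> 'rV[R]_n) (C D : 'M[R]_n) :
  (forall u w, K u w = \sum_i u 0 i *: K (delta_mx 0 i) w) ->
  (forall u w, K u w = \sum_j w 0 j *: K u (delta_mx 0 j)) ->
  \sum_i \sum_j (C^T *m D) i j *: K (delta_mx 0 i) (delta_mx 0 j) =
  \sum_a K (row a C) (row a D).
Proof.
move=> hl hr; rewrite sum_factor; apply: eq_bigr => a _; exact: sum_bilinear.
Qed.

Lemma mulmx_vec (B : 'M[R]_n) w : w *m B = \sum_j w 0 j *: (delta_mx 0 j *m B).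
Proof.
by rewrite {1}(row_sum_delta w) mulmx_suml; apply: eq_bigr => j _; rewrite scalemxAl.
Qed.

(** The frame E is fixed at x and not extended: the tension field is differentiated as a contraction
    with the inverse metric. The derivative of that inverse supplies the connection terms in both
    slots of the Hessian, equal by symmetry. *)
Lemma tension_cov_deriv x v (E : 'M[R]_n) : U x -> E^T *m E = invmx (G x) ->
  dd v (tensionmx G H f) x + tensionmx G H f x *m A v x =
  \sum_a (row a E *m (dd v (S (row a E)) x + S (row a E) x *m A v x - conn G x v *m S (row a E) x)
          - row a E *m conn G x v *m S (row a E) x).
Proof.
move=> Ux EE; have uG := metric_on_unit mG Ux.
have hG := isd_inv (isdP v (metric_on_dmx mG Ux)) uG.
have hS i := isdP v (hessmx_dmx (delta_mx 0 i) Ux).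
have h := isd_sum (index_enum 'I_n) (fun i => isd_sum (index_enum 'I_n)
  (fun j => isd_scale i j hG (isdcM (delta_mx 0 j : 'rV[R]_n) (hS i)))).
have [_ ->] : isd (tensionmx G H f) x v _ := h.
set B := conn G x v.
(* Metric compatibility gives -(G^-1 B + B^T G^-1), which is then factored through the frame. *)
have -> : - (invmx (G x) *m dd v G x *m invmx (G x)) = - (E^T *m (E *m B) + (E *m B)^T *m E).
  rewrite -(metric_on_conn_compat mG v Ux) -/B mulmxDr mulmxDl !mulmxA (mulmxK uG).
  by rewrite (mulVmx uG) mul1mx trmx_mul -EE !mulmxA.
pose K u w := w *m S u x.
have Kl u w : K u w = \sum_i u 0 i *: K (delta_mx 0 i) w.
  rewrite /K {1}/S (hessmx_vec mG mH sf fW u Ux) mulmx_sumr.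
  by apply: eq_bigr => i _; rewrite -scalemxAr.
have Kr u w : K u w = \sum_j w 0 j *: K u (delta_mx 0 j) by exact: mulmx_vec.
pose K' u w := w *m dd v (S u) x.
have K'l u w : K' u w = \sum_i u 0 i *: K' (delta_mx 0 i) w.
  by rewrite /K' dd_hessmx_vec// mulmx_sumr; apply: eq_bigr => i _; rewrite -scalemxAr.
have K'r u w : K' u w = \sum_j w 0 j *: K' u (delta_mx 0 j) by exact: mulmx_vec.
have -> : tensionmx G H f x = \sum_a K (row a E) (row a E).
  by rewrite -(sum_bilinear_factor E E Kl Kr) EE.
transitivity (- (\sum_a K (row a E) (row a (E *m B)) + \sum_a K (row a (E *m B)) (row a E))
   + \sum_a K' (row a E) (row a E) + (\sum_a K (row a E) (row a E)) *m A v x).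
  congr (_ + _).
  have f1 := sum_bilinear_factor E (E *m B) Kl Kr.
  have f2 := sum_bilinear_factor (E *m B) E Kl Kr.
  have f3 := sum_bilinear_factor E E K'l K'r; rewrite EE in f3.
  rewrite -f1 -f2 -f3 -big_split -sumrN -big_split; apply: eq_bigr => i _.
  rewrite -big_split -sumrN -big_split; apply: eq_bigr => j _ /=.
  by rewrite oppmxE addmxE scaleNr scalerDl.
rewrite mulmx_suml -big_split -sumrN -!big_split/=; apply: eq_bigr => a _.
rewrite /K /K' row_mul; move: (row a E) => e.
have e1 : e *m B *m S e x = e *m S (e *m B) x by exact: (hessmx_sym mG mH sf fW).
rewrite -e1; move: (dd v (S e) x) (S e x) (S (e *m B) x) (A v x) => d s0 s1 a0.
rewrite !mxdistrE !mulmxA.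
by apply/matrixP => i j; rewrite !mxlinE; ring.
Qed.

(** Summand by summand, the Codazzi equation exchanges the derivative along v of Hess F(e, e) for
    the derivative along e of Hess F(v, e). The result, paired with dF v, is nonpositive by
    [defect_hessian_le] up to the curvature terms. *)
Lemma bochner_le x (E : 'M[R]_n) v (c : R) : U x ->
  E^T *m E = invmx (G x) -> E *m G x *m E^T = 1%:M -> 0 < c ->
  (forall y, U y -> possemidef (defect G H f c y)) -> v *m defect G H f c x = 0 ->
  c * ((dd v (tensionmx G H f) x + tensionmx G H f x *m A v x) *m H (f x) *m (v *m J x)^T) 0 0
  <= c * \sum_a riemann_form H (f x) (v *m J x) (row a E *m J x) (row a E *m J x) (v *m J x)
     - bform (ricci G x) v v.
Proof.
move=> Ux EE EGE c0 pZ vZ; have Wx := fW Ux; have sH := metric_on_sym mH Wx.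
set X := v *m J x.
(* As v is in the kernel of Z, c <dF e, dF v> = <e, v>; this turns the curvature of M inside h into
   a curvature term of g. *)
have cP e : c * (e *m J x *m H (f x) *m X^T) 0 0 = (e *m G x *m v^T) 0 0.
  rewrite -scalemxE /X trmx_mul.
  have Zv : defect G H f c x *m v^T = 0.
    have sZ : (defect G H f c x)^T = defect G H f c x.
      rewrite /defect !(trmxE, trmx_mul) linearZ/= !trmx_mul trmxK sH mulmxA.
      by rewrite (metric_on_sym mG Ux).
    by rewrite -sZ -trmx_mul vZ trmx0.
  have : e *m (defect G H f c x *m v^T) = 0 by rewrite Zv mulmx0.
  rewrite /defect mulmxBl mulmxBr -scalemxAl -scalemxAr => /eqP; rewrite subr_eq0 => /eqP e0.
  by rewrite -(mulmxA e (G x)) e0 !mulmxA.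
rewrite (tension_cov_deriv v Ux EE) (ricci_mx mG v v Ux EGE) !mulmx_suml summxE.
rewrite mulr_sumr mulr_sumr -sumrB; apply: ler_sum => a _; move: (row a E) => e.
have h1 := (defect_hessian_le mG mH sf fW Ux c0 pZ vZ).
(* The first-order condition, used in the direction e conn(e), removes the last connection term. *)
have [_ h2] := h1 e; have [h3 _] := h1 (e *m conn G x e).
rewrite -/S -/A -/J -/X in h2 h3.
have codazzi := hessmx_codazzi mG mH sf fW v e Ux.
rewrite -/S -/A -/J -/X in codazzi.
rewrite codazzi.
have r1 : riemann_form H (f x) X (e *m J x) (e *m J x) X =
   (e *m J x *m Rmx H (f x) X (e *m J x) *m H (f x) *m X^T) 0 0.
  by rewrite (riemann_form_mx mH)// /bform !mulmxA.
have r2 : riemann_form G x e v v e = c * (e *m Rmx G x v e *m J x *m H (f x) *m X^T) 0 0.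
  rewrite cP (riemann_form_swap mG)// (riemann_form_mx mG)// /bform.
  by rewrite [e *m (_ *m _)]mulmxA.
rewrite r1 r2.
have s1 : e *m dd e (S v) x = v *m dd e (S e) x by rewrite dd_hessmx_sym.
have s2 : e *m S v x = v *m S e x by exact: (hessmx_sym mG mH sf fW).
have s3 : e *m conn G x e *m S v x = v *m S (e *m conn G x e) x.
  exact: (hessmx_sym mG mH sf fW).
have s4 : e *m conn G x v = v *m conn G x e by exact: (metric_on_conn_sym mG).
have expand : e *m (dd e (S v) x + S v x *m A e x - conn G x e *m S v x
      + J x *m Rmx H (f x) X (e *m J x) - Rmx G x v e *m J x) - e *m conn G x v *m S e x =
   v *m (dd e (S e) x + S e x *m A e x - conn G x e *m S e x)
   - v *m S (e *m conn G x e) x + e *m J x *m Rmx H (f x) X (e *m J x)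
   - e *m Rmx G x v e *m J x.
  move: s1 s2 s3 s4.
  move: (dd e (S v) x) (dd e (S e) x) (S (e *m conn G x e) x) (S v x) (S e x) => d1 d2 q3 q1 q2.
  move: (Rmx H (f x) X (e *m J x)) (Rmx G x v e) (A e x) (J x) (conn G x e) (conn G x v).
  move=> RH RG Ae Jx C1 C2 s1 s2 s3 s4.
  rewrite -s3 s4 !mxdistrE !mulmxA s1 s2.
  move: (e *m Jx *m RH) (e *m RG *m Jx) (v *m C1 *m q2) (v *m d2) (v *m q2 *m Ae) => w1 w2 w3 w4 w5.
  by apply/matrixP => i j; rewrite !mxlinE; ring.
rewrite expand {expand codazzi}.
rewrite !(mulmxDl, mulmxBl) !mulNmx !mxlinE in h2 *.
rewrite h3.
have := ler_wpM2l (ltW c0) h2; rewrite mulr0.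
move: ((v *m _ *m _ *m _) 0 0) => p; lra.
Qed.

Lemma tension_mxE x : U x -> tension G H f x = tensionmx G H f x.
Proof.
move=> Ux; have Wx := fW Ux.
have sG : \forall y \near x, (G y)^T = G y by apply: (metric_on_nsym mG).
have sH : \forall y \near f x, (H y)^T = H y by apply: (metric_on_nsym mH).
apply/rowP => a; rewrite mxE /tensionmx summxE; apply: eq_bigr => i _.
rewrite summxE; apply: eq_bigr => j _; rewrite scalemxE; congr (_ * _).
have df := smx_dmx sf.
have md y b k : U y -> map_diff f b k y = J y b k.
  by move=> Uy; rewrite /map_diff /partial /J /jacmx mxE ddE.
transitivity ((row j (dd (delta_mx 0 i) J x)) 0 a - (row j (conn G x (delta_mx 0 i) *m J x)) 0 a
   + (row j (J x *m pullconn H f (delta_mx 0 i) x)) 0 a); last first.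
  rewrite /hessmx -/J.
  move: (dd _ J x) (conn G x _ *m _) (J x *m _) => D1 D2 D3.
  by rewrite !rowE -oppmxE -!addmxE -mulmxN -!mulmxDr addrAC.
rewrite /cov_deriv; congr (_ - _ + _).
- rewrite /partial [RHS]mxE ddE; apply: near_eq_derive.
  by apply: (smooth_near mG Ux) => y Uy; exact: md.
- rewrite [RHS]mxE [RHS]mxE; apply: eq_bigr => k _.
  by rewrite md// (conn_christoffel _ _ _ (metric_on_dmx mG Ux) sG).
- rewrite [RHS]mxE [RHS]mxE.
  have pc c d : pullconn H f (delta_mx 0 i) x c d = \sum_b (J x) i b * christoffel H (f x) d b c.
    rewrite (pullconn_vec mH fW) // summxE; apply: eq_bigr => b _.
    rewrite scalemxE (conn_christoffel _ _ _ (metric_on_dmx mH Wx) sH) -rowE mxE//.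
  rewrite exchange_big/=; apply: eq_bigr => c _; rewrite pc mulr_sumr; apply: eq_bigr => b _.
  rewrite md// -[partial _ _ _]/(map_diff f i b x) md//.
  by rewrite mulrC; congr (_ * _); rewrite mulrC.
Qed.

End Bochner.
(** * The defect tensor at a first time of contact *)

Section TimeDerivative.
Variable R : realType.

Lemma growth_time (V W : normedModType R) (f : R * V -> W) t x :
  (fun h : R => h^-1 *: (((fun s => f (s, x)) \o shift t) (h *: (1 : R)) - f (t, x))) =
  (fun h : R => h^-1 *: ((f \o shift (t, x)) (h *: ((1, 0) : R * V)) - f (t, x))).
Proof.
apply/funext => h /=; congr (_ *: (f _ - _)).
by apply/pair_eqP; rewrite /= scaler0 add0r !eqxx.
Qed.

Lemma is_derive_time (V W : normedModType R) (f : R * V -> W) t x :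
  derivable f (t, x) ((1, 0) : R * V) ->
  is_derive (t : R) (1 : R) (fun s => f (s, x)) ('D_((1, 0) : R * V) f (t, x)).
Proof.
by move=> d; split; [rewrite /derivable growth_time|rewrite /derive growth_time].
Qed.

Lemma isd_curve m p (A : R -> 'M[R]_(m, p)) t A' :
  is_derive (t : R) (1 : R) A A' -> isd A t 1 A'.
Proof.
move=> [d <-]; have /derivable_mxP dij := d.
apply: isd_entries => i j; split; first exact/derivable1_diffP.
by rewrite (derive_mx d) mxE.
Qed.

Lemma smooth_open_swap_mx (V : normedModType R) m p (U : set V) (A : V -> 'M[R]_(m, p)) x u v :
  open U -> smooth_open U A -> U x -> 'D_v ('D_u A) x = 'D_u ('D_v A) x.
Proof.
move=> oU sA Ux; apply/matrixP => i j.
have e := iter_derive_coord i j _ oU sA Ux.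
rewrite -[LHS](e [:: v; u]) -[RHS](e [:: u; v]).
exact: smooth_open_swap oU (smooth_open_coord i j oU sA) Ux.
Qed.

Lemma left_quotient (V : normedModType R) (f : R -> V) (t : R) l : is_derive t (1 : R) f l ->
  (fun s => (s - t)^-1 *: (f s - f t)) @ t^'- --> l.
Proof.
move=> [+ <-]; rewrite /derivable /derive; set g := fun h => _.
move=> /cvg_ex[l' gl']; rewrite (cvg_lim _ gl')//.
have c : (fun s => s - t) @ t^'- --> 0^'.
  move=> P /nbhs_ballP[e /= e0 he].
  suff : \forall s \near t^'-, P (s - t) by [].
  near=> s; apply: he.
    rewrite /ball/= sub0r normrN distrC gtr0_norm ?subr_gt0//.
    by rewrite ltrBlDr -ltrBlDl; near: s; apply: nbhs_left_gt; rewrite ltrBlDr ltrDl.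
  by rewrite subr_eq0 lt_eqF//; near: s; exact: nbhs_left_lt.
have := cvg_comp _ _ c gl'; apply: cvg_trans; apply: near_eq_cvg; near=> s.
by rewrite /g /= [_ *: 1]mulr1 subrK.
Unshelve. all: by end_near. Qed.

(** At every t in (0, T] the derivative relative to [0, T] controls the quotients from the left, so
    t = T is no exception. *)
Lemma has_derive_within_left (V : normedModType R) (f : R -> V) (T t : R) l :
  0 < t <= T -> has_derive_within `[0, T] f t l ->
  (fun s => (s - t)^-1 *: (f s - f t)) @ t^'- --> l.
Proof.
move=> /andP[t0 tT] h; apply: cvg_trans h => P /=; rewrite /within/= => hP.
move: hP => /nbhs_ballP[e /= e0 he].
suff : \forall s \near t^'-, P ((s - t)^-1 *: (f s - f t)) by [].
near=> s.
have st : s < t by near: s; exact: nbhs_left_lt.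
apply: he; last by rewrite in_itv/= (le_trans (ltW st) tT) andbT; near: s; exact: nbhs_left_ge.
  rewrite /ball/= gtr0_norm ?subr_gt0//.
  by rewrite ltrBlDr -ltrBlDl; near: s; apply: nbhs_left_gt; rewrite ltrBlDr ltrDl.
by rewrite lt_eqF.
Unshelve. all: by end_near. Qed.

Lemma left_quotient_le0 (q : R -> R) (t l : R) : (fun s => (s - t)^-1 *: (q s - q t)) @ t^'- --> l ->
  q t = 0 -> (\forall s \near t^'-, 0 <= q s) -> l <= 0.
Proof.
move=> ql q0 qs; apply: (cvgr_to_le ql); near=> s.
rewrite q0 subr0; apply: mulr_le0_ge0; last by near: s.
by rewrite invr_le0 subr_le0 ltW//; near: s; exact: nbhs_left_lt.
Unshelve. all: by end_near. Qed.

Lemma left_quotient_sub (G Q : R -> R) (t a b lG lQ : R) :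
  (fun s => (s - t)^-1 *: (G s - G t)) @ t^'- --> lG ->
  (fun s => (s - t)^-1 *: (Q s - Q t)) @ t^'- --> lQ ->
  (fun s => (s - t)^-1 *: ((G s - (a - b * s) * Q s) - (G t - (a - b * t) * Q t))) @ t^'- -->
  lG - (a - b * t) * lQ + b * Q t.
Proof.
move=> hG hQ.
have c1 : (fun s : R => a - b * s) @ t^'- --> a - b * t.
  have c0 : (fun s : R => s) @ t^'- --> t by exact: cvg_at_left_filter.
  exact: cvgB (cvg_cst a) (cvgM (cvg_cst b) c0).
have hc : (fun s => (s - t)^-1 * (G s - G t) - (a - b * s) * ((s - t)^-1 * (Q s - Q t)) + b * Q t)
    @ t^'- --> lG - (a - b * t) * lQ + b * Q t.
  exact: cvgD (cvgB hG (cvgM c1 hQ)) (cvg_cst (b * Q t)).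
apply: cvg_trans hc; apply: near_eq_cvg; near=> s.
have st : s - t != 0 by rewrite subr_eq0 lt_eqF//; near: s; exact: nbhs_left_lt.
by rewrite [RHS]/GRing.scale/=; field.
Unshelve. all: by end_near. Qed.

Lemma left_quotient_cvg (f : R -> R) (t l : R) :
  (fun s => (s - t)^-1 *: (f s - f t)) @ t^'- --> l -> f @ t^'- --> f t.
Proof.
move=> hf.
have c1 : (fun s : R => s - t) @ t^'- --> 0.
  rewrite -(subrr t); apply: cvgB; last exact: cvg_cst.
  exact: cvg_at_left_filter.
have hc : (fun s => (s - t) * ((s - t)^-1 * (f s - f t)) + f t) @ t^'- --> 0 * l + f t.
  exact: cvgD (cvgM c1 hf) (cvg_cst (f t)).
rewrite mul0r add0r in hc; apply: cvg_trans hc; apply: near_eq_cvg; near=> s.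
have st : s - t != 0 by rewrite subr_eq0 lt_eqF//; near: s; exact: nbhs_left_lt.
by rewrite mulVKf// subrK.
Unshelve. all: by end_near. Qed.

Lemma bform_continuous n (v : 'rV[R]_n) : continuous (fun A : 'M[R]_n => bform A v v).
Proof.
move=> A; have d : dmx (@id 'M[R]_n) A by move=> i j; exact: differentiable_coord.
exact: differentiable_continuous ((isdMc v^T (isdcM v (isdP A d))).1 0 0).
Qed.

(** The first variation of |dF v|^2: the time derivative of X = dF v is D_v tau, and metric
    compatibility together with torsion-freeness completes it to <nabla_v tau, dF v>. *)
Lemma energy_isd n (Ue : set (R * 'rV[R]_n)) (fe : R * 'rV[R]_n -> 'rV[R]_n) t x v
    (W : set 'rV[R]_n) H (tau : 'rV[R]_n -> 'rV[R]_n) :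
  open Ue -> smooth_open Ue fe -> Ue (t, x) -> metric_on W H -> W (fe (t, x)) ->
  (\forall y \near x, 'D_((1, 0) : R * 'rV[R]_n) fe (t, y) = tau y) ->
  let X (s : R) : 'rV[R]_n := 'D_((0, v) : R * 'rV[R]_n) fe (s, x) in
  is_derive t (1 : R) (fun s => bform (H (fe (s, x))) (X s) (X s))
    (2 * ((dd v tau x + tau x *m conn H (fe (t, x)) (X t)) *m H (fe (t, x)) *m (X t)^T) 0 0).
Proof.
move=> oU sfe Utx mH Wx ntau X.
have y1 : isd (fun s => fe (s, x)) t 1 (tau x).
  rewrite -(nbhs_singleton ntau).
  by apply/isd_curve/is_derive_time; exact: smooth_open_derivable sfe Utx.
(* Time and space derivatives of the extension [fe] commute. *)
have tauE : dd v tau x = 'D_((1, 0) : R * 'rV[R]_n) ('D_((0, v) : R * 'rV[R]_n) fe) (t, x).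
  rewrite (smooth_open_swap_mx _ _ oU sfe Utx).
  apply/matrixP => i j; rewrite ddE.
  have d : derivable ('D_((1, 0) : R * 'rV[R]_n) fe) (t, x) ((0, v) : R * 'rV[R]_n).
    by apply: smooth_open_derivable Utx; exact: smooth_open_derive.
  rewrite (derive_mx d) mxE -derive_slice.
  by apply: near_eq_derive; apply: filterS ntau => y ->.
have X1 : isd X t 1 (dd v tau x).
  rewrite tauE; apply/isd_curve/is_derive_time.
  by apply: smooth_open_derivable Utx; exact: smooth_open_derive.
have H1 := isd_comp (1 : R) y1.1 (metric_on_dmx mH Wx).
rewrite y1.2 -(metric_on_conn_compat mH)// in H1.
have h := isd_entryP 0 0 (isdM (isdM X1 H1) (isd_tr X1)).
apply: is_derive_eq h _; rewrite -[X in _ = 2 * X]mulr1n.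
(* The metric H is differentiated along tau; torsion-freeness turns this into the connection along X
   that occurs in nabla_v tau. *)
have cs : tau x *m conn H (fe (t, x)) (X t) = X t *m conn H (fe (t, x)) (tau x).
  exact: (metric_on_conn_sym mH (X t) (tau x) Wx).
have sH := metric_on_sym mH Wx.
rewrite cs; move: (dd v tau x) (X t) (H (fe (t, x))) (conn H _ (tau x)) sH => D Y h0 C sH.
have t1 : Y *m h0 *m D^T = D *m h0 *m Y^T by rewrite -[LHS]mx11_tr !trmx_mul trmxK sH mulmxA.
have t2 : Y *m h0 *m C^T *m Y^T = Y *m C *m h0 *m Y^T.
  by rewrite -[LHS]mx11_tr !trmx_mul !trmxK sH !mulmxA.
by rewrite !mxdistrE !mulmxA t1 t2 !mxlinE; ring.
Qed.

End TimeDerivative.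

(** * Local representations of the family in space and time *)

Section SmoothOn.
Variable R : realType.
Implicit Types (V W : normedModType R).

Lemma smooth_on_slice V W (A : set R) (D : R -> set V) (f : R -> V -> W) t :
  A t -> open (D t) -> smooth_on [set z : R * V | A z.1 /\ D z.1 z.2] (fun z => f z.1 z.2) ->
  smooth_open (D t) (f t).
Proof.
move=> At oD sf vs x Dx; have [|Ue [fe [[oU Ux] sfe fef]]] := sf (t, x); first by split.
pose D' := [set y | Ue (t, y)] `&` D t.
have oD' : open D'.
  apply: openI => //; apply: open_comp oU => y _.
  by apply: (@cvg_pair _ _ _ _ (nbhs t) (nbhs y)); [exact: cvg_cst|exact: cvg_id].
have s' : smooth_open D' (fun y => fe (t, y)).
  apply: (smooth_open_sub (U := [set y | Ue (t, y)])); first by move=> y [].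
  exact: smooth_open_slice.
have : smooth_open D' (f t).
  by apply: smooth_open_eq s' => // y [Uy Dy]; exact: (fef (t, y)).
by apply; split.
Qed.

Lemma smooth_on_open V W (D : set V) (f : V -> W) : open D -> smooth_on D f -> smooth_open D f.
Proof.
move=> oD sf vs x Dx; have [Ue [fe [[oU Ux] sfe fef]]] := sf x Dx.
have : smooth_open (Ue `&` D) f.
  apply: (@smooth_open_eq _ _ _ _ fe).
  - exact: openI.
  - by move=> y [Uy Dy]; exact: fef.
  - by apply: (smooth_open_sub (U := Ue)) => // y [].
by apply; split.
Qed.

End SmoothOn.

Lemma slice_near (X Y : topologicalType) (P : set (X * Y)) t x :
  nbhs (t, x) P -> (\forall y \near x, P (t, y)) /\ (\forall s \near t, P (s, x)).
Proof.
move=> [[A B] [/= nA nB] AB]; have At := nbhs_singleton nA; have Bx := nbhs_singleton nB.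
split; first by apply: filterS nB => y By; exact: (AB (t, y)).
by apply: filterS nA => s As; exact: (AB (s, x)).
Qed.

Section ChartTopology.
Variables (R : realType) (n : nat).

Lemma chart_map_cvg (M : topologicalType) (c : chart R n M) p :
  chart_dom c p -> {for p, continuous (chart_map c)}.
Proof.
move=> cp; have := @chart_map_continuous _ _ _ c.
rewrite continuous_open_subspace; last exact: chart_dom_open.
by apply; rewrite inE.
Qed.

Lemma chart_inv_cvg (M : topologicalType) (c : chart R n M) x :
  chart_img c x -> {for x, continuous (chart_inv c)}.
Proof.
move=> cx; have := @chart_inv_continuous _ _ _ c.
rewrite continuous_open_subspace; last exact: chart_img_open.
by apply; rewrite inE.
Qed.

Variables (M N : smoothManifold R n) (A : set R) (F : R -> M -> N).
Hypothesis sF : smooth_map_family A F.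

Lemma family_near t p (O : set N) : A t -> nbhs (F t p) O ->
  \forall z \near (t, p), A z.1 -> O (F z.1 z.2).
Proof.
move=> At nO; have /subspace_continuousP/(_ (t, p)) := sF.1.
move=> /(_ (conj At I)) /(_ O nO) h.
have {}h : \forall z \near (t, p), (A `*` setT) z -> O (F z.1 z.2) by exact: h.
by apply: filterS h => z h Az; exact: (h (conj Az I)).
Qed.

Variables (i : chart_index M) (j : chart_index N).
Let ci := chart_at M i.
Let cj := chart_at N j.

Lemma family_dom_near t x : A t -> local_dom (F t) ci cj x ->
  \forall z \near (t, x), A z.1 -> local_dom (F z.1) ci cj z.2.
Proof.
move=> At [cx dx].
have n1 : \forall z \near (t, x), chart_img ci z.2.
  apply: (@cvg_snd _ _ (nbhs t) (nbhs x)); apply: open_nbhs_nbhs; split=> //.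
  exact: chart_img_open.
have n2 : nbhs (F t (chart_inv ci x)) (chart_dom cj).
  by apply: open_nbhs_nbhs; split=> //; exact: chart_dom_open.
have c : (fun z : R * 'rV[R]_n => (z.1, chart_inv ci z.2)) @ (t, x) --> (t, chart_inv ci x).
  apply: (@cvg_pair _ _ _ _ (nbhs t) (nbhs (chart_inv ci x))); first exact: cvg_fst.
  apply: (@cvg_comp _ _ _ snd (chart_inv ci) _ (nbhs x)); first exact: cvg_snd.
  exact: chart_inv_cvg.
have n3 := c _ (family_near At n2).
by apply: filterS2 n1 n3 => z h1 h3 Az; split=> //; exact: h3.
Qed.

Lemma local_dom_open t : A t -> open (local_dom (F t) ci cj).
Proof.
move=> At; rewrite openE => x dx; rewrite /interior.
have [h _] := slice_near (family_dom_near At dx).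
by apply: filterS h => y; exact.
Qed.

Lemma local_rep_smx t : A t -> smx (local_dom (F t) ci cj) (local_rep (F t) ci cj).
Proof.
move=> At; apply: smooth_smx; first exact: local_dom_open.
apply: (smooth_on_slice (D := fun t => local_dom (F t) ci cj)
  (f := fun t => local_rep (F t) ci cj) At); first exact: local_dom_open.
exact: (sF.2 i j).
Qed.

Lemma local_rep_img t x : local_dom (F t) ci cj x -> chart_img cj (local_rep (F t) ci cj x).
Proof. by move=> [_ /chart_mapP[]]. Qed.

(** The domain of the representation moves with time and stops at the ends of A. The map [fe] is
    smooth on an open set of space-time, and at times of A it has the values and the spatial
    derivative of F on a whole neighbourhood, so it may be differentiated in place of F. *)
Lemma family_extension t x v : A t -> local_dom (F t) ci cj x ->
  exists Ue (fe : R * 'rV[R]_n -> 'rV[R]_n),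
  [/\ open Ue, Ue (t, x), smooth_open Ue fe &
    \forall z \near (t, x), A z.1 -> [/\ Ue z, local_dom (F z.1) ci cj z.2,
     fe z = local_rep (F z.1) ci cj z.2 &
     v *m jacobian (local_rep (F z.1) ci cj) z.2 = 'D_((0, v) : R * 'rV[R]_n) fe z]].
Proof.
move=> At dx; have [|Ue [fe [[oU Ux] sfe fef]]] := sF.2 i j (t, x); first by split.
exists Ue, fe; split=> //.
have n1 : \forall z \near (t, x), Ue z by apply: open_nbhs_nbhs.
apply: filterS2 n1 (family_dom_near At dx) => -[s y] /= Uz h As.
have dy := h As; split=> //; first exact: (fef (s, y)).
have sm := local_rep_smx As.
rewrite jacobian_dd; last exact: smx_dmx sm dy.
have d : derivable (fun y => fe (s, y)) y v.
  by apply: derivable_slice; exact: smooth_open_derivable sfe Uz.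
rewrite -derive_slice (derive_mx d); apply/matrixP => a b; rewrite ddE mxE.
apply: near_eq_derive.
have [n2 _] := slice_near (open_nbhs_nbhs (conj oU Uz)).
have n3 := smx_near sm dy.
by apply: filterS2 n2 n3 => w Uw dw; rewrite -(fef (s, w)).
Qed.

End ChartTopology.
(** The final contradiction, with l = k(v, v), r = Ric(v, v), e = <nabla_v tau, dF v>, q = F^*h(v,
    v), c = phi, b = - phi' and m = (n - 1) kappa. *)
Lemma contact_arith (R : realFieldType) (b c e l r q m : R) :
  2 * l - c * (2 * e) + b * q <= 0 -> 0 <= l + r -> c * e <= m * q - r -> 0 < q ->
  2 * m < b -> False.
Proof.
move=> h1 h2 h3 q0 mb; have : (b - 2 * m) * q <= 0 by lra.
by rewrite pmulr_lle0// subr_le0 leNgt mb.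
Qed.

(** * Exclusion of a first contact *)

Section FirstContact.
Variables (R : realType) (n : nat) (M N : smoothManifold R n).
Variables (h : riemMetric N) (T : R) (g : R -> riemMetric M) (k : R -> symTensor M).
Variables (F : R -> M -> N).
Hypothesis g_evol : metric_evolution `[0, T] g k.
Hypothesis smooth_F : smooth_map_family `[0, T] F.
Hypothesis F_flow : harmonic_map_heat_flow `[0, T] g h F.

Lemma metric_on_sub (U U' : set 'rV[R]_n) G : open U' -> U' `<=` U -> metric_on U G ->
  metric_on U' G.
Proof.
move=> oU' s [[oU sG] sy pG]; split.
- by split=> // a b; exact: smooth_open_sub s (sG a b).
- by move=> x /s; exact: sy.
- by move=> x /s; exact: pG.
Qed.

Lemma chart_metric_on (M' : smoothManifold R n) (h' : riemMetric M') j :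
  metric_on (chart_img (chart_at M' j)) (h' j).
Proof.
have o := @chart_img_open _ _ _ (chart_at M' j).
split.
- by apply: smooth_smx => //; apply: smooth_on_open => //; exact: metric_smooth.
- by move=> x; exact: tensor_sym.
- by move=> x xj v; exact: metric_pos.
Qed.

Variables (i : chart_index M) (j : chart_index N).
Let ci := chart_at M i.
Let cj := chart_at N j.
Let rep s := local_rep (F s) ci cj.
Let dom s := local_dom (F s) ci cj.
Let Q s x v := bform (pullback_form (h j) (rep s) x) v v.

Lemma time_itv t : 0 < t <= T -> (`[0, T]%classic : set R) t.
Proof. by move=> /andP[t0 tT]; rewrite /= in_itv/= (ltW t0). Qed.

Lemma near_left_itv t : 0 < t <= T -> \forall s \near t^'-, (`[0, T]%classic : set R) s.
Proof.
move=> /andP[t0 tT]; near=> s; rewrite /= in_itv/=; apply/andP; split.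
  by near: s; exact: nbhs_left_ge.
apply: le_trans tT; near: s; exact: nbhs_left_le.
Unshelve. all: by end_near. Qed.

Lemma at_left_nbhs (t : R) (P : R -> Prop) : (\forall s \near t, P s) -> \forall s \near t^'-, P s.
Proof. by move=> h'; apply: cvg_within. Qed.

Lemma dom_metric_on t : 0 < t <= T -> metric_on (dom t) (g t i).
Proof.
move=> /time_itv At; apply: metric_on_sub (chart_metric_on (g t) i) => //.
  exact: local_dom_open smooth_F _ _ _ At.
by move=> x [].
Qed.

(** [energy_isd] is applied to the smooth extension, whose left quotients agree with those of F. *)
Lemma pullback_left_quotient t x v : 0 < t <= T -> dom t x ->
  let f := rep t in
  (fun s => (s - t)^-1 *: (Q s x v - Q t x v)) @ t^'- -->
  2 * ((dd v (tensionmx (g t i) (h j) f) x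
       + tensionmx (g t i) (h j) f x *m pullconn (h j) f v x) *m h j (f x)
       *m (v *m jacmx f x)^T) 0 0.
Proof.
move=> tT dx f; have At := time_itv tT.
have [Ue [fe [oU Utx sfe nfe]]] := family_extension smooth_F v At dx.
have mG := dom_metric_on tT.
have mH := chart_metric_on h j.
have sf : smx (dom t) f := local_rep_smx smooth_F i j At.
have fW y : dom t y -> chart_img cj (f y) by exact: local_rep_img.
have [_ _ fx vJ] := nbhs_singleton nfe At.
(* Left quotients already determine the time derivative of [fe], by uniqueness of limits. The
   identity with the tension field is needed at all y near x, because it is differentiated in y
   afterwards. *)
have ntau : \forall y \near x, 'D_((1, 0) : R * 'rV[R]_n) fe (t, y) = tensionmx (g t i) (h j) f y.
  have [nn _] := slice_near (nbhs_interior nfe).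
  apply: filterS nn => y; rewrite /interior => ny.
  have [Uy dy fy _] := nbhs_singleton ny At.
  rewrite -(tension_mxE mG mH sf fW dy).
  have d : derivable fe (t, y) ((1, 0) : R * 'rV[R]_n) by exact: smooth_open_derivable sfe Uy.
  have l1 := left_quotient (is_derive_time d).
  have l2 := has_derive_within_left tT (F_flow At dy).
  have e : \forall s \near t^'-, (s - t)^-1 *: (fe (s, y) - fe (t, y)) =
      (s - t)^-1 *: (local_rep (F s) ci cj y - local_rep (F t) ci cj y).
    have [_ ns] := slice_near ny.
    apply: filterS2 (near_left_itv tT) (at_left_nbhs ns) => s As /(_ As)[_ _ -> _].
    by rewrite fy.
  have l1' : (fun s => (s - t)^-1 *: (local_rep (F s) ci cj y - local_rep (F t) ci cj y)) @ t^'- -->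
     'D_((1, 0) : R * 'rV[R]_n) fe (t, y).
    by apply: cvg_trans l1; apply: near_eq_cvg; apply: filterS e => s ->.
  exact: (cvg_unique _ l1' l2).
have fxW : chart_img cj (fe (t, x)) by rewrite fx; exact: fW.
have QE s : fe (s, x) = rep s x ->
    v *m jacobian (rep s) x = 'D_((0, v) : R * 'rV[R]_n) fe (s, x) ->
    bform (h j (fe (s, x))) ('D_((0, v) : R * 'rV[R]_n) fe (s, x))
      ('D_((0, v) : R * 'rV[R]_n) fe (s, x)) = Q s x v.
  by move=> -> <-; rewrite -bform_mul.
have := left_quotient (energy_isd v oU sfe Utx mH fxW ntau).
move=> /=; rewrite (QE t fx vJ) -vJ /= fx (jacmxE sf dx).
apply: cvg_trans; apply: near_eq_cvg.
have [_ ns] := slice_near nfe.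
apply: filterS2 (near_left_itv tT) (at_left_nbhs ns) => s As /(_ As)[_ _ fs vs].
by rewrite (QE s fs vs).
Qed.

Lemma metric_left_quotient t x v : 0 < t <= T -> chart_img ci x ->
  (fun s => (s - t)^-1 *: (bform (g s i x) v v - bform (g t i x) v v)) @ t^'- -->
  2 * bform (k t i x) v v.
Proof.
move=> tT cx; have := has_derive_within_left tT (g_evol (time_itv tT) cx) => l.
have l1 : (fun s => bform ((s - t)^-1 *: (g s i x - g t i x)) v v) @ t^'- -->
    bform (2 *: k t i x) v v by exact: (continuous_cvg _ (@bform_continuous R n v _) l).
rewrite bformZ in l1; have -> : (fun s => (s - t)^-1 *: (bform (g s i x) v v - bform (g t i x) v v))
  = (fun s => bform ((s - t)^-1 *: (g s i x - g t i x)) v v).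
  by apply/funext => s; rewrite bformZ bformB.
exact: l1.
Qed.

(** Z(v, v) in a pair of charts at time s, with phi(s) = a - b * s. *)
Definition contact_form a b s x v :=
  bform (g s i x) v v - (a - b * s) * bform (pullback_form (h j) (local_rep (F s) ci cj) x) v v.

Lemma contact_left_quotient a b t x v : 0 < t <= T -> dom t x ->
  let f := rep t in
  (fun s => (s - t)^-1 *: (contact_form a b s x v - contact_form a b t x v)) @ t^'- -->
  2 * bform (k t i x) v v - (a - b * t) * (2 * ((dd v (tensionmx (g t i) (h j) f) x
       + tensionmx (g t i) (h j) f x *m pullconn (h j) f v x) *m h j (f x)
       *m (v *m jacmx f x)^T) 0 0) + b * Q t x v.
Proof.
move=> tT dx f.
exact: (@left_quotient_sub R (fun s => bform (g s i x) v v) (fun s => Q s x v) t a b _ _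
  (metric_left_quotient (v := v) tT dx.1) (pullback_left_quotient (v := v) tT dx)).
Qed.

(** Positivity before t in a single pair of charts suffices, since the second derivative test
    compares x only with nearby points at time t. The limit from the left provides Z >= 0 at these
    points. *)
Lemma no_contact a b kappa t x v : 0 < t <= T -> dom t x -> 0 <= kappa ->
  2 * ((n%:R - 1) * kappa) < b ->
  (forall s y, 0 <= s < t -> dom s y -> forall w, 0 <= contact_form a b s y w) ->
  plus_ricci_ge0 (k t) (g t) ->
  sectional_le h kappa \/ (sectional_ge0 h /\ ricci_le h ((n%:R - 1) * kappa)) ->
  v != 0 -> 0 < contact_form a b t x v.
Proof.
move=> tT dx k0 kb good kric curv v0; rewrite ltNge; apply/negP => qv.
have At := time_itv tT; pose f := rep t; pose c := a - b * t.
have mG := dom_metric_on tT.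
have mH := chart_metric_on h j.
have sf : smx (dom t) f := local_rep_smx smooth_F i j At.
have fW y : dom t y -> chart_img cj (f y) by exact: local_rep_img.
(* The point y stays in the moving domain [dom s] for s close to t, so the earlier positivity is
   available in the fixed charts. *)
have nonneg y w : dom t y -> \forall s \near t^'-, 0 <= contact_form a b s y w.
  move=> dy; have [_ ns] := slice_near (family_dom_near smooth_F At dy).
  near=> s; have As : (`[0, T]%classic : set R) s by near: s; exact: near_left_itv.
  apply: good; last by move: As; near: s; exact: (at_left_nbhs ns).
  apply/andP; split; first by move: As; rewrite /= in_itv/= => /andP[].
  by near: s; exact: nbhs_left_lt.
have pZ' y w : dom t y -> 0 <= contact_form a b t y w.
  move=> dy; have l := left_quotient_cvg (contact_left_quotient (a := a) (b := b) (v := w) tT dy).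
  exact: (cvgr_to_ge l (nonneg y w dy)).
have ZE y w : dom t y -> bform (defect (g t i) (h j) f c y) w w = contact_form a b t y w.
  by move=> dy; rewrite /defect bformB bformZ -(jacmxE sf dy).
have pZ y : dom t y -> possemidef (defect (g t i) (h j) f c y).
  by move=> dy w; rewrite ZE//; exact: pZ'.
have q0 : contact_form a b t x v = 0 by apply/eqP; rewrite eq_le qv pZ'.
have sG := metric_on_sym mG dx; have pG := metric_on_pos mG dx.
have sH := metric_on_sym mH (fW x dx).
have vZ : v *m defect (g t i) (h j) f c x = 0.
  apply: possemidef_null; [|exact: pZ|by rewrite ZE].
  by rewrite /defect !(trmxE, trmx_mul) linearZ/= !trmx_mul trmxK sH mulmxA sG.
have [E EE EGE] := posdef_frame sG pG.
have QE : Q t x v = bform (jacmx f x *m h j (f x) *m (jacmx f x)^T) v v.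
  by rewrite /Q /pullback_form -(jacmxE sf dx).
have Gv : bform (g t i x) v v = c * Q t x v.
  by move/eqP: q0; rewrite /contact_form subr_eq0 => /eqP.
have Q0 : 0 <= Q t x v.
  by rewrite QE bform_mul; exact: (posdef_semidef (metric_on_pos mH (fW x dx))).
have cQ : 0 < c * Q t x v by rewrite -Gv; exact: pG.
have Qpos : 0 < Q t x v.
  by rewrite lt_neqAle Q0 andbT eq_sym; apply: contraTneq cQ => ->; rewrite mulr0 ltxx.
have c0 : 0 < c by rewrite -(pmulr_lgt0 _ Qpos).
have L0 := left_quotient_le0 (contact_left_quotient (a := a) (b := b) (v := v) tT dx) q0 (nonneg x v dx).
have B := bochner_le mG mH sf fW dx EE EGE c0 pZ vZ.
have curv' : (forall u w, row_free (col_mx u w) -> sectional (h j) (f x) u w <= kappa) \/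
  (forall u w, row_free (col_mx u w) -> 0 <= sectional (h j) (f x) u w) /\
  form_le (ricci (h j) (f x)) (((n%:R - 1) * kappa) *: h j (f x)).
  case: curv => [hk|[hs hr]]; [left|right] => //.
    by move=> u w; exact: (hk j (f x) (fW x dx)).
  by split; [move=> u w; exact: (hs j (f x) (fW x dx))|exact: (hr j (f x) (fW x dx))].
have C := curvature_trace_le mH (fW x dx) sG pG EE EGE c0 (pZ x dx) vZ k0 curv'.
have K : 0 <= bform (k t i x) v v + bform (ricci (g t i) x) v v.
  by have := kric i x dx.1 v; rewrite bformD {1}/bform mulmx0 mul0mx mxE.
move: C; rewrite -QE => C.
exact: contact_arith L0 K (le_trans B (lerB C (lexx _))) Qpos kb.
Unshelve. all: by end_near. Qed.

End FirstContact.
(** * The maximum principle *)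

(** Continuous induction: let m be the supremum of the u such that P holds on [0, u]. The third
    hypothesis gives P at m, and the second would extend P beyond m if m < T. *)
Lemma time_induction (R : realType) (T : R) (P : R -> Prop) :
  P 0 ->
  (forall t, 0 <= t <= T -> P t -> \forall s \near t, 0 <= s <= T -> P s) ->
  (forall t, 0 < t <= T -> (forall s, 0 <= s < t -> P s) -> P t) ->
  forall t, 0 <= t <= T -> P t.
Proof.
move=> P0 Popen Plim t /andP[t0 tT].
have T0 : 0 <= T := le_trans t0 tT.
pose S := [set u : R | 0 <= u <= T /\ forall s, 0 <= s <= u -> P s].
have S0 : S 0.
  by split; [rewrite lexx|move=> s /andP[s0 s0']; rewrite (@le_anti _ R s 0) ?s0 ?s0'].
have hS : has_sup S by split; [exists 0|exists T => u [/andP[]]].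
pose m := sup S.
have m0 : 0 <= m by apply: ub_le_sup => //; exact: hS.2.
have mT : m <= T by apply: ge_sup; [exists 0|move=> u [/andP[]]].
have below s : 0 <= s < m -> P s.
  move=> /andP[s0 sm]; have [u [_ uP] us] := sup_gt (ex_intro _ _ S0) sm.
  by apply: uP; rewrite s0 ltW.
have Pm : P m.
  have [me|mne] := eqVneq m 0; first by rewrite me.
  by apply: Plim => //; rewrite lt_neqAle eq_sym mne m0 mT.
have [/eqP mTe|mTne] := boolP (m == T).
  have [te|tne] := eqVneq t T; first by rewrite te -mTe.
  by apply: below; rewrite t0 mTe lt_neqAle tne.
have mltT : m < T by rewrite lt_neqAle mTne.
have /nbhs_ballP[d /= d0 hd] : \forall s \near m, 0 <= s <= T -> P s.
  by apply: Popen => //; rewrite m0.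
(* Halving d keeps [m, u] inside the ball given by openness; the minimum keeps u at most T. *)
pose u := m + Num.min (d / 2) (T - m).
have e0 : 0 < Num.min (d / 2) (T - m) by rewrite lt_min divr_gt0//= subr_gt0.
have uT : u <= T by rewrite /u -lerBrDl ge_min lexx orbT.
have um : u < m + d.
  by rewrite /u ltrD2l gt_min ltr_pdivrMr// ltr_pMr// ltr1n.
have Su : S u.
  split; first by rewrite uT andbT addr_ge0// ltW.
  move=> s /andP[s0 su]; have [sm|ms] := ltP s m; first by apply: below; rewrite s0.
  apply: hd; last by rewrite s0 (le_trans su).
  by rewrite /ball/= distrC ger0_norm ?subr_ge0// ltrBlDl (le_lt_trans su).
have : u <= m by apply: ub_le_sup => //; exact: hS.2.
by rewrite gerDl leNgt e0.
Qed.

(** * Limits of matrices and openness of positive definiteness *)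

Section EntrywiseConvergence.
Variables (R : realType) (X : Type) (Fi : set_system X).
Context {FF : Filter Fi}.

(** Convergence entry by entry, the form in which [posdef_near] measures distance. *)
Definition ecvg m p (A : X -> 'M[R]_(m, p)) (L : 'M[R]_(m, p)) :=
  forall i j, (fun z => A z i j) @ Fi --> L i j.

Lemma ecvg_near m p (A B : X -> 'M[R]_(m, p)) L :
  (\forall z \near Fi, A z = B z) -> ecvg A L -> ecvg B L.
Proof.
move=> AB cA i j; apply: cvg_trans (cA i j); apply: near_eq_cvg.
by apply: filterS AB => z ->.
Qed.

Lemma ecvgM m p q (A : X -> 'M[R]_(m, p)) (B : X -> 'M[R]_(p, q)) L K :
  ecvg A L -> ecvg B K -> ecvg (fun z => A z *m B z) (L *m K).
Proof.
move=> cA cB i j; rewrite mxE.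
have -> : (fun z => (A z *m B z) i j) = (fun z => \sum_k A z i k * B z k j).
  by apply/funext => z; rewrite mxE.
elim: (index_enum _) => [|k r IH].
  rewrite big_nil (_ : (fun z => _) = fun=> 0); first exact: cvg_cst.
  by apply/funext => z; rewrite big_nil.
rewrite big_cons (_ : (fun z => _) = fun z => A z i k * B z k j + \sum_(l <- r) A z i l * B z l j).
  exact: cvgD (cvgM (cA i k) (cB k j)) IH.
by apply/funext => z; rewrite big_cons.
Qed.

Lemma ecvg_tr m p (A : X -> 'M[R]_(m, p)) L : ecvg A L -> ecvg (fun z => (A z)^T) L^T.
Proof.
move=> cA i j; rewrite mxE (_ : (fun z => _) = fun z => A z j i) //.
by apply/funext => z; rewrite mxE.
Qed.

Lemma ecvgB m p (A B : X -> 'M[R]_(m, p)) L K :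
  ecvg A L -> ecvg B K -> ecvg (fun z => A z - B z) (L - K).
Proof.
move=> cA cB i j; rewrite addmxE oppmxE (_ : (fun z => _) = fun z => A z i j - B z i j).
  exact: cvgB (cA i j) (cB i j).
by apply/funext => z; rewrite addmxE oppmxE.
Qed.

Lemma ecvgZ m p (c : X -> R) (A : X -> 'M[R]_(m, p)) (a : R) L :
  c @ Fi --> a -> ecvg A L -> ecvg (fun z => c z *: A z) (a *: L).
Proof.
move=> cc cA i j; rewrite scalemxE (_ : (fun z => _) = fun z => c z * A z i j).
  exact: cvgM cc (cA i j).
by apply/funext => z; rewrite scalemxE.
Qed.

Lemma ecvg_cvg m p (A : X -> 'M[R]_(m, p)) L : A @ Fi --> L -> ecvg A L.
Proof.
move=> cA i j.
exact: (cvg_comp _ (fun B : 'M[R]_(m, p) => B i j) cA (@coord_continuous R m p i j L)).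
Qed.

Lemma posdef_ecvg n (A : X -> 'M[R]_n) L : L^T = L -> posdef L -> ecvg A L ->
  \forall z \near Fi, posdef (A z).
Proof.
move=> sL pL cA; have [d d0 hd] := posdef_near sL pL.
have n1 : \forall z \near Fi, forall k : ('I_n * 'I_n)%type, `|L k.1 k.2 - A z k.1 k.2| < d.
  apply: (@filter_forall _ _ (fun k z => `|L k.1 k.2 - A z k.1 k.2| < d) Fi FF) => k.
  by have /cvgrPdist_lt := cA k.1 k.2; apply.
by apply: filterS n1 => z h; apply: hd => i j; exact: (h (i, j)).
Qed.

End EntrywiseConvergence.

(** * Independence of the choice of charts *)

Lemma jacobian_comp3 (R : realType) n (p1 p2 p3 f : 'rV[R]_n -> 'rV[R]_n) (x w : 'rV[R]_n) :
  dmx p1 x -> dmx p2 (p1 x) -> dmx p3 (p2 (p1 x)) -> dmx f x ->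
  (\forall y \near x, p3 (p2 (p1 y)) = f y) ->
  w *m jacobian f x = w *m jacobian p1 x *m jacobian p2 (p1 x) *m jacobian p3 (p2 (p1 x)).
Proof.
move=> d1 d2 d3 df fE.
have h1 := isd_comp w d1 d2; have h2 := isd_comp w h1.1 d3.
pose u := dd w p1 x; pose v := dd u p2 (p1 x).
have e1 : w *m jacobian p1 x = u := jacobian_dd w d1.
have e2 : u *m jacobian p2 (p1 x) = v := jacobian_dd u d2.
have e3 : v *m jacobian p3 (p2 (p1 x)) = dd v p3 (p2 (p1 x)) := jacobian_dd v d3.
have e4 : dd w f x = dd v p3 (p2 (p1 x)).
  exact: etrans (isd_near fE h2).2 (congr1 (fun z => dd z p3 (p2 (p1 x))) h1.2).
apply: etrans (jacobian_dd w df) _; apply: etrans e4 _; apply: esym.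
by rewrite e1 e2.
Qed.

Lemma bform_pull (R : realType) n (A A' B J : 'M[R]_n) u v :
  B = J *m A *m J^T -> A = A' -> v = u *m J -> bform A' v v = bform B u u.
Proof. by move=> -> <- ->; rewrite bform_mul. Qed.

Section ChartChange.
Variables (R : realType) (n : nat).

Lemma open_chart_domain (X Y : topologicalType) (c : chart R n X) (d : chart R n Y) (f : X -> Y) :
  continuous f -> open (local_dom f c d).
Proof.
move=> cf; rewrite openE => x [cx dx]; rewrite /interior.
have n1 : nbhs x (chart_img c) by apply: open_nbhs_nbhs; split=> //; exact: chart_img_open.
have n2 : nbhs (f (chart_inv c x)) (chart_dom d).
  by apply: open_nbhs_nbhs; split=> //; exact: chart_dom_open.
have n3 := chart_inv_cvg cx (cf _ _ n2).
by apply: filterS2 n1 n3 => y; split.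
Qed.

Lemma transition_smx (M : smoothManifold R n) (i i' : chart_index M) :
  smx (local_dom id (chart_at M i) (chart_at M i')) (local_rep id (chart_at M i) (chart_at M i')).
Proof.
have o : open (local_dom id (chart_at M i) (chart_at M i')).
  by apply: open_chart_domain => x; exact: cvg_id.
by apply: smooth_smx => //; apply: smooth_on_open => //; exact: chart_compat.
Qed.

Lemma transition_chart (M : smoothManifold R n) (i i' : chart_index M) p :
  chart_dom (chart_at M i) p ->
  local_rep id (chart_at M i) (chart_at M i') (chart_map (chart_at M i) p) =
  chart_map (chart_at M i') p.
Proof. by move=> pi; rewrite /local_rep (chart_mapP pi).2. Qed.

Variables (M N : smoothManifold R n) (h : riemMetric N) (T : R) (g : R -> riemMetric M).
Variable (F : R -> M -> N).
Hypothesis smooth_F : smooth_map_family `[0, T] F.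

(** Near x the map in the charts i, j is psi o f' o phi, where phi changes charts on M and psi goes
    back from j' to j on N. The Jacobian of phi moves onto w; that of psi is absorbed by the
    transformation law of h. *)
Lemma contact_form_change a b s p i j i' j' w : (`[0, T]%classic : set R) s ->
  chart_dom (chart_at M i) p -> chart_dom (chart_at M i') p ->
  chart_dom (chart_at N j) (F s p) -> chart_dom (chart_at N j') (F s p) ->
  contact_form h g F i j a b s (chart_map (chart_at M i) p) w =
  contact_form h g F i' j' a b s (chart_map (chart_at M i') p)
    (w *m jacobian (local_rep id (chart_at M i) (chart_at M i')) (chart_map (chart_at M i) p)).
Proof.
move=> As pi pi' pj pj'; set x := chart_map _ p; set x' := chart_map _ p.
set phi := local_rep id _ _; pose psi := local_rep id (chart_at N j') (chart_at N j).
have cx : chart_img (chart_at M i) x := (chart_mapP pi).1.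
have xp : chart_inv (chart_at M i) x = p := (chart_mapP pi).2.
have cx' : chart_img (chart_at M i') x' := (chart_mapP pi').1.
have xp' : chart_inv (chart_at M i') x' = p := (chart_mapP pi').2.
have dphi : local_dom id (chart_at M i) (chart_at M i') x.
  split; first exact: cx.
  by rewrite /= xp.
have phix : phi x = x' by exact: transition_chart.
pose f := local_rep (F s) (chart_at M i) (chart_at N j).
pose f' := local_rep (F s) (chart_at M i') (chart_at N j').
have df : local_dom (F s) (chart_at M i) (chart_at N j) x by split; rewrite // xp.
have df' : local_dom (F s) (chart_at M i') (chart_at N j') x' by split; rewrite // xp'.
have f'x : f' x' = chart_map (chart_at N j') (F s p) by rewrite /f' /local_rep xp'.
have [cj' jp'] := chart_mapP pj'.
have dpsi : local_dom id (chart_at N j') (chart_at N j) (f' x').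
  by rewrite f'x; split; rewrite //= jp'.
have psix : psi (f' x') = f x.
  by rewrite f'x /psi transition_chart// /f /local_rep xp.
have mphi := smx_dmx (transition_smx i i') dphi.
have mpsi := smx_dmx (transition_smx j' j) dpsi.
have mf := smx_dmx (local_rep_smx smooth_F i j As) df.
have mf' := smx_dmx (local_rep_smx smooth_F i' j' As) df'.
have fE : \forall y \near x, psi (f' (phi y)) = f y.
  have n1 := smx_near (transition_smx i i') dphi.
  have n2 : \forall y \near x, local_dom (F s) (chart_at M i) (chart_at N j') y.
    apply: (smx_near (local_rep_smx smooth_F i j' As)); split=> //; first by rewrite xp.
  apply: filterS2 n1 n2 => y [cy dy] [_ dy'].
  rewrite /f' /local_rep (_ : chart_inv _ (phi y) = chart_inv (chart_at M i) y); last first.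
    exact: (chart_mapP dy).2.
  by rewrite /psi /local_rep /= (chart_mapP dy').2.
have Jf : w *m jacobian f x = w *m jacobian phi x *m jacobian f' x' *m jacobian psi (f' x').
  by rewrite -phix in mf' mpsi *; exact: (jacobian_comp3 w mphi mf' mpsi mf fE).
rewrite /contact_form; congr (_ - _ * _).
  have e : g s i x = jacobian phi x *m g s i' (phi x) *m (jacobian phi x)^T.
    exact: (tensor_transform (g s) dphi).
  by rewrite e bform_mul phix.
have e : h j' (f' x') = jacobian psi (f' x') *m h j (psi (f' x')) *m (jacobian psi (f' x'))^T.
  exact: (tensor_transform h dpsi).
apply: etrans (bform_mul (h j (f x)) (jacobian f x) w w) _.
apply: etrans _ (esym (bform_mul (h j' (f' x')) (jacobian f' x') _ _)).
exact: (bform_pull e (congr1 (h j) psix) Jf).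
Qed.

(** One pair of charts is enough to establish positivity at p; [noncontact_all] recovers every other
    pair. *)
Definition noncontact a b s (p : M) := exists i j,
  [/\ chart_dom (chart_at M i) p, chart_dom (chart_at N j) (F s p) &
      forall w, w != 0 -> 0 < contact_form h g F i j a b s (chart_map (chart_at M i) p) w].

Lemma noncontact_all a b s p i j : (`[0, T]%classic : set R) s -> noncontact a b s p ->
  chart_dom (chart_at M i) p -> chart_dom (chart_at N j) (F s p) ->
  forall w, w != 0 -> 0 < contact_form h g F i j a b s (chart_map (chart_at M i) p) w.
Proof.
move=> As [i' [j' [pi' pj' H]]] pi pj w w0.
rewrite (contact_form_change a b w As pi pi' pj pj'); apply: H.
have [cx xp] := chart_mapP pi.
have dphi : local_dom id (chart_at M i) (chart_at M i') (chart_map (chart_at M i) p).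
  by split; rewrite //= xp.
(* The Jacobian kills no nonzero vector, since g in the first chart is positive definite and is a
   pullback through it. *)
apply/eqP => J0.
have e := tensor_transform (g s) dphi; cbv zeta in e.
have := @metric_pos _ _ _ (g s) i _ cx w w0.
by rewrite e bform_mul J0 /bform !mul0mx mxE ltxx.
Qed.

End ChartChange.

(** * Persistence of positivity in space and time *)

Section Noncontact.
Variables (R : realType) (n : nat) (M N : smoothManifold R n).
Hypothesis compactM : compact [set: M].
Variables (h : riemMetric N) (T : R) (g : R -> riemMetric M) (F : R -> M -> N).
Hypothesis smooth_g : smooth_metric_family `[0, T] g.
Hypothesis smooth_F : smooth_map_family `[0, T] F.
Let A : set R := `[0, T].

Lemma cvg_within_nbhs (X Y : topologicalType) (D : set X) (f : X -> Y) x :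
  {for x, continuous f} -> f @ within D (nbhs x) --> f x.
Proof.
move=> cf P nP; have n1 : \forall z \near x, P (f z) by exact: (cf P nP).
have n2 : \forall z \near x, D z -> P (f z) by apply: filterS n1 => z Pz _.
exact: n2.
Qed.

Lemma near_within (X : topologicalType) (D : set X) (x : X) (P : X -> Prop) :
  (\forall z \near x, D z -> P z) -> \forall z \near within D (nbhs x), P z.
Proof. by []. Qed.

Section Charts.
Variables (i : chart_index M) (j : chart_index N) (s : R) (x : 'rV[R]_n).
Hypothesis As : A s.
Hypothesis dx : local_dom (F s) (chart_at M i) (chart_at N j) x.
Let D := [set z : R * 'rV[R]_n | A z.1].
Let Fi := within D (nbhs (s, x)).
Let FiF : Filter Fi := within_filter _ _.
Let rep t := local_rep (F t) (chart_at M i) (chart_at N j).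

Lemma metric_ecvg : ecvg Fi (fun z => g z.1 i z.2) (g s i x).
Proof.
have [|U [ge [[oU Ux] sge geg]]] := @smooth_g i (s, x); first by split=> //; exact: dx.1.
have n1 : \forall z \near (s, x), U z := open_nbhs_nbhs (conj oU Ux).
have n2 : \forall z \near (s, x), chart_img (chart_at M i) z.2.
  have nx : nbhs x (chart_img (chart_at M i)).
    by apply: open_nbhs_nbhs; split; [exact: chart_img_open|exact: dx.1].
  by apply: (@cvg_snd _ _ (nbhs s) (nbhs x)).
have e : \forall z \near Fi, ge z = g z.1 i z.2.
  by apply: near_within; apply: filterS2 n1 n2 => z Uz cz Az; exact: geg.
apply: (ecvg_near e); have <- : ge (s, x) = g s i x by apply: geg => //; split=> //; exact: dx.1.
by apply: ecvg_cvg; apply: cvg_within_nbhs; exact: smooth_open_continuous sge Ux.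
Qed.

(** Row k of the Jacobian is the derivative along (0, e_k) of a smooth extension in space and time,
    hence jointly continuous. *)
Lemma jacobian_ecvg : ecvg Fi (fun z => jacobian (rep z.1) z.2) (jacobian (rep s) x).
Proof.
move=> k l; have [U [fe [oU Ux sfe nfe]]] := family_extension smooth_F (delta_mx 0 k) As dx.
have e z : 'D_((0, delta_mx 0 k) : R * 'rV[R]_n) fe z =
    delta_mx 0 k *m jacobian (rep z.1) z.2 ->
    'D_((0, delta_mx 0 k) : R * 'rV[R]_n) fe z 0 l = jacobian (rep z.1) z.2 k l.
  by move=> ->; rewrite -rowE mxE.
have [_ _ _ v0] := nbhs_singleton nfe As.
have lim0 := e (s, x) (esym v0).
have c : ecvg Fi ('D_((0, delta_mx 0 k) : R * 'rV[R]_n) fe)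
    ('D_((0, delta_mx 0 k) : R * 'rV[R]_n) fe (s, x)).
  apply: ecvg_cvg; apply: cvg_within_nbhs.
  by apply: smooth_open_continuous Ux; exact: smooth_open_derive.
have c0 : (fun z => 'D_((0, delta_mx 0 k) : R * 'rV[R]_n) fe z 0 l) @ Fi -->
  (jacobian (rep s) x k l : R) := eq_ind _ (fun y : R => _ --> y) (c 0 l) _ lim0.
apply: cvg_trans c0; apply: near_eq_cvg; apply: near_within.
by apply: filterS nfe => z hz Az; have [_ _ _ vz] := hz Az; exact: (e z (esym vz)).
Qed.

Lemma target_metric_ecvg : ecvg Fi (fun z => h j (rep z.1 z.2)) (h j (rep s x)).
Proof.
have [U [fe [oU Ux sfe nfe]]] := family_extension smooth_F 0 As dx.
have [_ _ f0 _] := nbhs_singleton nfe As.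
have f0' : fe (s, x) = rep s x := f0.
rewrite -f0'; have cf : {for (s, x), continuous fe} := smooth_open_continuous sfe Ux.
have Wx : chart_img (chart_at N j) (fe (s, x)).
  by rewrite f0'; exact: local_rep_img dx.
have ch : {for fe (s, x), continuous (h j)}.
  apply: smooth_open_continuous Wx; apply: smooth_on_open; first exact: chart_img_open.
  exact: metric_smooth.
have e : \forall z \near Fi, h j (fe z) = h j (rep z.1 z.2).
  apply: near_within; apply: filterS nfe => z hz Az; have [_ _ fz _] := hz Az.
  exact: (congr1 (h j) fz).
apply: (ecvg_near e); apply: ecvg_cvg.
by apply: (@cvg_within_nbhs _ _ _ (fun z => h j (fe z))); exact: (continuous_comp cf ch).
Qed.

(** The matrix of Z depends continuously on time and point together, and positive definiteness is an
    open condition. *)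
Lemma contact_near a b :
  (forall w, w != 0 -> 0 < contact_form h g F i j a b s x w) ->
  \forall z \near (s, x), A z.1 -> forall w, w != 0 -> 0 < contact_form h g F i j a b z.1 z.2 w.
Proof.
move=> H; pose Z (z : R * 'rV[R]_n) := g z.1 i z.2 - (a - b * z.1) *: pullback_form (h j) (rep z.1) z.2.
have ZE z w : bform (Z z) w w = contact_form h g F i j a b z.1 z.2 w.
  by rewrite /Z bformB bformZ.
have cc : (fun z : R * 'rV[R]_n => a - b * z.1) @ Fi --> a - b * s.
  have c1 : (fun z : R * 'rV[R]_n => z.1) @ Fi --> s.
    apply: (@cvg_within_nbhs _ _ _ fst (s, x)); exact: cvg_fst.
  exact: cvgB (cvg_cst a) (cvgM (cvg_cst b) c1).
have cZ : ecvg Fi Z (Z (s, x)).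
  apply: ecvgB metric_ecvg _; apply: ecvgZ cc _.
  exact: ecvgM (ecvgM jacobian_ecvg target_metric_ecvg) (ecvg_tr jacobian_ecvg).
have sZ : (Z (s, x))^T = Z (s, x).
  have e1 : (g s i x)^T = g s i x := tensor_sym (g s) dx.1.
  have e2 : (h j (rep s x))^T = h j (rep s x) := tensor_sym h (local_rep_img dx).
  rewrite /Z /pullback_form /= !(trmxE, trmx_mul) linearZ/= !trmx_mul trmxK.
  by rewrite e1 e2 mulmxA.
have pZ : posdef (Z (s, x)) by move=> w w0; rewrite ZE; exact: H.
have := posdef_ecvg sZ pZ cZ; rewrite /Fi => nZ.
have {}nZ : \forall z \near (s, x), A z.1 -> posdef (Z z) by exact: nZ.
by apply: filterS nZ => z hz Az w w0; rewrite -ZE; exact: hz.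
Qed.

End Charts.

Lemma noncontact_near a b s p : A s -> noncontact h g F a b s p ->
  \forall z \near (s, p), A z.1 -> noncontact h g F a b z.1 z.2.
Proof.
move=> As [i [j [pi pj H]]].
have dx : local_dom (F s) (chart_at M i) (chart_at N j) (chart_map (chart_at M i) p).
  by split; [exact: (chart_mapP pi).1|rewrite (chart_mapP pi).2].
have n1 := contact_near As dx H.
have c : (fun z : R * M => (z.1, chart_map (chart_at M i) z.2)) @ (s, p) -->
    (s, chart_map (chart_at M i) p).
  apply: (@cvg_pair _ _ _ _ (nbhs s) (nbhs (chart_map (chart_at M i) p))); first exact: cvg_fst.
  apply: (@cvg_comp _ _ _ snd (chart_map (chart_at M i)) _ (nbhs p)); first exact: cvg_snd.
  exact: chart_map_cvg.
have n2 : \forall z \near (s, p), A z.1 -> forall w, w != 0 ->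
  0 < contact_form h g F i j a b z.1 (chart_map (chart_at M i) z.2) w by exact: (c _ n1).
have n3 : \forall z \near (s, p), chart_dom (chart_at M i) z.2.
  have np : nbhs p (chart_dom (chart_at M i)).
    by apply: open_nbhs_nbhs; split; [exact: chart_dom_open|].
  by apply: (@cvg_snd _ _ (nbhs s) (nbhs p)).
have n4 : \forall z \near (s, p), A z.1 -> chart_dom (chart_at N j) (F z.1 z.2).
  apply: (family_near smooth_F As); apply: open_nbhs_nbhs; split; [exact: chart_dom_open|exact: pj].
apply: filterS3 n2 n3 n4 => z h2 h3 h4 Az; exists i, j.
by split; [exact: h3|exact: h4|exact: h2].
Qed.

(** Tube lemma: compactness of M turns the neighbourhoods of the points (s, p) into one
    neighbourhood of s. *)
Lemma noncontact_tube a b s : A s -> (forall p, noncontact h g F a b s p) ->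
  \forall t \near s, A t -> forall p, noncontact h g F a b t p.
Proof.
move=> As H; have /compact_near_coveringP nc := compactM.
pose P t p := A t -> noncontact h g F a b t p.
have : \forall t \near s, [set: M] `<=` P t.
  apply: (nc _ (nbhs s) P (nbhs_filter s)) => p _; have n1 := noncontact_near As (H p).
  have c : (fun z : M * R => (z.2, z.1)) @ (p, s) --> (s, p).
    by apply: (@cvg_pair _ _ _ _ (nbhs s) (nbhs p)); [exact: cvg_snd|exact: cvg_fst].
  exact: (c _ n1).
by apply: filterS => t h' At p; exact: (h' p I At).
Qed.

End Noncontact.
(** Here P = F^*h(v, v) and G = g(v, v) at time 0. If P > 0 the term e P makes the inequality
    strict, and if P = 0 the positivity of G does. *)
Lemma initial_arith (R : realFieldType) (L e P G : R) : 0 < L -> 0 < e -> 0 < G -> 0 <= P ->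
  P <= L ^+ 2 * G -> 0 < G - (L ^- 2 - e) * P.
Proof.
move=> L0 e0 G0 P0 PG; have L2 : 0 < L ^+ 2 by rewrite exprn_gt0.
have h : L ^- 2 * P <= G by rewrite mulrC ler_pdivrMr// mulrC.
have [P1|P1] := ltP 0 P; last by have := le_anti (introT andP (conj P1 P0)) => ->; rewrite mulr0 subr0.
have : 0 < e * P by rewrite mulr_gt0.
move: (L ^- 2) h => l h; lra.
Qed.

(** The expression in the hypothesis equals G - (l - m t) P + e (1 + t) P. For P > 0, taking e
    proportional to 1 / ((1 + t) P) makes the last term arbitrarily small; for P <= 0 it has the
    right sign already, and e = 1 will do. *)
Lemma epsilon_arith (R : realFieldType) (l m t P G : R) : 0 <= t ->
  (forall e, 0 < e -> 0 < G - (l - e - (m + e) * t) * P) -> (l - m * t) * P <= G.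
Proof.
move=> t0 H; have [P0|P0] := leP P 0.
  rewrite leNgt; apply/negP => h; have := H 1 ltr01.
  have : (1 + t) * P <= 0 by rewrite mulr_ge0_le0// addr_ge0.
  by lra.
apply/ler_addgt0Pr => e e0.
have d0 : 0 < (1 + t) * P by rewrite mulr_gt0// ltr_pwDl.
have := H (e / ((1 + t) * P)) (divr_gt0 e0 d0).
have -> : G - (l - e / ((1 + t) * P) - (m + e / ((1 + t) * P)) * t) * P =
    G - (l - m * t) * P + e.
  by field; rewrite !lt0r_neq0// ltr_pwDl.
by rewrite -ltrBlDr sub0r ltrNl opprB => h; rewrite -lerBlDr ltW// ltrBlDr -ltrBlDl.
Qed.

Theorem theorem2p1 (R : realType) (n : nat) (M N : smoothManifold R n)
  (compactM : compact [set: M]) (compactN : compact [set: N])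
  (g0 : riemMetric M) (h : riemMetric N)
  (f : M -> N) (smooth_f : smooth_map f)
  (Lambda : R) (Lambda_gt0 : 0 < Lambda)
  (f_le : pullback_le 1 f h (Lambda ^+ 2) g0)
  (T : R) (T_ge0 : 0 <= T)
  (g : R -> riemMetric M) (k : R -> symTensor M)
  (smooth_g : smooth_metric_family `[0, T] g)
  (g_init : eq_metric (g 0) g0)
  (g_evol : metric_evolution `[0, T] g k)
  (k_ric : forall t : R, 0 <= t <= T -> plus_ricci_ge0 (k t) (g t))
  (F : R -> M -> N)
  (smooth_F : smooth_map_family `[0, T] F)
  (F_flow : harmonic_map_heat_flow `[0, T] g h F)
  (F_init : F 0 = f)
  (kappa : R) (kappa_ge0 : 0 <= kappa)
  (curv_h : sectional_le h kappa \/
            (sectional_ge0 h /\ ricci_le h ((n%:R - 1) * kappa))) :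
  forall t : R, 0 <= t <= T ->
    pullback_le (Lambda ^- 2 - 2 * (n%:R - 1) * kappa * t) (F t) h 1 (g t).
Proof.
have bound i j x w t e : 0 <= t <= T -> local_dom (F t) (chart_at M i) (chart_at N j) x ->
    w != 0 -> 0 < e ->
    0 < contact_form h g F i j (Lambda ^- 2 - e) (2 * ((n%:R - 1) * kappa) + e) t x w.
  (* The constants of phi(s) = a - b s: a is below Lambda^-2 for the start, b above 2 (n - 1) kappa
     for [no_contact]. *)
  move=> tT dx w0 e0; set a := _ - e; set b := _ + e.
  have itvP (s : R) : 0 <= s <= T -> (`[0, T]%classic : set R) s by rewrite /= in_itv.
  have domP s p i' j' : chart_dom (chart_at M i') p -> chart_dom (chart_at N j') (F s p) ->
      local_dom (F s) (chart_at M i') (chart_at N j') (chart_map (chart_at M i') p).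
    by move=> pi pj; split; [exact: (chart_mapP pi).1|rewrite (chart_mapP pi).2].
  (* The property carried through time is positivity at all points of M together, so that the tube
     lemma applies. *)
  have key : forall s, 0 <= s <= T -> forall p, noncontact h g F a b s p.
    apply: time_induction.
    - move=> p; have [i' pi] := chart_cover p; have [j' pj] := chart_cover (F 0 p).
      exists i', j'; split=> // v v0.
      have dp := domP _ _ _ _ pi pj.
      have Gv : 0 < bform (g 0 i' (chart_map (chart_at M i') p)) v v.
        exact: (@metric_pos _ _ _ (g 0) i' _ dp.1 v v0).
      have fl : bform (1 *: pullback_form (h j') (local_rep (F 0) (chart_at M i') (chart_at N j'))
            (chart_map (chart_at M i') p)) v v <=
          bform (Lambda ^+ 2 *: g0 i' (chart_map (chart_at M i') p)) v v.
        by move: dp; rewrite F_init => dp; exact: f_le dp v.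
      have P0 : 0 <= bform (pullback_form (h j') (local_rep (F 0) (chart_at M i') (chart_at N j'))
            (chart_map (chart_at M i') p)) v v.
        rewrite bform_mul.
        exact: (posdef_semidef (metric_on_pos (chart_metric_on h j') (local_rep_img dp))).
      move: fl; rewrite -(g_init i' _ dp.1) !bformZ mul1r /contact_form mulr0 subr0.
      exact: initial_arith.
    - move=> s sT H; have := noncontact_tube compactM smooth_g smooth_F (itvP s sT) H.
      by apply: filterS => u hu uT; apply: hu; exact: itvP.
    - move=> s sT H p; have [i' pi] := chart_cover p; have [j' pj] := chart_cover (F s p).
      exists i', j'; split=> // v v0.
      have sT' : 0 <= s <= T by case/andP: sT => /ltW -> ->.
      apply: (no_contact g_evol smooth_F F_flow sT (domP _ _ _ _ pi pj) kappa_ge0 _ _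
        (k_ric s sT') curv_h v0).
        by rewrite /b ltrDl.
      move=> u y us dy z; have uT : 0 <= u <= T.
        case/andP: us => -> /ltW us; case/andP: sT => _; exact: le_trans us.
      (* [noncontact] concerns nonzero vectors; at z = 0 the form vanishes, which still meets the
         weak inequality. *)
      have [->|z0] := eqVneq z 0.
        by rewrite /contact_form /bform !mul0mx mxE mulr0 subr0.
      have [yi yj] := dy; have [pd py] := chart_invP yi.
      have := noncontact_all smooth_F (itvP u uT) (H u us (chart_inv (chart_at M i') y)) pd yj z0.
      by rewrite py => /ltW.
  have [xi xj] := dx; have [pd px] := chart_invP xi.
  have := noncontact_all smooth_F (itvP t tT) (key t tT (chart_inv (chart_at M i) x)) pd xj w0.
  by rewrite px.
move=> t tT i j x dx w; have [->|w0] := eqVneq w 0.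
  by rewrite /bform !mul0mx mxE.
rewrite !bformZ mul1r -(mulrA 2); have t0 : 0 <= t by case/andP: tT.
apply: (epsilon_arith t0) => e e0; exact: (bound i j x w t e tT dx w0 e0).
Qed.
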